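(* Let $\Delta\subset\mathbb R^3$ be an arbitrary non-degenerate convex lattice polytope. Then there is a bounded function $r(n)=O(1)$, depending only on $\Delta$, such that for every $n\ge 1$ there exists a singular tropical surface $S_n$ with Newton polytope $n\Delta$ which is of maximal-dimensional geometric type and has at least $2n\cdot \mathrm{ld}_\infty(\Delta)+r(n)$ tropical singular points.
   Context: ''Non-degenerate'' means three-dimensional. The lattice diameter $\mathrm{ld}(\Delta)$ is the maximal lattice length of a segment with endpoints in $\Delta\cap\mathbb Z^3$, and $\mathrm{ld}_\infty(\Delta)=\lim_{n\to\infty}\mathrm{ld}(n\Delta)/n$. Let $\mathbb K=\bigcup_{m\ge1}\mathbb C\{t^{1/m}\}$ be the field of locally convergent complex Puiseux series with $\mathrm{Val}(\sum_r a_rt^r)=-\min\{r: a_r\ne0\}$. For a lattice polytope $\Delta'$, a tropical surface with Newton polytope $\Delta'$ is the corner locus of a tropical polynomial $F(X)=\max_{\omega\in\Delta'\cap\mathbb Z^3}(c_\omega+\langle\omega,X\rangle)$; its dual subdivision of $\Delta'$ is formed by the linearity domains of the convex piecewise linear function on $\Delta'$ whose graph is the lower part of the convex hull of the points $(\omega,-c_\omega)$. The surface is singular if it is the tropicalization of an algebraic surface in $(\mathbb K^* )^3$ with Newton polytope $\Delta'$ having a singular point in $(\mathbb K^* )^3$. A point of a singular tropical surface $S$ is a tropical singular point if it is the tropicalization (coordinatewise $\mathrm{Val}$) of a singular point in $(\mathbb K^* )^3$ of some algebraic surface with Newton polytope $\Delta'$ tropicalizing to $S$; different tropical singular points of $S$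 may come from different algebraic surfaces. A singular tropical surface with Newton polytope $\Delta'$ is of maximal-dimensional geometric type if its deformation space (the set of coefficient vectors, modulo $(1,\dots,1)$, of singular tropical surfaces with the same dual subdivision) has dimension $|\Delta'\cap\mathbb Z^3|-2$, the maximal possible value for singular surfaces with Newton polytope $\Delta'$.
   Formalization: For n = 1 the existence of a singular tropical surface of maximal-dimensional geometric type with Newton polytope Δ is assumed, since it can fail (the unit simplex carries no singular surface); for n ≥ 2 nothing is assumed. *)

(* Defs.v *)
From HB Require Import structures.
From mathcomp Require Import all_boot all_order all_algebra.
From mathcomp Require Import finmap complex.
From mathcomp Require Import all_classical all_reals all_analysis.
From mathcomp Require Import ring lra zify.

Set Implicit Arguments.
Unset Strict Implicit.
Unset Printing Implicit Defensive.

Import Order.TTheory GRing.Theory Num.Theory numFieldNormedType.Exports.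

Local Open Scope classical_set_scope.
Local Open Scope ring_scope.
Local Open Scope complex_scope.

(* Power series over R[i] as coefficient sequences; [geo_bounded f] means that
   $\sum_n f_n x^n$ has positive radius of convergence. *)
Section PowerSeries.
Variable R : realType.
Local Notation normc := (@Normc.normc R).
Implicit Types (f g h : nat -> R[i]) (n : nat).

Definition cauchy f g n : R[i] := \sum_(i < n.+1) f i * g (n - i)%N.

Definition geo_bounded f : Prop :=
  exists2 B : R, 1 <= B & forall n, normc (f n) <= B ^+ n.+1.

Lemma normc_ge0 (x : R[i]) : 0 <= normc x.
Proof. by case: x => a b; exact: sqrtr_ge0. Qed.

Lemma normc_sum n (F : 'I_n -> R[i]) : normc (\sum_i F i) <= \sum_i normc (F i).
Proof.
elim/big_ind2 : _ => //; first by rewrite Normc.normc0.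
by move=> x a y b xa yb; apply: le_trans (le_normcD _ _) (lerD xa yb).
Qed.

Lemma cauchy_poly N f g n : (n < N)%N ->
  cauchy f g n = (\poly_(i < N) f i * \poly_(i < N) g i)`_n.
Proof.
move=> nN; rewrite coefM; apply: eq_bigr => i _.
by rewrite !coef_poly !ifT//; have := ltn_ord i; lia.
Qed.

Lemma cauchyC f g : cauchy f g = cauchy g f.
Proof. by apply/funext => n; rewrite !(@cauchy_poly n.+1)// mulrC. Qed.

Lemma cauchyA f g h : cauchy f (cauchy g h) = cauchy (cauchy f g) h.
Proof.
apply/funext => n.
have -> : cauchy f (cauchy g h) n = (\poly_(i < n.+1) f i *
    (\poly_(i < n.+1) g i * \poly_(i < n.+1) h i))`_n.
  rewrite coefM; apply: eq_bigr => i _; rewrite coef_poly ltn_ord.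
  by rewrite -cauchy_poly// ltnS leq_subr.
rewrite cauchyC mulrA mulrC coefM; apply: eq_bigr => i _.
by rewrite coef_poly ltn_ord -cauchy_poly// ltnS leq_subr.
Qed.

Lemma cauchyDl f g h :
  cauchy (fun n => f n + g n) h = (fun n => cauchy f h n + cauchy g h n).
Proof.
by apply/funext => n; rewrite -big_split; apply: eq_bigr => i _; rewrite mulrDl.
Qed.

Lemma cauchy1l f : cauchy (fun n => (n == 0)%:R) f = f.
Proof.
apply/funext => n; rewrite /cauchy big_ord_recl/= mul1r subn0 big1 ?addr0// => i _.
by rewrite mul0r.
Qed.

Lemma geo_bounded_cauchy f g :
  geo_bounded f -> geo_bounded g -> geo_bounded (cauchy f g).
Proof.
move=> [B B1 fB] [D D1 gD].
wlog: B D B1 D1 fB gD / B = D => [wlg|BD].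
  have B0 : 0 <= B by apply: le_trans B1.
  have D0 : 0 <= D by apply: le_trans D1.
  apply: (wlg (B + D) (B + D)) => //; try by lra.
  - by move=> n; apply: le_trans (fB n) _; rewrite ler_pXn2r ?nnegrE//; lra.
  - by move=> n; apply: le_trans (gD n) _; rewrite ler_pXn2r ?nnegrE//; lra.
subst D; have B0 : 0 < B by apply: lt_le_trans B1.
exists (2 * B ^+ 2); first by have := exprn_ege1 2 B1; lra.
move=> n; apply: le_trans (normc_sum _) _.
apply: (@le_trans _ _ (\sum_(i < n.+1) B ^+ n.+2)).
  apply: ler_sum => i _; rewrite Normc.normcM.
  apply: le_trans (ler_pM (normc_ge0 _) (normc_ge0 _) (fB _) (gD _)) _.
  rewrite -exprD (_ : (_ + _)%N = n.+2)//.
  by have := ltn_ord i; lia.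
rewrite sumr_const card_ord exprMn -(mulr_natl (B ^+ n.+2)); apply: ler_pM.
- exact: ler0n.
- by rewrite exprn_ge0// ltW.
- by rewrite -natrX ler_nat ltnW// ltn_expl.
- by rewrite -exprM ler_weXn2l//; lia.
Qed.

Lemma geo_boundedD f g :
  geo_bounded f -> geo_bounded g -> geo_bounded (fun n => f n + g n).
Proof.
move=> [B B1 fB] [D D1 gD]; exists (B + D); first by lra.
move=> n; apply: le_trans (le_normcD _ _) _; apply: le_trans (lerD (fB n) (gD n)) _.
have B0 : 0 <= B by lra. have D0 : 0 <= D by lra.
elim: n => [|n IH]; first by rewrite !expr1.
rewrite exprS (exprS D) (exprS (B + D)).
have := exprn_ge0 n.+1 B0; have := exprn_ge0 n.+1 D0; nra.
Qed.

Lemma geo_boundedN f : geo_bounded f -> geo_bounded (fun n => - f n).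
Proof. by move=> [B B1 fB]; exists B => // n; rewrite normcN. Qed.

Lemma geo_bounded_single (x : R[i]) :
  geo_bounded (fun n => if n == 0 then x else 0).
Proof.
exists (1 + normc x); first by have := normc_ge0 x; lra.
have x0 := normc_ge0 x.
move=> n; case: eqP => [->|_]; first by rewrite expr1; lra.
by rewrite Normc.normc0 exprn_ge0//; lra.
Qed.

Definition spread d f n := if (d %| n)%N then f (n %/ d)%N else 0.

Lemma geo_bounded_spread d f : geo_bounded f -> geo_bounded (spread d f).
Proof.
move=> [B B1 fB]; exists B => // n; rewrite /spread; case: ifP => _; last first.
  by rewrite Normc.normc0 exprn_ge0//; lra.
by apply: le_trans (fB _) _; rewrite ler_weXn2l// ltnS leq_div.
Qed.

Definition delay d f n := if (d <= n)%N then f (n - d)%N else 0.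

Lemma geo_bounded_delay d f : geo_bounded f -> geo_bounded (delay d f).
Proof.
move=> [B B1 fB]; exists B => // n; rewrite /delay; case: ifP => _; last first.
  by rewrite Normc.normc0 exprn_ge0//; lra.
by apply: le_trans (fB _) _; rewrite ler_weXn2l// ltnS leq_subr.
Qed.

Lemma geo_bounded_advance d f : geo_bounded f -> geo_bounded (fun n => f (d + n)%N).
Proof.
move=> [B B1 fB]; exists (B ^+ d.+1); first by rewrite exprn_ege1.
by move=> n; apply: le_trans (fB _) _; rewrite -exprM ler_weXn2l//; lia.
Qed.

Fixpoint inv_coefs f n : seq R[i] :=
  if n is m.+1 then
    let s := inv_coefs f m in
    rcons s (if m == 0 then (f 0)^-1
             else - (f 0)^-1 * \sum_(i < m) f (m - i)%N * nth 0 s i)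
  else [::].

Definition cinv f n : R[i] := nth 0 (inv_coefs f n.+1) n.

Lemma size_inv_coefs f n : size (inv_coefs f n) = n.
Proof. by elim: n => //= n IH; rewrite size_rcons IH. Qed.

Lemma nth_inv_coefs f n i : (i < n)%N -> nth 0 (inv_coefs f n) i = cinv f i.
Proof.
elim: n => // n IH; rewrite ltnS leq_eqVlt => /orP[/eqP ->//|lt_in].
by rewrite /= nth_rcons size_inv_coefs lt_in IH.
Qed.

Lemma cinv0 f : cinv f 0 = (f 0)^-1. Proof. by []. Qed.

Lemma cinvS f n :
  cinv f n.+1 = - (f 0)^-1 * \sum_(i < n.+1) f (n.+1 - i)%N * cinv f i.
Proof.
rewrite /cinv [inv_coefs f n.+2]/= -/(inv_coefs f n.+1).
rewrite nth_rcons size_rcons size_inv_coefs ltnn eqxx; congr (_ * _).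
by apply: eq_bigr => i _; congr (_ * _); exact: nth_inv_coefs.
Qed.

Lemma cauchyV f : f 0 != 0 -> cauchy (cinv f) f = (fun n => (n == 0)%:R).
Proof.
move=> f0; apply/funext => -[|n].
  by rewrite /cauchy big_ord1 cinv0 mulVf.
rewrite /cauchy big_ord_recr/= subnn cinvS mulrC mulrA mulrN mulfV// mulN1r.
by apply/eqP; rewrite subr_eq0; apply/eqP/eq_bigr => i _; rewrite mulrC.
Qed.

Lemma geo_bounded_cinv f : f 0 != 0 -> geo_bounded f -> geo_bounded (cinv f).
Proof.
move=> f0 [B B1 fB]; set a := normc (f 0)^-1.
have a0 : 0 <= a by exact: normc_ge0.
have B0 : 0 < B by lra.
pose E := 2 + a * B.
have E2 : 2 <= E by rewrite lerDl mulr_ge0//; lra.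
exists (B * E); first by nra.
move=> n; elim/ltn_ind : n => -[_|n IH].
  have BB1 : 0 <= B * B - 1 by nra.
  by rewrite cinv0 -/a expr1 /E; have := mulr_ge0 a0 BB1; lra.
rewrite cinvS Normc.normcM normcN -/a.
apply: (@le_trans _ _ (a * (B ^+ n.+3 * \sum_(i < n.+1) E ^+ i.+1))).
  rewrite ler_wpM2l//; apply: le_trans (normc_sum _) _; rewrite mulr_sumr.
  apply: ler_sum => i _; rewrite Normc.normcM.
  apply: le_trans (ler_pM (normc_ge0 _) (normc_ge0 _) (fB _) (IH _ (ltn_ord i))) _.
  rewrite exprMn mulrA -exprD (_ : (_ + _)%N = n.+3)//.
  by have := ltn_ord i; lia.
have sumE : (E - 1) * \sum_(i < n.+1) E ^+ i.+1 <= E ^+ n.+2.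
  have -> : \sum_(i < n.+1) E ^+ i.+1 = E * \sum_(i < n.+1) E ^+ i.
    by rewrite mulr_sumr; apply: eq_bigr => i _; rewrite exprS.
  rewrite mulrCA -subrX1 (exprS E n.+1).
  by rewrite ler_wpM2l//; lra.
have S0 : 0 <= \sum_(i < n.+1) E ^+ i.+1.
  by apply: sumr_ge0 => i _; apply: exprn_ge0; lra.
set S := \sum_(i < n.+1) _ in sumE S0 *.
rewrite exprMn (exprS B n.+2).
rewrite [leLHS](_ : _ = B ^+ n.+2 * (a * B * S)); last by ring.
apply: ler_wpM2l; first by rewrite exprn_ge0// ltW.
by apply: le_trans sumE; rewrite ler_wpM2r// /E; lra.
Qed.

End PowerSeries.

Section Puiseux.
Variable R : realType.
Local Notation normc := (@Normc.normc R).
Implicit Types (a b c : rat -> R[i]) (f g : nat -> R[i]) (m : nat) (k : int).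

(* [a q] is the coefficient of $t^q$: the exponents lie in $\frac1m\mathbb Z$,
   are bounded below by $k/m$, and the resulting power series in $t^{1/m}$ has
   positive radius of convergence. *)
Definition is_puiseux a : Prop := exists (m : nat) (k : int),
  [/\ (0 < m)%N,
      forall q, a q != 0 -> exists n : nat, q = (k%:~R + n%:R) / m%:R &
      exists2 rho : R, 0 < rho &
        cvgn (series (fun n => normc (a ((k%:~R + n%:R) / m%:R)) * rho ^+ n))].

(* For Puiseux series only finitely many terms of the sum are nonzero. *)
Definition pmul a b (q : rat) : R[i] := \sum_(s \in [set: rat]) a s * b (q - s).

(* $\sum_n f_n t^{(k+n)/m}$ *)
Definition pseries m k f (q : rat) : R[i] :=
  let x := q * m%:R - k%:~R in
  if x \is a Num.nat then f (Num.truncn x) else 0.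

Lemma pseriesE m k f n : (0 < m)%N ->
  pseries m k f ((k%:~R + n%:R) / m%:R) = f n.
Proof.
move=> m0; rewrite /pseries divfK ?pnatr_eq0 -?lt0n//.
by rewrite addrC addKr natr_nat natrK.
Qed.

Lemma pseries_neq0 m k f q : (0 < m)%N -> pseries m k f q != 0 ->
  exists2 n : nat, q = (k%:~R + n%:R) / m%:R & f n != 0.
Proof.
move=> m0; rewrite /pseries; case: ifP => [/natrP[n xn]|_]; last by rewrite eqxx.
rewrite xn natrK => fn; exists n => //.
by rewrite -xn addrC subrK mulfK// pnatr_eq0 -lt0n.
Qed.

Lemma eq_pseries m k f a : (0 < m)%N ->
  (forall q, a q != 0 -> exists n : nat, q = (k%:~R + n%:R) / m%:R) ->
  (forall n, a ((k%:~R + n%:R) / m%:R) = f n) -> a = pseries m k f.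
Proof.
move=> m0 sa fa; apply/funext => q; apply: contrapT => /eqP nq.
have [n qn] : exists n : nat, q = (k%:~R + n%:R) / m%:R.
  case: (eqVneq (a q) 0) nq => [->|/sa//].
  by rewrite eq_sym => /(pseries_neq0 m0)[n -> _]; exists n.
by move: nq; rewrite qn pseriesE// fa eqxx.
Qed.

Lemma is_puiseuxP a : is_puiseux a <->
  exists (m : nat) k f, [/\ (0 < m)%N, geo_bounded f & a = pseries m k f].
Proof.
split=> [[m [k [m0 sa [rho rho0 cv]]]]|[m [k [f [m0 [B B1 fB] ->]]]]].
  exists m, k, (fun n => a ((k%:~R + n%:R) / m%:R)); split=> //; last exact: eq_pseries.
  have [M [_ /(_ (`|M| + 1))]] := cvg_series_bounded cv.
  have -> : (M < `|M| + 1) by rewrite (le_lt_trans (ler_norm M))// ltrDl.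
  move=> /(_ isT); set D := `|M| + 1 => fD.
  have D1 : 1 <= D by rewrite lerDr.
  have rV : 0 < rho^-1 by rewrite invr_gt0.
  exists (D + D * (1 + rho^-1)); first by nra.
  move=> n; have {fD} := fD n I; rewrite /= ger0_norm; last first.
    by rewrite mulr_ge0 ?normc_ge0// exprn_ge0// ltW.
  rewrite -ler_pdivlMr ?exprn_gt0// -exprVn => /le_trans; apply.
  rewrite exprS; apply: ler_pM; [lra|by rewrite exprn_ge0// ltW|nra|].
  have Dr : 0 <= D * rho^-1 - rho^-1 by nra.
  by apply: lerXn2r; rewrite ?nnegrE; lra.
exists m, k; split=> //.
  by move=> q /(pseries_neq0 m0)[n -> _]; exists n.
have B0 : 0 < B by lra.
exists (2 * B)^-1; first by rewrite invr_gt0; lra.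
have := @is_cvg_geometric_series R B 2^-1.
rewrite ger0_norm ?invr_ge0// invf_lt1// ltr1n => /(_ isT).
apply: series_le_cvg => n.
- by rewrite mulr_ge0 ?normc_ge0// exprn_ge0// invr_ge0; lra.
- by rewrite /geometric/= mulr_ge0 ?exprn_ge0 ?invr_ge0//; lra.
rewrite pseriesE//; apply: le_trans (ler_wpM2r _ (fB n)) _.
  by rewrite exprn_ge0// invr_ge0; lra.
have BV : B ^+ n * B^-1 ^+ n = 1 by rewrite -exprMn mulfV ?gt_eqF// expr1n.
by rewrite /geometric/= invfM exprMn exprS mulrACA BV mulr1.
Qed.

Lemma pseries_spread m k f d : (0 < m)%N -> (0 < d)%N ->
  pseries m k f = pseries (m * d) (k * d%:Z) (spread d f).
Proof.
move=> m0 d0; have mR : m%:R != 0 :> rat by rewrite pnatr_eq0 -lt0n.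
have dR : d%:R != 0 :> rat by rewrite pnatr_eq0 -lt0n.
have E n : ((k * d)%:~R + (d * n)%:R) / (m * d)%:R = (k%:~R + n%:R) / m%:R :> rat.
  by rewrite intrM !natrM (mulrC d%:R) -mulrDl -mulf_div divff// mulr1.
apply: eq_pseries; first by rewrite muln_gt0 m0.
  by move=> q /(pseries_neq0 m0)[n -> _]; exists (d * n)%N; rewrite E.
move=> n; rewrite /spread; case: ifPn => [/dvdnP[j ->]|nd].
  by rewrite mulnK// mulnC E pseriesE.
apply/eqP; apply: contraNT nd => /(pseries_neq0 m0)[j].
rewrite -E => /(divIf _); rewrite pnatr_eq0 muln_eq0 negb_or -!lt0n m0 d0 => /(_ isT).
by move=> /addrI /eqP; rewrite eqr_nat => /eqP -> _; exact: dvdn_mulr.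
Qed.

Lemma pseries_delay m k f d : (0 < m)%N ->
  pseries m (k + d%:Z) f = pseries m k (delay d f).
Proof.
move=> m0; have mR : m%:R != 0 :> rat by rewrite pnatr_eq0 -lt0n.
have E n : ((k + d%:Z)%:~R + n%:R) / m%:R = (k%:~R + (d + n)%:R) / m%:R :> rat.
  by rewrite rmorphD natrD addrA.
apply: eq_pseries => //.
  by move=> q /(pseries_neq0 m0)[n -> _]; exists (d + n)%N; rewrite E.
move=> n; rewrite /delay; case: ifPn => [dn|dn].
  by rewrite -{1}(subnKC dn) -E pseriesE.
apply/eqP; apply: contraNT dn => /(pseries_neq0 m0)[j].
rewrite E => /(divIf _) -/(_ mR)/addrI /eqP; rewrite eqr_nat => /eqP -> _.
exact: leq_addr.
Qed.

Lemma int_leD (k l : int) : k <= l -> exists d : nat, l = k + d%:Z.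
Proof. by move=> kl; exists `|l - k|%N; lia. Qed.

Lemma common_pseries a b : is_puiseux a -> is_puiseux b ->
  exists (m : nat) k f g, [/\ (0 < m)%N, geo_bounded f, geo_bounded g,
    a = pseries m k f & b = pseries m k g].
Proof.
move=> /is_puiseuxP[m [k [f [m0 bf ->]]]] /is_puiseuxP[m' [k' [f' [m'0 bf' ->]]]].
rewrite (pseries_spread _ _ m0 m'0) (pseries_spread _ _ m'0 m0) (mulnC m').
move: (k * _) (k' * _) (geo_bounded_spread m' bf) (geo_bounded_spread m bf').
have {m0 m'0} : (0 < m * m')%N by rewrite muln_gt0 m0.
move: (m * m')%N (spread _ f) (spread _ f') => {}m {}f {}f' m0 {}k {}k' {}bf {}bf'.
have [/int_leD[d ->]|/ltW/int_leD[d ->]] := leP k k'.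
  exists m, k, f, (delay d f'); split=> //; first exact: geo_bounded_delay.
  exact: pseries_delay.
exists m, k', (delay d f), f'; split=> //; first exact: geo_bounded_delay.
exact: pseries_delay.
Qed.

Lemma pmulE m k l f g : (0 < m)%N ->
  pmul (pseries m k f) (pseries m l g) = pseries m (k + l) (cauchy f g).
Proof.
move=> m0; have mR : m%:R != 0 :> rat by rewrite pnatr_eq0 -lt0n.
apply: eq_pseries => // [q|n].
  move=> nz; apply: contrapT => nex; move/eqP: nz; apply.
  apply: fsbig1 => s _; apply/eqP; apply: contra_notT nex.
  rewrite mulf_eq0 negb_or => /andP[/(pseries_neq0 m0)[i -> _]].
  move=> /(pseries_neq0 m0)[j /(canRL (subrK _)) -> _]; exists (i + j)%N.
  by rewrite rmorphD natrD -mulrDl; congr (_ / _); ring.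
pose h (i : nat) : rat := (k%:~R + i%:R) / m%:R.
have h_inj : injective h.
  by move=> i j /(divIf mR)/addrI/eqP; rewrite eqr_nat => /eqP.
have hB (i : nat) : (i <= n)%N ->
    ((k + l)%:~R + n%:R) / m%:R - h i = (l%:~R + (n - i)%:R) / m%:R.
  by move=> ni; rewrite natrB// rmorphD -mulrBl; congr (_ / _); ring.
rewrite /pmul (fsbigE [seq h i | i <- iota 0 n.+1]) ?map_inj_uniq ?iota_uniq//.
  rewrite big_map -[iota 0 n.+1]/(index_iota 0 n.+1) big_mkord.
  apply: eq_big => [i|i _]; first by rewrite in_setT.
  by rewrite hB ?pseriesE// -ltnS.
move=> s _ ns; apply/eqP; apply: contraNT ns.
rewrite mulf_eq0 negb_or => /andP[/(pseries_neq0 m0)[i -> _]].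
move=> /(pseries_neq0 m0)[j /(canRL (subrK _)) E _]; apply: (map_f h).
have {}E : ((k + l)%:~R + n%:R : rat) = (k + l)%:~R + (j + i)%:R.
  by apply: (divIf mR); rewrite E -mulrDl; congr (_ / _); rewrite rmorphD natrD; ring.
move/addrI/eqP: E; rewrite eqr_nat => /eqP ->.
by rewrite mem_iota add0n ltnS leq_addl.
Qed.

Definition pone (q : rat) : R[i] := (q == 0)%:R.

Lemma poneE m : (0 < m)%N -> pone = pseries m 0 (fun n => (n == 0)%:R).
Proof.
move=> m0; apply: eq_pseries => // [q|n]; rewrite /pone.
  by case: (eqVneq q 0) => [-> _|_]; [exists 0%N; rewrite addr0 mul0r|rewrite eqxx].
by rewrite add0r mulf_eq0 invr_eq0 !pnatr_eq0 (gtn_eqF m0) orbF.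
Qed.

Lemma is_puiseux0 : is_puiseux (fun=> 0).
Proof.
apply/is_puiseuxP; exists 1%N, 0, (fun n => if n == 0 then 0 else 0).
split=> //; first exact: geo_bounded_single.
by apply: eq_pseries => [//|q|n]; rewrite ?eqxx// if_same.
Qed.

Lemma is_puiseux1 : is_puiseux pone.
Proof.
apply/is_puiseuxP; exists 1%N, 0, (fun n => if n == 0 then 1 else 0).
split=> //; first exact: geo_bounded_single.
by rewrite (poneE (ltn0Sn 0)); congr pseries; apply/funext => n; case: (n == 0).
Qed.

Lemma is_puiseuxB a b :
  is_puiseux a -> is_puiseux b -> is_puiseux (fun q => a q - b q).
Proof.
move=> pa pb; have [m [k [f [g [m0 bf bg -> ->]]]]] := common_pseries pa pb.
apply/is_puiseuxP; exists m, k, (fun n => f n - g n); split=> //.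
  exact/geo_boundedD/geo_boundedN.
by apply/funext => q; rewrite /pseries; case: ifP => _//; rewrite subr0.
Qed.

Lemma is_puiseuxM a b : is_puiseux a -> is_puiseux b -> is_puiseux (pmul a b).
Proof.
move=> pa pb; have [m [k [f [g [m0 bf bg -> ->]]]]] := common_pseries pa pb.
apply/is_puiseuxP; exists m, (k + k), (cauchy f g); split=> //.
  exact: geo_bounded_cauchy.
exact: pmulE.
Qed.

Lemma pmulC a b : is_puiseux a -> is_puiseux b -> pmul a b = pmul b a.
Proof.
move=> pa pb; have [m [k [f [g [m0 bf bg -> ->]]]]] := common_pseries pa pb.
by rewrite !pmulE// cauchyC.
Qed.

Lemma pmul1 a : is_puiseux a -> pmul pone a = a.
Proof.
move=> /is_puiseuxP[m [k [f [m0 bf ->]]]].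
by rewrite (poneE m0) pmulE// add0r cauchy1l.
Qed.

Lemma common_pseries3 a b c : is_puiseux a -> is_puiseux b -> is_puiseux c ->
  exists (m : nat) k f l g h, [/\ (0 < m)%N, a = pseries m k f,
    b = pseries m k g & c = pseries m l h].
Proof.
move=> pa pb /is_puiseuxP[d [l [h [d0 _ ->]]]].
have [m [k [f [g [m0 bf bg -> ->]]]]] := common_pseries pa pb.
exists (m * d)%N, (k * d%:Z), (spread d f), (l * m%:Z), (spread d g), (spread m h).
rewrite -!pseries_spread// muln_gt0 m0 d0; split=> //.
by rewrite mulnC -pseries_spread.
Qed.

Lemma pmulA a b c : is_puiseux a -> is_puiseux b -> is_puiseux c ->
  pmul a (pmul b c) = pmul (pmul a b) c.
Proof.
move=> pa pb pc.
have [m [k [f [l [g [h [m0 -> -> ->]]]]]]] := common_pseries3 pa pb pc.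
by rewrite !pmulE// cauchyA addrA.
Qed.

Lemma pmulDl a b c : is_puiseux a -> is_puiseux b -> is_puiseux c ->
  pmul (fun q => a q + b q) c = (fun q => pmul a c q + pmul b c q).
Proof.
move=> pa pb pc.
have [m [k [f [l [g [h [m0 -> -> ->]]]]]]] := common_pseries3 pa pb pc.
have -> : (fun q => pseries m k f q + pseries m k g q) =
    pseries m k (fun n => f n + g n).
  by apply/funext => q; rewrite /pseries; case: ifP => _//; rewrite addr0.
rewrite !pmulE// cauchyDl.
by apply/funext => q; rewrite /pseries; case: ifP => _//; rewrite addr0.
Qed.

Lemma pseries_lead a : is_puiseux a -> a != (fun=> 0) ->
  exists (m : nat) k f, [/\ (0 < m)%N, geo_bounded f, f 0 != 0 & a = pseries m k f].
Proof.
move=> /is_puiseuxP[m [k [f [m0 bf ->]]]] nz.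
have exf : exists n, f n != 0.
  apply: contrapT => nf; move/eqP: nz; apply; apply/funext => q.
  apply/eqP; apply: contra_notT nf => /(pseries_neq0 m0)[n _ fn]; by exists n.
case: (ex_minnP exf) => d fd mind.
exists m, (k + d%:Z), (fun n => f (d + n)%N); split=> //.
- exact: geo_bounded_advance.
- by rewrite addn0.
rewrite pseries_delay//; congr pseries; apply/funext => n; rewrite /delay.
case: leqP => [dn|nd]; first by rewrite subnKC.
by apply/eqP; apply: contraTT nd => fn; rewrite -leqNgt mind.
Qed.

Lemma pmulV a : is_puiseux a -> a != (fun=> 0) ->
  exists2 b, is_puiseux b & pmul b a = pone.
Proof.
move=> pa nz; have [m [k [f [m0 bf f0 ->]]]] := pseries_lead pa nz.
exists (pseries m (- k) (cinv f)).
  apply/is_puiseuxP; exists m, (- k), (cinv f); split=> //.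
  exact: geo_bounded_cinv.
by rewrite pmulE// addNr cauchyV// -poneE.
Qed.
End Puiseux.

Section PuiseuxField.
Variable R : realType.

Definition puiseux_pred : {pred (rat -> R[i])} := [pred a | `[< is_puiseux a >]].

Record puiseux := Puiseux {
  pcoef :> rat -> R[i];
  puiseux_subproof : pcoef \in puiseux_pred }.

HB.instance Definition _ := [isSub for pcoef].
HB.instance Definition _ := [Choice of puiseux by <:].

Implicit Types a b c : puiseux.

Lemma puiseuxP a : is_puiseux a.
Proof. exact/asboolP/puiseux_subproof. Qed.

Lemma puiseux_zmod_closed : zmod_closed puiseux_pred.
Proof.
split=> [|a b /asboolP pa /asboolP pb]; apply/asboolP; first exact: is_puiseux0.
exact: is_puiseuxB.
Qed.

HB.instance Definition _ := GRing.isZmodClosed.Build (rat -> R[i])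
  puiseux_pred puiseux_zmod_closed.
HB.instance Definition _ := [SubChoice_isSubZmodule of puiseux by <:].

Definition puiseux_one : puiseux := Puiseux (asboolT (is_puiseux1 R)).
Definition puiseux_mul a b : puiseux :=
  Puiseux (asboolT (is_puiseuxM (puiseuxP a) (puiseuxP b))).

Fact puiseux_mulA : associative puiseux_mul.
Proof. by move=> a b c; apply: val_inj; apply: pmulA; exact: puiseuxP. Qed.

Fact puiseux_mulC : commutative puiseux_mul.
Proof. by move=> a b; apply: val_inj; apply: pmulC; exact: puiseuxP. Qed.

Fact puiseux_mul1 : left_id puiseux_one puiseux_mul.
Proof. by move=> a; apply: val_inj; apply: pmul1; exact: puiseuxP. Qed.

Fact puiseux_mulDl : left_distributive puiseux_mul +%R.
Proof. by move=> a b c; apply: val_inj; apply: pmulDl; exact: puiseuxP. Qed.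

Fact puiseux_oner_neq0 : puiseux_one != 0.
Proof.
apply/eqP => /(congr1 (fun a : puiseux => a 0)) /=.
by rewrite /pone eqxx => /eqP; rewrite oner_eq0.
Qed.

HB.instance Definition _ := GRing.Zmodule_isComNzRing.Build puiseux
  puiseux_mulA puiseux_mulC puiseux_mul1 puiseux_mulDl puiseux_oner_neq0.

Definition puiseux_inv a : puiseux :=
  if a == 0 then 0 else xget 0 [set b | b * a = 1].

Fact puiseux_mulVf a : a != 0 -> puiseux_inv a * a = 1.
Proof.
move=> nz; rewrite /puiseux_inv (negPf nz).
have [|b pb ba] := @pmulV R a (puiseuxP a).
  by apply: contra nz => /eqP a0; apply/eqP/val_inj.
apply: (@xgetPex _ 0 [set b : puiseux | b * a = 1]).
by exists (Puiseux (asboolT pb)); exact: val_inj.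
Qed.

Fact puiseux_inv0 : puiseux_inv 0 = 0.
Proof. by rewrite /puiseux_inv eqxx. Qed.

HB.instance Definition _ := GRing.ComNzRing_isField.Build puiseux
  puiseux_mulVf puiseux_inv0.

End PuiseuxField.

Section Valuation.
Variable R : realType.
Local Open Scope ereal_scope.

(* The infimum is a minimum ([Val_min]); for $a = 0$ it is $+\infty$, whence
   $\mathrm{Val}(0) = -\infty$. *)
Definition Val (a : puiseux R) : \bar R :=
  - ereal_inf [set (ratr q)%:E | q in [set q : rat | a q != 0%R]].

Lemma Val0 : Val 0%R = -oo.
Proof.
rewrite /Val (_ : [set q | _] = set0) ?image_set0 ?ereal_inf0//.
by apply/seteqP; split=> // q /=; rewrite eqxx.
Qed.

Lemma Val_min (a : puiseux R) : a != 0%R -> exists q : rat,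
  [/\ a q != 0%R, (forall s, a s != 0%R -> (q <= s)%R) & Val a = (- ratr q)%:E].
Proof.
move=> nz; have [|m [k [f [m0 _ f0 af]]]] := @pseries_lead R a (puiseuxP a).
  by apply: contra nz => /eqP a0; apply/eqP/val_inj.
pose q : rat := ((k%:~R + 0%:R) / m%:R)%R.
have aq : a q != 0%R by rewrite af pseriesE.
have qmin s : a s != 0%R -> (q <= s)%R.
  rewrite af => /(pseries_neq0 m0)[n -> _].
  by rewrite ler_pM2r ?invr_gt0 ?ltr0n// lerD2l ler_nat.
exists q; split=> //; rewrite /Val EFinN; congr (- _).
apply/eqP; rewrite eq_le; apply/andP; split.
  by apply: ereal_inf_lbound; exists q.
by apply: le_ereal_inf_tmp => _ [s as0 <-]; rewrite lee_fin ler_rat qmin.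
Qed.
End Valuation.

Section Polytopes.
Variable R : realType.

Definition dot n (u v : 'rV[R]_n) : R := (u *m v^T) 0 0.

Definition conv_hull n (X : set 'rV[R]_n) : set 'rV[R]_n :=
  smallest (fun Y : set 'rV[R]_n => convex_set Y) X.

Definition contains_simplex n (X : set 'rV[R]_n) (d : nat) : Prop :=
  exists (p : 'rV[R]_n) (M : 'M[R]_(d, n)), row_free M /\
    conv_hull (p |` [set p + row i M | i in [set: 'I_d]]) `<=` X.

(* Dimension of a polytope or, more generally, of a finite union of
   polyhedra. *)
Definition has_dim n (X : set 'rV[R]_n) (d : nat) : Prop :=
  contains_simplex X d /\ ~ contains_simplex X d.+1.

Definition embed (w : 'rV[int]_3) : 'rV[R]_3 := map_mx intr w.

Definition lattice_polytope (D : set 'rV[R]_3) : Prop :=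
  exists s : seq 'rV[int]_3, D = conv_hull (embed @` [set` s]).

Definition dilate (n : nat) (D : set 'rV[R]_3) : set 'rV[R]_3 :=
  [set n%:R *: x | x in D].

(* [fset_set] is the empty set on infinite sets; polytopes being bounded, this
   default value is never used below. *)
Definition lattice_points (D : set 'rV[R]_3) : {fset 'rV[int]_3} :=
  fset_set [set w | D (embed w)].

Definition lattice_length (u v : 'rV[int]_3) : nat :=
  \big[gcdn/0%N]_(i < 3) `|(v 0 i - u 0 i)%R|%N.

Definition ld (D : set 'rV[R]_3) : nat :=
  (\max_(u <- lattice_points D) \max_(v <- lattice_points D)
     lattice_length u v)%N.

Definition ld_infty (D : set 'rV[R]_3) : R :=
  limn (fun n : nat => (ld (dilate n D))%:R / n%:R : R).

End Polytopes.

Section AlgebraicSurfaces.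
Variable R : realType.
Local Notation K := (puiseux R).

(* Laurent polynomials $\sum_\omega a_\omega z^\omega$ in three variables, as
   finitely supported families of coefficients. *)
Definition laurent := {fsfun 'rV[int]_3 -> K with 0}.

Implicit Types (f : laurent) (z : 'rV[K]_3).

Definition monomial z (w : 'rV[int]_3) : K := \prod_(i < 3) z 0 i ^ w 0 i.

Definition laurent_eval f z : K :=
  \sum_(w <- finsupp f) f w * monomial z w.

(* the value at [z] of the partial derivative of [f] in the [i]-th variable *)
Definition laurent_deriv f (i : 'I_3) z : K :=
  \sum_(w <- finsupp f) f w * (w 0 i)%:~R * monomial z (w - delta_mx 0 i).

Definition newton_polytope f : set 'rV[R]_3 :=
  conv_hull (@embed R @` [set w | f w != 0]).

Definition singular_point f z : Prop :=
  [/\ forall i, z 0 i != 0, laurent_eval f z = 0 &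
      forall i, laurent_deriv f i z = 0].

End AlgebraicSurfaces.

(* A tropical surface with Newton polytope [D] is given by the coefficients
   [c] of a tropical polynomial; only the values of [c] on [lattice_points D]
   matter. *)
Section TropicalSurfaces.
Variables (R : realType) (D : set 'rV[R]_3).
Implicit Types (c : 'rV[int]_3 -> R) (f : laurent R).

Definition trop_poly c (X : 'rV[R]_3) : R :=
  sup [set c w + dot (embed R w) X | w in [set` lattice_points D]].

Definition tropical_surface c : set 'rV[R]_3 :=
  [set X | exists w w',
    [/\ w \in lattice_points D, w' \in lattice_points D, w != w',
        c w + dot (embed R w) X = trop_poly c X &
        c w' + dot (embed R w') X = trop_poly c X]].

Definition lower_hull c (x : 'rV[R]_3) : R :=
  inf [set y : R | conv_hull
    [set (row_mx (embed R w) (const_mx (- c w)) : 'rV[R]_(3 + 1))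
       | w in [set` lattice_points D]] (row_mx x (const_mx y))].

Definition affine_on (g : 'rV[R]_3 -> R) (Q : set 'rV[R]_3) : Prop :=
  exists (u : 'rV[R]_3) (b : R), forall x, Q x -> g x = dot u x + b.

Definition linear_piece c (Q : set 'rV[R]_3) : Prop :=
  [/\ Q `<=` D, convex_set Q & affine_on (lower_hull c) Q].

(* The linearity domains of the convex piecewise linear function
   [lower_hull c] are the maximal convex sets on which it is affine. *)
Definition dual_subdivision c : set (set 'rV[R]_3) :=
  [set Q | linear_piece c Q /\
    forall Q', linear_piece c Q' -> Q `<=` Q' -> Q' = Q].

(* The surface $\{f = 0\}$ has Newton polytope [D] and tropicalizes to the
   surface given by [c]: its tropical polynomial
   $\max_\omega(\mathrm{Val}(a_\omega) + \langle\omega, X\rangle)$ has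
   coefficient vector [c]. *)
Definition tropicalizes_to f c : Prop :=
  newton_polytope f = D /\
  forall w, w \in lattice_points D -> Val (f w) = (c w)%:E.

Definition singular_tropical c : Prop :=
  exists f z, tropicalizes_to f c /\ singular_point f z.

Definition tropical_singular_point c (p : 'rV[R]_3) : Prop :=
  tropical_surface c p /\
  exists f z, [/\ tropicalizes_to f c, singular_point f z &
    forall i, Val (z 0 i) = (p 0 i)%:E].

Definition coef_vector c : 'rV[R]_#|`lattice_points D| :=
  \row_i c (nth 0 (enum_fset (lattice_points D)) i).

(* Multiplication by [cokermx (const_mx 1)] has kernel spanned by
   $(1,\dots,1)$, so it realizes the quotient modulo this vector. *)
Definition deformation_space c : set 'rV[R]_#|`lattice_points D| :=
  [set coef_vector c' *m cokermx (const_mx 1 : 'rV_#|`lattice_points D|)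
     | c' in [set c' | singular_tropical c' /\
                       dual_subdivision c' = dual_subdivision c]].

(* Since [Val] takes rational values on $\mathbb K^*$, the deformation space
   consists of rational points, dense in a finite union of polyhedra; its
   dimension is that of its closure. *)
Definition maximal_dimensional c : Prop :=
  singular_tropical c /\
  has_dim (closure (deformation_space c)) (#|`lattice_points D| - 2).

End TropicalSurfaces.

(* A lattice polytope need not carry any singular tropical surface, although
   its multiples by $n \ge 2$ do: a surface whose Newton polytope is the unit
   simplex has no singular point in the torus. *)
Section UnitSimplex.
Variable R : realType.

Definition unit_simplex : set 'rV[R]_3 :=
  conv_hull (@embed R @` [set` 0 :: [seq delta_mx 0 i | i <- enum 'I_3]]).

Lemma conv_hull_sub n (X Y : set 'rV[R]_n) :
  (forall x y (t : R), 0 <= t <= 1 -> Y x -> Y y -> Y (t *: x + (1 - t) *: y)) ->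
  X `<=` Y -> conv_hull X `<=` Y.
Proof.
move=> cY XY x /(_ Y); apply; split=> //.
move=> u v t /set_mem Yu /set_mem Yv; apply: mem_set.
by apply: (cY u v t%:num) => //; rewrite ge0/=.
Qed.

Lemma conv_hull_gen n (X : set 'rV[R]_n) x : X x -> conv_hull X x.
Proof. exact: sub_gen_smallest. Qed.

Lemma unit_simplex_not_singular (c : 'rV[int]_3 -> R) :
  ~ singular_tropical unit_simplex c.
Proof.
move=> [f [z [[nf _] [z0 _ /(_ ord0)]]]].
have gens (Y : set 'rV[R]_3) : Y 0 -> (forall i, Y (delta_mx 0 i)) ->
    embed R @` [set` 0 :: [seq delta_mx 0 i | i <- enum 'I_3]] `<=` Y.
  move=> Y0 Yi _ [w /= + <-]; rewrite inE => /orP[/eqP->|/mapP[i _ ->]].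
    by rewrite /embed map_mx0.
  by rewrite /embed map_delta_mx.
have posP (w : 'rV[int]_3) : unit_simplex (embed R w) ->
    (forall i, 0 <= w 0 i) /\ w 0 0 + w 0 1 + w 0 2%:R <= 1.
  pose Y := [set x : 'rV[R]_3 | (forall i, 0 <= x 0 i) /\
    x 0 0 + x 0 1 + x 0 2%:R <= 1].
  suff /[apply] -[w0 w1] : unit_simplex `<=` Y.
    split=> [i|]; first by have := w0 i; rewrite mxE ler0z.
    by move: w1; rewrite !mxE -!intrD -[1]/(1%:~R) ler_int.
  apply: conv_hull_sub => [x y t /andP[t0 t1] [x0 x1] [y0 y1]|].
    split=> [i|]; rewrite !mxE; first by have := x0 i; have := y0 i; nra.
    by nra.
  apply: gens; first by split=> [i|]; rewrite !mxE// !addr0.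
  move=> i; split=> [j|]; rewrite !mxE ?ler0n//=.
  by case: i => -[|[|[|]]]//= i; rewrite ?addr0 ?add0r.
have supp w : f w != 0 -> 0 <= w 0 0 /\ (0 < w 0 0 -> w = delta_mx 0 ord0).
  move=> fw; have [w0 w1] : (forall i, 0 <= w 0 i) /\ w 0 0 + w 0 1 + w 0 2%:R <= 1.
    by apply: posP; rewrite -nf; apply: conv_hull_gen; exists w.
  split=> // w00; apply/rowP => i; rewrite mxE eqxx/=.
  have [w10 w20] := (w0 1, w0 2%:R).
  have E j : i = j -> w 0 i = w 0 j by move=> ->.
  case: i E => -[|[|[|//]]] i E.
  - by rewrite (E 0) ?[RHS]/=; [lia|exact: val_inj].
  - by rewrite (E 1) ?[RHS]/=; [lia|exact: val_inj].
  - by rewrite (E 2%:R) ?[RHS]/=; [lia|exact: val_inj].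
have fe : f (delta_mx 0 ord0) != 0.
  apply/eqP => fe.
  have : unit_simplex (embed R (delta_mx 0 ord0)).
    apply: conv_hull_gen; exists (delta_mx 0 ord0) => //=.
    by rewrite inE map_f ?orbT ?mem_enum.
  suff sub : newton_polytope f `<=` [set x : 'rV[R]_3 | x 0 ord0 <= 0].
    by rewrite -nf => /sub; rewrite /= !mxE eqxx/= ler10.
  apply: conv_hull_sub => [x y t /andP[t0 t1]/=|_ [w /= fw <-]].
    by rewrite !mxE; nra.
  rewrite /= mxE lerz0 leNgt; apply/negP => w0.
  by move/eqP: (fw); apply; rewrite (proj2 (supp w fw) w0).
rewrite /laurent_deriv (bigD1_seq (delta_mx 0 ord0)) ?mem_finsupp ?fset_uniq//=.
rewrite big_seq_cond big1 => [|w /andP[+ we]]; last first.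
  rewrite mem_finsupp => /supp[w0 w1]; have [/w1 weq|] := ltP 0 (w 0 0).
    by rewrite weq eqxx in we.
  by move=> w0'; rewrite (_ : w 0 ord0 = 0) ?mulr0 ?mul0r//; apply: le_anti; rewrite w0 w0'.
rewrite addr0 mxE !eqxx/= mulr1 subrr /monomial big1 => [|i _]; last by rewrite mxE.
by rewrite mulr1 => /eqP; apply/negP.
Qed.
End UnitSimplex.

(* Main.v *)
(** A point [z] of the surface [f = 0] is singular iff the terms [f w * z ^ w]
   satisfy the affine relations of the lattice points: their sum and their first
   moments vanish. Hence the leading coefficients of the dominant terms form an
   affine relation, so that coefficient vectors of singular tropical surfaces lie
   in a finite union of hyperplanes. Conversely, if a rational tropical polynomial
   attains its maximum at [p] exactly at three points [w - e], [w], [w + e], and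
   its next lower value exactly at three points in general position with respect
   to [w] and [e], then relations with Puiseux coefficients of the prescribed
   orders can be solved for, and [p] is a tropical singular point.

   For fixed triples this condition at finitely many points [p] is stable under
   perturbations of the coefficients preserving [c (w - e) + c (w + e) = 2 c w].
   Since there are finitely many dual subdivisions, one of them occurs densely on
   an open set of such perturbations, which gives the maximal dimension.

   A dilate [n D] contains a segment of lattice length [L = n ld_infty - O(1)]
   together with a neighbourhood of bounded size. Next to the segment one finds
   [w - e], [w], [w + e] and, in a plane transverse to [e], a chain of [L] unit
   segments with one point on either side. The resulting [2 L] triangles give [2 L]
   points [p] for the same [w] and [e]. *)

Require Import Defs.
From HB Require Import structures.
From mathcomp Require Import all_boot all_order all_algebra.
From mathcomp Require Import finmap complex.
From mathcomp Require Import all_classical all_reals all_analysis.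
From mathcomp Require Import ring lra zify.

Set Implicit Arguments.
Unset Strict Implicit.
Unset Printing Implicit Defensive.

Import Order.TTheory GRing.Theory Num.Theory numFieldNormedType.Exports.
Local Open Scope classical_set_scope.
Local Open Scope ring_scope.

(** All critical points [p] share the triple [w - e], [w], [w + e], because their persistence then
    costs the single equation [c (w - e) + c (w + e) = 2 c w]: of [N] coefficients [N - 1] stay
    free, that is [N - 2] modulo constants, the maximal value. The equations on [u1], [u2], [u3]
    cost nothing, since they only serve to determine [p]. With different triples, further equations
    could arise. Valuations of nonzero Puiseux series are rational, so only rational perturbations
    can be lifted, and the dual subdivision may vary among them. One subdivision is dense only on
    some open set of perturbations; hence the surface obtained is a perturbation of the explicit
    [c0] and need not be [c0]. To make the finiteness of the set of subdivisions visible, a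
    subdivision is encoded by the sets of lattice points that lie on a common lower face. The
    segment in [n D] is scaled from one segment in a dilate [m D] whose ratio [ld / m] is within
    [1 / n] of the limit, so that no rate of convergence is required. *)

Section ConvexHull.
Variable R : realType.

Lemma convex_setP n (Y : set 'rV[R]_n) : convex_set Y <->
  forall x y (t : R), 0 <= t <= 1 -> Y x -> Y y -> Y (t *: x + (1 - t) *: y).
Proof.
split=> [cY x y t /andP[t0 t1] Yx Yy|cY x y t /set_mem Yx /set_mem Yy].
  by have /set_mem := cY x y (Itv01 t0 t1) (mem_set Yx) (mem_set Yy).
by apply/mem_set/(cY x y t%:num) => //; rewrite ge0/=.
Qed.

Lemma convex_conv_hull n (X : set 'rV[R]_n) : convex_set (conv_hull X).
Proof.
apply/convex_setP => x y t t01 hx hy Y [cY XY].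
by move/convex_setP: (cY); apply => //; [exact: hx|exact: hy].
Qed.

Definition weights N (l : 'rV[R]_N) : Prop :=
  (forall i, 0 <= l 0 i) /\ \sum_i l 0 i = 1.

Lemma convex_weights N n (X : 'M[R]_(N, n)) (Y : set 'rV[R]_n) l :
  convex_set Y -> (forall i, Y (row i X)) -> weights l -> Y (l *m X).
Proof.
move=> /convex_setP cY YX [l0 l1]; rewrite mulmx_sum_row.
(* Induction on partial sums, each normalised to total mass 1. A tail of mass 0 cannot be
   normalised, but then all its weights vanish. *)
have main (s : seq 'I_N) : 0 < \sum_(i <- s) l 0 i ->
    Y ((\sum_(i <- s) l 0 i)^-1 *: \sum_(i <- s) l 0 i *: row i X).
  elim: s => [|i s IH]; first by rewrite big_nil ltxx.
  rewrite !big_cons; set S := \sum_(j <- s) _; set V := \sum_(j <- s) _ => lS.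
  have S0 : 0 <= S by apply: sumr_ge0.
  have [S_0|Sn0] := eqVneq S 0.
    have V0 : V = 0.
      rewrite /V big_seq big1// => j js.
      suff -> : l 0 j = 0 by rewrite scale0r.
      apply/eqP; rewrite eq_le l0 andbT -S_0 /S (big_rem j js)/=.
      by rewrite lerDl sumr_ge0.
    by rewrite S_0 V0 !addr0 in lS *; rewrite scalerA mulVf ?gt_eqF// scale1r.
  have {Sn0} Sp : 0 < S by rewrite lt_def Sn0.
  have := cY (row i X) (S^-1 *: V) ((l 0 i + S)^-1 * l 0 i) _ (YX i) (IH Sp).
  have -> : 1 - (l 0 i + S)^-1 * l 0 i = (l 0 i + S)^-1 * S.
    by field; rewrite gt_eqF.
  rewrite scalerDr !scalerA -mulrA mulfV ?gt_eqF// mulr1; apply.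
  by rewrite mulr_ge0 ?invr_ge0 ?(ltW lS)//= ler_pdivrMl// mulr1 lerDl.
by have := main (enum 'I_N); rewrite !big_enum l1/= invr1 scale1r; apply.
Qed.

Lemma weights_conv N (l l' : 'rV[R]_N) (t : R) : 0 <= t <= 1 ->
  weights l -> weights l' -> weights (t *: l + (1 - t) *: l').
Proof.
move=> /andP[t0 t1] [l0 l1] [l'0 l'1]; split=> [i|].
  by rewrite !mxE; have := l0 i; have := l'0 i; nra.
under eq_bigr do rewrite !mxE.
by rewrite big_split/= -!mulr_sumr l1 l'1; ring.
Qed.

Lemma weights_delta N (i : 'I_N) : weights (delta_mx 0 i).
Proof.
split=> [j|]; first by rewrite mxE ler0n.
rewrite (bigD1 i)//= mxE !eqxx big1 ?addr0// => j ji.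
by rewrite mxE (negPf ji) andbF.
Qed.

Lemma conv_hull_rows N n (X : 'M[R]_(N, n)) :
  conv_hull [set row i X | i in [set: 'I_N]] = [set l *m X | l in @weights N].
Proof.
apply/seteqP; split=> [|_ [l wl <-]].
  apply: conv_hull_sub => [_ _ t t01 [l wl <-] [l' wl' <-]|_ [i _ <-]].
    exists (t *: l + (1 - t) *: l'); first exact: weights_conv.
    by rewrite mulmxDl -!scalemxAl.
  by exists (delta_mx 0 i); [exact: weights_delta|rewrite rowE].
apply: convex_weights wl; first exact: convex_conv_hull.
by move=> i; apply: conv_hull_gen; exists i.
Qed.

Lemma conv_hullS n (X Y : set 'rV[R]_n) : X `<=` Y -> conv_hull X `<=` conv_hull Y.
Proof.
by move=> XY; apply: smallest_sub => [|x /XY/conv_hull_gen//]; exact: convex_conv_hull.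
Qed.

End ConvexHull.

(** * Linear forms, and the lower hull of a lifted point configuration *)

Section DotProduct.
Variable R : realType.

Lemma dotE n (u v : 'rV[R]_n) : dot u v = \sum_i u 0 i * v 0 i.
Proof. by rewrite /dot mxE; apply: eq_bigr => i _; rewrite mxE. Qed.

Lemma dotDl n (u u' v : 'rV[R]_n) : dot (u + u') v = dot u v + dot u' v.
Proof. by rewrite /dot mulmxDl mxE. Qed.

Lemma dotZl n a (u v : 'rV[R]_n) : dot (a *: u) v = a * dot u v.
Proof. by rewrite /dot -scalemxAl mxE. Qed.

Lemma dotNl n (u v : 'rV[R]_n) : dot (- u) v = - dot u v.
Proof. by rewrite /dot mulNmx mxE. Qed.

Lemma dotC n (u v : 'rV[R]_n) : dot u v = dot v u.
Proof. by rewrite !dotE; apply: eq_bigr => i _; rewrite mulrC. Qed.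

Lemma dotBl n (u u' v : 'rV[R]_n) : dot (u - u') v = dot u v - dot u' v.
Proof. by rewrite dotDl dotNl. Qed.

Lemma dot_mulmx n m (l : 'rV[R]_n) (X : 'M[R]_(n, m)) v :
  dot (l *m X) v = dot l (v *m X^T).
Proof. by rewrite /dot trmx_mul trmxK mulmxA. Qed.

Lemma dot_row N n (u : 'rV[R]_n) (X : 'M[R]_(N, n)) i :
  dot u (row i X) = (u *m X^T) 0 i.
Proof. by rewrite /dot tr_row colE mulmxA -colE [LHS]mxE. Qed.

Lemma dot_col m n (y : 'rV[R]_m) (K : 'M[R]_(m, n)) i :
  dot y (col i K)^T = (y *m K) 0 i.
Proof. by rewrite /dot trmxK colE mulmxA -colE [LHS]mxE. Qed.

Lemma linear_rV_continuous n (v : 'rV[R]_n) : continuous (fun l => dot l v).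
Proof.
have -> : (fun l => dot l v) = (fun l : 'rV[R]_n => \sum_i l 0 i * v 0 i).
  by apply/funext => l; rewrite dotE.
apply: continuous_big => [|i _ l]; first exact: add_continuous.
by apply: continuousM; [exact: coord_continuous|exact: cst_continuous].
Qed.

Lemma closed_linear_eq n (v : 'rV[R]_n) (a : R) : closed [set l | dot l v = a].
Proof.
apply: (@preimage_closed _ _ (fun l => dot l v) [set a]); last exact: closed_eq.
by move=> l _; exact: linear_rV_continuous.
Qed.

End DotProduct.

(* A point configuration is given by the rows of [P], lifted to the heights
   [h]. *)
Section LowerHull.
Variables (R : realType) (N n : nat) (P : 'M[R]_(N, n)).
Implicit Types (h l : 'rV[R]_N) (x : 'rV[R]_n) (s : {set 'I_N}).

Definition lower_height h x : R :=
  inf [set y | exists2 l, weights l & l *m P = x /\ dot l h = y].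

Definition indicator s : 'rV[R]_N := \row_i (i \in s)%:R.

Lemma sum_indicator s : \sum_i indicator s 0 i = #|s|%:R.
Proof.
under eq_bigr do rewrite mxE.
by rewrite -natr_sum -sum1_card [in RHS]big_mkcond.
Qed.

(* The points of [s] lie on a common lower face of the lifted configuration:
   no weights of the same mass and barycentre have smaller height. *)
Definition lower_face h s : Prop := forall l, (forall i, 0 <= l 0 i) ->
  \sum_i l 0 i = #|s|%:R -> l *m P = indicator s *m P ->
  dot (indicator s) h <= dot l h.

Definition spanned s : set 'rV[R]_n :=
  [set l *m P | l in [set l | weights l /\ forall i, i \notin s -> l 0 i = 0]].

Lemma weights_le1 l i : weights l -> l 0 i <= 1.
Proof.
by move=> [l0 <-]; rewrite (bigD1 i)//= lerDl sumr_ge0.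
Qed.

(** The weights with a given barycentre form a closed subset of a cube; compactness turns the
    infimum in [lower_height] into a minimum. *)
Lemma compact_weights l0 : compact [set l | weights l /\ l *m P = l0 *m P].
Proof.
apply: (@subclosed_compact _ _ [set l : 'rV[R]_N | forall i, `[0, 1]%classic (l ord0 i)]).
- rewrite (_ : [set l | _] = (\bigcap_(i in [set: 'I_N]) [set l : 'rV[R]_N | 0 <= l 0 i]) `&`
      [set l | dot l (const_mx 1) = 1] `&`
      \bigcap_(j in [set: 'I_n]) [set l | dot l (col j P)^T = (l0 *m P) 0 j]).
    apply: closedI; first apply: closedI; last 2 first.
    + exact: closed_linear_eq.
    + by apply: closed_bigI => j _; exact: closed_linear_eq.
    apply: closed_bigI => i _.
    apply: (@preimage_closed _ _ (fun l : 'rV[R]_N => l 0 i) [set x | 0 <= x]).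
      by move=> l _; exact: coord_continuous.
    exact: closed_ge.
  have sumE (l : 'rV[R]_N) : dot l (const_mx 1) = \sum_i l 0 i.
    by rewrite dotE; apply: eq_bigr => i _; rewrite mxE mulr1.
  apply/seteqP; split=> [l [[wl0 wl1] lP]|l [[wl0 wl1] lP]].
    split; first by split=> [i _|]; [exact: wl0|rewrite /= sumE].
    by move=> j _; rewrite /= dot_col lP.
  split; first by split=> [i|]; [exact: wl0|rewrite -sumE].
  by apply/rowP => j; rewrite -dot_col; exact: lP.
- apply: (@rV_compact R N (fun=> `[0 : R, 1]%classic)) => i; exact: segment_compact.
- move=> l /= [wl _] i; rewrite in_itv/= weights_le1// andbT.
  by case: wl.
Qed.

Lemma lower_height_min h l0 : weights l0 -> exists l,
  [/\ weights l, l *m P = l0 *m P, lower_height h (l0 *m P) = dot l h &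
      forall l', weights l' -> l' *m P = l0 *m P -> dot l h <= dot l' h].
Proof.
move=> wl0.
have cont : {within [set l | weights l /\ l *m P = l0 *m P],
    continuous (fun l => dot l h)}.
  exact/continuous_subspaceT/linear_rV_continuous.
have [|l /set_mem[wl lP] lmin] := EVT_min_rV _ (@compact_weights l0) cont.
  by exists l0.
have {}lmin l' : weights l' -> l' *m P = l0 *m P -> dot l h <= dot l' h.
  by move=> wl' lP'; apply: lmin; rewrite inE.
exists l; split=> //; apply/eqP; rewrite eq_le; apply/andP; split.
  apply: ge_inf; last by exists l.
  by exists (dot l h) => _ [l' wl' [lP' <-]]; exact: lmin.
apply: lb_le_inf; first by exists (dot l h), l.
by move=> _ [l' wl' [lP' <-]]; exact: lmin.
Qed.

(* Otherwise a small multiple of [l' - l], added to the indicator of [s], would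
   contradict the minimality defining [lower_face]. *)
Lemma lower_face_le h s l l' : lower_face h s -> weights l ->
  (forall i, i \notin s -> l 0 i = 0) -> weights l' -> l' *m P = l *m P ->
  dot l h <= dot l' h.
Proof.
move=> fs wl ls wl' lP.
have := fs (indicator s + (l' - l)).
rewrite mulmxDl mulmxBl lP subrr addr0 !dotDl dotNl lerDl subr_ge0; apply=> //.
  move=> i; rewrite !mxE; have [il|il] := boolP (i \in s).
    by rewrite mulr1n; have := weights_le1 i wl; have := wl'.1 i; lra.
  by rewrite (ls _ il) subr0 add0r; exact: wl'.1.
under eq_bigr do rewrite !mxE.
rewrite !big_split/= sumrN wl.2 wl'.2 subrr addr0 -sum_indicator.
by apply: eq_bigr => i _; rewrite mxE.
Qed.

(** A small multiple of [k] or of [- k] can be added to the indicator of [s] without leaving the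
    nonnegative vectors, so the height changes by a nonnegative amount for both signs. *)
Lemma lower_face_relation h s (k : 'rV[R]_N) : lower_face h s ->
  (forall i, i \notin s -> k 0 i = 0) -> \sum_i k 0 i = 0 -> k *m P = 0 ->
  dot k h = 0.
Proof.
move=> fs ks k0 kP.
suff main (k' : 'rV[R]_N) : (forall i, i \notin s -> k' 0 i = 0) -> \sum_i k' 0 i = 0 ->
    k' *m P = 0 -> 0 <= dot k' h.
  apply/eqP; rewrite eq_le main// andbT -oppr_ge0 -dotNl main//.
  - by move=> i /ks ki; rewrite mxE ki oppr0.
  - by under eq_bigr do rewrite mxE; rewrite sumrN k0 oppr0.
  - by rewrite mulNmx kP oppr0.
move=> {k0 kP}ks' k0 kP; pose B := 1 + \sum_i `|k' 0 i|.
have kB i : `|k' 0 i| <= B.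
  by rewrite /B (bigD1 i)//= addrCA lerDl addr_ge0// sumr_ge0.
have B0 : 0 < B by rewrite ltr_wpDr// sumr_ge0.
have := fs (indicator s + B^-1 *: k').
rewrite mulmxDl -scalemxAl kP scaler0 addr0 dotDl dotZl lerDl.
rewrite pmulr_rge0 ?invr_gt0//; apply=> //.
  move=> i; rewrite !mxE; have [si|/ks'->] := boolP (i \in s); last first.
    by rewrite mulr0 addr0.
  rewrite -(ler_pM2l B0) mulr0 mulrDr mulrA mulfV ?gt_eqF// mul1r mulr1.
  by have := kB i; rewrite ler_norml => /andP[+ _]; lra.
rewrite (eq_bigr (fun i => indicator s 0 i + B^-1 * k' 0 i)); last first.
  by move=> i _; rewrite !mxE.
by rewrite big_split/= -mulr_sumr k0 mulr0 addr0 sum_indicator.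
Qed.

(** Duality of row space and cokernel: [h] restricted to [s] is a combination of the coordinate
    functions and the constant 1 as soon as it is killed by every affine relation supported on [s].
    The columns of the cokernel, cut down to [s], are such relations. *)
Lemma lower_face_affine h s : lower_face h s ->
  exists (u : 'rV[R]_n) (b : R), forall i, i \in s -> dot u (row i P) + b = h 0 i.
Proof.
move=> fs; pose Z : 'M[R]_(n + 1, N) := col_mx P^T (const_mx 1).
have : (h *m diag_mx (indicator s) <= Z *m diag_mx (indicator s))%MS.
  rewrite submxE; have := mulmx_coker (Z *m diag_mx (indicator s)).
  move: (cokermx _) => K ZK; apply/eqP/matrixP => j i; rewrite ord1 {j}.
  pose k := (diag_mx (indicator s) *m col i K)^T.
  have Zk : Z *m k^T = 0 by rewrite trmxK colE !mulmxA ZK mul0mx.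
  have hk : dot k h = 0.
  apply: (@lower_face_relation h s) => //; last first.
  - move/(congr1 usubmx): Zk; rewrite mul_col_mx col_mxKu => /(congr1 trmx).
    by rewrite trmx_mul !trmxK linear0 => ->; rewrite linear0.
  - move/(congr1 dsubmx)/matrixP/(_ 0 0): Zk.
    rewrite mul_col_mx col_mxKd linear0 mxE [RHS]mxE => Zk; rewrite -[RHS]Zk.
    by apply: eq_bigr => j _; rewrite !mxE mul1r.
  - by move=> j js; rewrite mxE mul_diag_mx !mxE (negPf js) mul0r.
  by rewrite [RHS]mxE; move: hk; rewrite dotC /dot trmxK colE !mulmxA -colE mxE.
move=> /submxP[D hD]; exists (lsubmx D), (rsubmx D 0 0) => i si.
have -> : h 0 i = (D *m Z) 0 i.
  move: hD; rewrite mulmxA; move: (D *m Z) => W /matrixP/(_ 0 i).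
  by rewrite !mul_mx_diag !mxE si !mulr1.
rewrite -[D in RHS]hsubmxK mul_row_col [RHS]mxE; congr (_ + _); last first.
  by rewrite [RHS]mxE big_ord1 [const_mx _ _ _]mxE mulr1.
exact: dot_row.
Qed.

Lemma lower_face_height h s u b l : lower_face h s ->
  (forall i, i \in s -> dot u (row i P) + b = h 0 i) ->
  weights l -> (forall i, i \notin s -> l 0 i = 0) ->
  lower_height h (l *m P) = dot u (l *m P) + b.
Proof.
move=> fs ub wl ls; have [l' [wl' lP' -> lmin]] := lower_height_min h wl.
have -> : dot l' h = dot l h.
  by apply/eqP; rewrite eq_le lmin//= (lower_face_le fs).
rewrite [dot u _]dotC dot_mulmx !dotE -[b]mulr1 -wl.2 mulr_sumr -big_split/=.
apply: eq_bigr => i _; have [si|/ls->] := boolP (i \in s); last first.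
  by rewrite !mul0r mulr0 addr0.
by rewrite -ub//= mulrDr [b * _]mulrC dot_row.
Qed.

Lemma affine_on_lower_height h s : lower_face h s ->
  exists (u : 'rV[R]_n) (b : R),
    forall x, spanned s x -> lower_height h x = dot u x + b.
Proof.
move=> fs; have [u [b ub]] := lower_face_affine fs.
by exists u, b => _ [l [wl ls] <-]; exact: (lower_face_height fs).
Qed.

(* The face is the union of the supports of optimal weights of points of [Q]:
   by affineness the average of these weights is optimal for the average of
   those points. *)
Lemma affine_lower_face h (Q : set 'rV[R]_n) u b :
  Q `<=` [set l *m P | l in @weights R N] -> convex_set Q ->
  (forall x, Q x -> lower_height h x = dot u x + b) ->
  exists2 s, lower_face h s & Q `<=` spanned s.
Proof.
move=> QP cQ Qub.
pose opt l x := [/\ weights l, l *m P = x, lower_height h x = dot l h &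
  forall l', weights l' -> l' *m P = x -> dot l h <= dot l' h].
have optex x : Q x -> exists l, opt l x.
  by move=> /QP[l0 wl0 <-]; exact: lower_height_min.
pose s := [set i : 'I_N | `[< exists l x, [/\ Q x, opt l x & l 0 i != 0] >]]%SET.
have Qs : Q `<=` spanned s.
  move=> x Qx; have [l lx] := optex _ Qx; have [wl lP _ _] := lx.
  exists l => //; split=> // i; rewrite inE => /asboolPn nl.
  by apply/eqP; apply: contra_notT nl => li; exists l, x.
exists s => //.
have [->|[i0 i0s]] := set_0Vmem s.
  move=> l l0; rewrite cards0 => lsum _.
  suff -> : l = 0.
    suff -> : indicator finset.set0 = 0 by rewrite lexx.
    by apply/rowP => i; rewrite !mxE inE.
  apply/rowP => i; rewrite mxE; apply/eqP.
  have := lsum; move/eqP; rewrite psumr_eq0// => /allP/(_ i).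
  by rewrite mem_index_enum => /(_ isT).
(* For [i] outside [s] the fixed [i0] serves as a substitute, so that all rows of [Lm] are optimal
   weights; the averaging vector [w] ignores these rows. *)
have /choice[L LP] : forall i, exists l,
    [/\ Q (l *m P), opt l (l *m P) & i \in s -> l 0 i != 0].
  move=> i; pose j := if i \in s then i else i0.
  have : j \in s by rewrite /j; case: ifP.
  rewrite inE => /asboolP[l [x [Qx lx lj]]]; exists l.
  by have [wl lP _ _] := lx; rewrite lP; split=> // si; move: lj; rewrite /j si.
pose Lm : 'M[R]_N := \matrix_i L i; pose w : 'rV[R]_N := \row_j (#|s|%:R^-1 * (j \in s)%:R).
have m0 : 0 < #|s|%:R :> R by rewrite ltr0n; apply/card_gt0P; exists i0.
have ww : weights w.
  split=> [i|]; first by rewrite mxE mulr_ge0// invr_ge0 ltW.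
  rewrite (eq_bigr (fun i => #|s|%:R^-1 * indicator s 0 i)) => [|i _].
    by rewrite -mulr_sumr sum_indicator mulVf// gt_eqF.
  by rewrite !mxE.
pose lb := w *m Lm.
have wlb : weights lb.
  apply: (@convex_weights R N N Lm (@weights R N)) => //.
    by apply/convex_setP => x y t t01; exact: weights_conv.
  by move=> i; rewrite rowK; have [_ []] := LP i.
have Qlb : Q (lb *m P).
  rewrite /lb -mulmxA; apply: (convex_weights cQ) => // i.
  by rewrite row_mul rowK; have [] := LP i.
have lbh : lower_height h (lb *m P) = dot lb h.
  rewrite Qub// /lb -mulmxA dotC [in RHS]dot_mulmx !dot_mulmx !dotE.
  rewrite -[b]mulr1 -ww.2 mulr_sumr -big_split/=; apply: eq_bigr => i _.
  rewrite [b * _]mulrC -mulrDr -!dot_row row_mul rowK.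
  have [Qi [_ _ hi _] _] := LP i.
  by rewrite -Qub// hi dotC.
have lbmin l' : weights l' -> l' *m P = lb *m P -> dot lb h <= dot l' h.
  by rewrite -lbh; have [l [_ _ -> +]] := lower_height_min h wlb; apply.
have lb0 i : i \in s -> 0 < lb 0 i.
  move=> si; rewrite mxE (bigD1 i)//= !mxE si mulr1 ltr_wpDr//; last first.
    rewrite mulr_gt0 ?invr_gt0// lt_def; have [_ [[+ _] _ _ _] ->//] := LP i.
    exact.
  apply: sumr_ge0 => j _; rewrite !mxE; apply: mulr_ge0.
    by rewrite mulr_ge0// invr_ge0 ltW.
  by have [_ [[]]] := LP j.
(* With [e] at most every [lb 0 i] on [s], the vector [lb + e (l - indicator s)] stays nonnegative.
   Comparing its height with the minimal height of [lb] gives the inequality for [l]. *)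
pose e := \big[Order.min/1]_(i in s) lb 0 i.
have e0 : 0 < e by apply: lt_bigmin.
move=> l l0 lsum lP.
have entry i : (lb + e *: (l - indicator s)) 0 i = lb 0 i + e * (l 0 i - indicator s 0 i).
  by move: lb e {wlb Qlb lbh lbmin lb0 e0} => z e; rewrite !mxE.
have := lbmin (lb + e *: (l - indicator s)).
rewrite mulmxDl -scalemxAl mulmxBl lP subrr scaler0 addr0 dotDl dotZl dotBl.
rewrite lerDl pmulr_rge0// subr_ge0; apply=> //; split=> [i|].
  rewrite entry [indicator s 0 i]mxE; have [si|si] := boolP (i \in s).
    have : e <= lb 0 i by exact: bigmin_le_cond.
    by rewrite mulr1n; have := l0 i; nra.
  by rewrite subr0; have := l0 i; have := wlb.1 i; nra.
under eq_bigr do rewrite entry.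
by rewrite big_split/= -mulr_sumr sumrB lsum sum_indicator subrr mulr0 addr0 wlb.2.
Qed.

End LowerHull.

(** * The dual subdivision as a finite datum *)

Section DualSubdivision.
Variables (R : realType) (D : set 'rV[R]_3).
Local Notation A := (lattice_points D).
Local Notation N := #|`A|.
Implicit Type c : 'rV[int]_3 -> R.

Definition lattice_point (i : 'I_N) : 'rV[int]_3 := nth 0 (enum_fset A) i.

Definition lattice_matrix : 'M[R]_(N, 3) := \matrix_i embed R (lattice_point i).

Lemma lattice_point_in i : lattice_point i \in A.
Proof. by rewrite /lattice_point mem_nth//. Qed.

Lemma lattice_pointP w : w \in A -> exists i, lattice_point i = w.
Proof.
move=> wA; have wN : (index w (enum_fset A) < N)%N by rewrite index_mem.
by exists (Ordinal wN); rewrite /lattice_point nth_index.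
Qed.

Lemma lattice_point_inj : injective lattice_point.
Proof.
move=> i j /eqP; rewrite nth_uniq ?fset_uniq// => /eqP.
exact: val_inj.
Qed.

Lemma image_lattice_points T (f : 'rV[int]_3 -> T) :
  [set f w | w in [set` A]] = [set f (lattice_point i) | i in [set: 'I_N]].
Proof.
apply/seteqP; split=> [_ [w wA <-]|_ [i _ <-]].
  by have [i <-] := lattice_pointP wA; exists i.
by exists (lattice_point i) => //; exact: lattice_point_in.
Qed.

Lemma lower_hullE c x :
  lower_hull D c x = lower_height lattice_matrix (- coef_vector D c) x.
Proof.
rewrite /lower_hull image_lattice_points /lower_height; congr inf.
pose X : 'M[R]_(N, 3 + 1) := row_mx lattice_matrix (- coef_vector D c)^T.
rewrite (_ : [set _ | i in _] = [set row i X | i in [set: 'I_N]]); last first.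
  apply: eq_imagel => i _; rewrite /X row_row_mx rowK; congr row_mx.
  by apply/rowP => j; rewrite !mxE.
rewrite conv_hull_rows; apply/seteqP; split=> y /=.
  move=> [l wl]; rewrite /X mul_mx_row => /eq_row_mx[lx ly].
  by exists l => //; split=> //; rewrite /dot ly mxE.
move=> [l wl [lx ly]]; exists l => //; rewrite /X mul_mx_row lx; congr row_mx.
by apply/rowP => j; rewrite ord1 [RHS]mxE -ly.
Qed.

Hypothesis hullD : D = conv_hull [set row i lattice_matrix | i in [set: 'I_N]].

(** Reduces the analytic condition of affineness on [Q] to containment in the span of one of
    finitely many sets of lattice points; only the collection of lower faces then depends on [c]. *)
Lemma linear_pieceP c Q : linear_piece D c Q <-> convex_set Q /\
  exists2 s, lower_face lattice_matrix (- coef_vector D c) s &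
    Q `<=` spanned lattice_matrix s.
Proof.
split=> [[QD cQ [u [b Qub]]]|[cQ [s fs Qs]]].
  split=> //; apply: (@affine_lower_face _ _ _ _ _ _ u b) => //.
    by rewrite -conv_hull_rows -hullD.
  by move=> x /Qub; rewrite lower_hullE.
split=> //.
  by rewrite [X in _ `<=` X]hullD conv_hull_rows => x /Qs[l [wl _] <-]; exists l.
have [u [b ub]] := affine_on_lower_height fs.
by exists u, b => x /Qs/ub; rewrite lower_hullE.
Qed.

(* The dual subdivision depends only on this finite datum. *)
Definition face_type c : {set {set 'I_N}} :=
  [set s | `[< lower_face lattice_matrix (- coef_vector D c) s >]]%SET.

Lemma eq_dual_subdivision c c' :
  face_type c = face_type c' -> dual_subdivision D c = dual_subdivision D c'.
Proof.
move=> cc'; suff E : linear_piece D c = linear_piece D c' by rewrite /dual_subdivision E.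
have F s : lower_face lattice_matrix (- coef_vector D c) s <->
    lower_face lattice_matrix (- coef_vector D c') s.
  move/setP/(_ s): cc'; rewrite !inE => E.
  by split=> /asboolP; [rewrite E|rewrite -E] => /asboolP.
apply/funext => Q; apply/propext.
split=> /linear_pieceP[cQ [s fs Qs]]; apply/linear_pieceP; split=> //;
  by exists s => //; apply/F.
Qed.

End DualSubdivision.

(** * Orders of Puiseux series *)

Section PuiseuxOrder.
Variable R : realType.
Local Notation K := (puiseux R).
Implicit Types (a b : K) (q r s : rat).

Lemma pcoefD a b s : (a + b) s = a s + b s. Proof. by []. Qed.

Lemma pcoefN a s : (- a) s = - a s. Proof. by []. Qed.

Lemma pcoef0 s : (0 : K) s = 0. Proof. by []. Qed.

Lemma pcoef_sum I (t : seq I) (P : pred I) (F : I -> K) s :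
  (\sum_(i <- t | P i) F i) s = \sum_(i <- t | P i) F i s.
Proof. by elim/big_rec2: _ => // i x y _ <-. Qed.

Lemma pcoefMz a (n : int) s : (a * n%:~R) s = a s * n%:~R.
Proof.
rewrite !mulrzr.
have nat m : (a *+ m) s = a s *+ m by elim: m => // m IH; rewrite !mulrS pcoefD IH.
by case: n => n; rewrite ?NegzE ?mulrNz -!pmulrn ?pcoefN nat.
Qed.

Lemma fsbig_single (F : rat -> R[i]) q : (forall s, s != q -> F s = 0) ->
  \sum_(s \in [set: rat]) F s = F q.
Proof.
by move=> F0; rewrite -(fsbig_widen [set q]) ?fsbig_set1// => s /= [_ /eqP/F0].
Qed.

Definition has_order a q : Prop := a q != 0 /\ forall s, s < q -> a s = 0.

Lemma has_order_uniq a q r : has_order a q -> has_order a r -> q = r.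
Proof.
move=> [aq q0] [ar r0]; apply: le_anti; rewrite !leNgt; apply/andP; split.
  by apply/negP => /q0 /eqP; rewrite (negPf ar).
by apply/negP => /r0 /eqP; rewrite (negPf aq).
Qed.

Lemma has_order_ex a : a != 0 -> exists q, has_order a q.
Proof.
move=> /Val_min[q [aq qmin _]]; exists q; split=> // s sq.
by apply/eqP; apply: contraTT sq => /qmin; rewrite leNgt.
Qed.

Lemma has_order_neq0 a q : has_order a q -> a != 0.
Proof. by move=> [aq _]; apply: contra_neq aq => ->. Qed.

Lemma has_orderP a q : has_order a q <-> Val a = (- ratr q)%:E.
Proof.
suff main r : has_order a r -> Val a = (- ratr r)%:E.
  split=> [/main//|Va]; have a0 : a != 0 by apply/eqP => a0; rewrite a0 Val0 in Va.
  have [r ar] := has_order_ex a0; have := main _ ar.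
  by rewrite Va => -[/oppr_inj/fmorph_inj->].
move=> ar; have [q' [aq' q'min ->]] := Val_min (has_order_neq0 ar).
rewrite (@has_order_uniq a r q')//; split=> // s sq.
by apply/eqP; apply: contraTT sq => /q'min; rewrite leNgt.
Qed.

Lemma has_orderM a b q r : has_order a q -> has_order b r -> has_order (a * b) (q + r).
Proof.
move=> [aq a0] [br b0]; split=> [|s sqr]; rewrite [pcoef _ _]/(pmul _ _ _) /pmul.
  rewrite (@fsbig_single _ q) ?[q + r]addrC ?addrK ?mulf_neq0// => s.
  case: ltgtP => // [/a0->|qs] _; first by rewrite mul0r.
  by rewrite b0 ?mulr0// ltrBlDr ltrD2l.
apply: fsbig1 => u _; have [/a0->|qu] := ltP u q; first by rewrite mul0r.
by rewrite b0 ?mulr0// ltrBlDl (lt_le_trans sqr)// lerD2r.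
Qed.

Lemma has_order1 : has_order 1 0.
Proof.
split=> [|s s0]; rewrite [pcoef _ _]/(pone _ _) /pone ?eqxx ?oner_eq0//.
by rewrite lt_eqF.
Qed.

Lemma has_orderV a q : has_order a q -> has_order a^-1 (- q).
Proof.
move=> aq; have a0 := has_order_neq0 aq.
have [r ar] : exists r, has_order a^-1 r by apply: has_order_ex; rewrite invr_eq0.
suff -> : - q = r by [].
apply/eqP; rewrite eq_sym -addr_eq0 addrC; apply/eqP.
by apply: has_order_uniq (has_orderM aq ar) _; rewrite mulfV//; exact: has_order1.
Qed.

Lemma has_orderX a q (n : nat) : has_order a q -> has_order (a ^+ n) (q *+ n).
Proof.
move=> aq; elim: n => [|n IH]; first exact: has_order1.
by rewrite exprS mulrS; exact: has_orderM.
Qed.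

Lemma has_orderXz a q (n : int) : has_order a q -> has_order (a ^ n) (q *~ n).
Proof.
move=> aq; case: n => n; first exact: has_orderX.
by rewrite NegzE mulrNz -invr_expz; exact/has_orderV/has_orderX.
Qed.

Lemma has_order_monomial (z : 'rV[K]_3) (p : 'I_3 -> rat) w :
  (forall i, has_order (z 0 i) (p i)) ->
  has_order (monomial z w) (\sum_i p i * (w 0 i)%:~R).
Proof.
move=> zp; rewrite /monomial; elim/big_ind2: _ => //.
- exact: has_order1.
- by move=> a q b r; exact: has_orderM.
- by move=> i _; rewrite mulrzr; exact: has_orderXz.
Qed.

Fact is_puiseux_term (x : R[i]) q : is_puiseux (fun s => if s == q then x else 0).
Proof.
apply/is_puiseuxP; exists `|denq q|%N, (numq q), (fun n => if n == 0 then x else 0).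
have d0 : (0 < `|denq q|)%N by rewrite absz_gt0 denq_eq0.
have E : `|denq q|%:R = (denq q)%:~R :> rat by rewrite -[in RHS]absz_denq.
split=> //; first exact: geo_bounded_single.
apply: eq_pseries => // [s|n].
  case: (eqVneq s q) => [-> _|_]; last by rewrite eqxx.
  by exists 0%N; rewrite addr0 E divq_num_den.
rewrite -[in X in _ == X](divq_num_den q) -E eqr_div; last 2 first.
- by rewrite pnatr_eq0 -lt0n.
- by rewrite pnatr_eq0 -lt0n.
rewrite (inj_eq (mulIf _)) ?pnatr_eq0 -?lt0n//.
by rewrite -subr_eq0 addrC addKr pnatr_eq0.
Qed.

(* $x t^q$ *)
Definition term (x : R[i]) q : K := Puiseux (asboolT (is_puiseux_term x q)).

Lemma pcoef_term x q s : term x q s = if s == q then x else 0.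
Proof. by []. Qed.

Lemma has_order_term x q : x != 0 -> has_order (term x q) q.
Proof.
by move=> x0; split=> [|s sq]; rewrite pcoef_term ?eqxx// lt_eqF.
Qed.

End PuiseuxOrder.

Fact Re_is_zmod_morphism (R : realType) : zmod_morphism (@complex.Re R).
Proof. by move=> [a b] [a' b']. Qed.

Fact Im_is_zmod_morphism (R : realType) : zmod_morphism (@complex.Im R).
Proof. by move=> [a b] [a' b']. Qed.

HB.instance Definition _ (R : realType) := GRing.isZmodMorphism.Build R[i] R
  (@complex.Re R) (@Re_is_zmod_morphism R).
HB.instance Definition _ (R : realType) := GRing.isZmodMorphism.Build R[i] R
  (@complex.Im R) (@Im_is_zmod_morphism R).

(** * From singular points to affine relations *)

Section SingularRelation.
Variables (R : realType) (D : set 'rV[R]_3).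
Local Notation A := (lattice_points D).
Local Notation N := #|`A|.
Local Notation P := (lattice_matrix D).
Implicit Types (c : 'rV[int]_3 -> R) (f : laurent R).

Hypothesis finD : finite_set [set w | D (embed R w)].

Lemma in_lattice_points w : (w \in A) = `[< D (embed R w) >].
Proof. by rewrite /lattice_points in_fset_set. Qed.

Lemma finsupp_tropicalizes f c : tropicalizes_to D f c -> finsupp f = A.
Proof.
move=> [nf Vf]; apply/fsetP => w; rewrite mem_finsupp; apply/idP/idP => [fw|wA].
  rewrite in_lattice_points; apply/asboolP; rewrite -nf.
  by apply: conv_hull_gen; exists w.
by apply/eqP => fw; have := Vf w wA; rewrite fw Val0.
Qed.

Lemma sum_lattice_points (V : nmodType) (F : 'rV[int]_3 -> V) :
  \sum_(w <- A) F w = \sum_(i < N) F (lattice_point i).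
Proof. by rewrite (big_nth 0) big_mkord. Qed.

Lemma monomial_delta (z : 'rV[puiseux R]_3) w i : z 0 i != 0 ->
  monomial z (w - delta_mx 0 i) * z 0 i = monomial z w.
Proof.
move=> z0; rewrite /monomial (bigD1 i)// [RHS](bigD1 i)// mulrAC.
have -> : z 0 i ^ (w - delta_mx 0 i) 0 i * z 0 i = z 0 i ^ w 0 i.
  by rewrite -[X in _ * X]expr1z -expfzDr// !mxE !eqxx subrK.
rewrite [in LHS](eq_bigr (fun j => z 0 j ^ w 0 j))// => j ji.
by rewrite !mxE eqxx (negPf ji) subr0.
Qed.

(* Evaluation and logarithmic derivatives of [f] at a singular point [z], as
   linear relations between the terms [f w * monomial z w]. *)
Lemma singular_pointP f (z : 'rV[puiseux R]_3) : (forall i, z 0 i != 0) ->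
  singular_point f z <->
  \sum_(w <- finsupp f) f w * monomial z w = 0 /\
  forall j, \sum_(w <- finsupp f) f w * monomial z w * (w 0 j)%:~R = 0.
Proof.
move=> z0; have E j : \sum_(w <- finsupp f) f w * monomial z w * (w 0 j)%:~R =
    laurent_deriv f j z * z 0 j.
  rewrite mulr_suml; apply: eq_bigr => w _.
  by rewrite -[RHS]mulrA monomial_delta// [RHS]mulrAC.
split=> [[_ f0 df]|[f0 df]]; split=> // j; first by rewrite E df mul0r.
by apply/eqP; have /eqP := df j; rewrite E mulf_eq0 (negPf (z0 j)) orbF.
Qed.

Definition affine_relation (k : 'rV[R]_N) : Prop := \sum_i k 0 i = 0 /\ k *m P = 0.

Lemma affine_relationP k : affine_relation k <-> \sum_i k 0 i = 0 /\
  forall j, \sum_i k 0 i * (lattice_point i 0 j)%:~R = 0.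
Proof.
have E j : (k *m P) 0 j = \sum_i k 0 i * (lattice_point i 0 j)%:~R.
  by rewrite mxE; apply: eq_bigr => i _; rewrite !mxE.
split=> -[k0 kP]; split=> //; first by move=> j; rewrite -E kP mxE.
by apply/rowP => j; rewrite E kP mxE.
Qed.

(* The leading coefficients of the terms of minimal order of [f] at [z] satisfy
   the same linear relations as the terms themselves. *)
Lemma singular_relation c : (0 < N)%N -> singular_tropical D c ->
  exists (T : {set 'I_N}) (u : 'rV[R]_3) (b : R) (k : 'rV[R]_N),
  [/\ forall i, i \in T -> c (lattice_point i) = dot u (row i P) + b,
      forall i, i \notin T -> k 0 i = 0, k != 0 & affine_relation k].
Proof.
move=> N0 [f [z [fc sf]]]; have [z0 _ _] := sf.
have [f0 fj] := (singular_pointP f z0).1 sf; have fA := finsupp_tropicalizes fc.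
rewrite fA in f0 fj; rewrite sum_lattice_points in f0.
pose B (i : 'I_N) := f (lattice_point i) * monomial z (lattice_point i).
have {}fj j : \sum_(i < N) B i * (lattice_point i 0 j)%:~R = 0.
  by rewrite -[RHS](fj j) sum_lattice_points.
have [p zp] := choice (fun i : 'I_3 => has_order_ex (z0 i)).
have /choice[e fe] : forall i : 'I_N, exists q, has_order (f (lattice_point i)) q.
  move=> i; apply: has_order_ex.
  by rewrite -mem_finsupp fA lattice_point_in.
pose v (i : 'I_N) := e i + \sum_j p j * (lattice_point i 0 j)%:~R.
have Bv i : has_order (B i) (v i) by exact/has_orderM/has_order_monomial.
have [i0 _ vmin] : exists2 i0, true & forall i, v i0 <= v i.
  by case: (arg_minP v (erefl (xpredT (Ordinal N0)))) => i _ vmin; exists i => // j; exact: vmin.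
pose T := [set i | v i == v i0]%SET; pose k i := B i (v i0).
have kT i : i \notin T -> k i = 0.
  rewrite inE => iT; have [_] := Bv i; apply; by rewrite lt_neqAle eq_sym iT vmin.
(* The leading coefficients are complex. Real or imaginary part, whichever is nonzero at [i0], turns
   their relation into a nonzero real one, since it is additive and the lattice points are
   integral. *)
have [g g0] : exists g : {additive R[i] -> R}, g (k i0) != 0.
  have : k i0 != 0 by case: (Bv i0).
  rewrite eq_complex negb_and => /orP[]; first by exists (@complex.Re R).
  by exists (@complex.Im R).
have gint x (n : int) : g (x * n%:~R) = g x * n%:~R by rewrite !mulrzr raddfMz.
exists T, (\row_j ratr (p j)), (- ratr (v i0)), (\row_i g (k i)); split.
- move=> i; rewrite inE => /eqP <-.
  have := (has_orderP _ _).1 (fe i); rewrite (fc.2 _ (lattice_point_in i)) => -[->].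
  suff -> : dot (\row_j ratr (p j)) (row i P) =
      ratr (\sum_j p j * (lattice_point i 0 j)%:~R).
    by rewrite /v rmorphD/= opprD addrCA subrr addr0.
  rewrite dotE rmorph_sum; apply: eq_bigr => j _.
  by rewrite !mxE rmorphM/= ratr_int.
- by move=> i /kT ki; rewrite mxE ki raddf0.
- by apply/eqP => /rowP/(_ i0)/eqP; rewrite !mxE (negPf g0).
- apply/affine_relationP; split=> [|j].
    rewrite -[RHS](raddf0 g) -(pcoef0 R (v i0)) -f0 pcoef_sum raddf_sum.
    by apply: eq_bigr => i _; rewrite mxE.
  rewrite -[RHS](raddf0 g) -(pcoef0 R (v i0)) -(fj j) pcoef_sum raddf_sum.
  by apply: eq_bigr => i _; rewrite mxE pcoefMz gint.
Qed.

End SingularRelation.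

(** * The upper bound for the dimension of the deformation space *)

Section Simplex.
Variable R : realType.

Definition subweights d (t : 'rV[R]_d) : Prop :=
  (forall i, 0 <= t 0 i) /\ \sum_i t 0 i <= 1.

Lemma simplexE n d (p : 'rV[R]_n) (M : 'M[R]_(d, n)) :
  conv_hull (p |` [set p + row i M | i in [set: 'I_d]]) =
  [set p + t *m M | t in @subweights d].
Proof.
apply/seteqP; split.
  apply: conv_hull_sub => [_ _ a /andP[a0 a1] [t [t0 t1] <-] [t' [t'0 t'1] <-]|].
    exists (a *: t + (1 - a) *: t').
      split=> [i|]; first by rewrite !mxE; have := t0 i; have := t'0 i; nra.
      rewrite (eq_bigr (fun i => a * t 0 i + (1 - a) * t' 0 i)) => [|i _].
        by rewrite big_split/= -!mulr_sumr; nra.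
      by rewrite !mxE.
    rewrite mulmxDl -!scalemxAl !scalerDr addrACA; congr (_ + _).
    by rewrite -scalerDl addrC subrK scale1r.
  move=> _ [->|[i _ <-]].
    exists 0; last by rewrite mul0mx addr0.
    by split=> [i|]; [rewrite mxE|rewrite big1// => i _; rewrite mxE].
  exists (delta_mx 0 i); last by rewrite -rowE.
  by have [w0 w1] := weights_delta R i; split=> //; rewrite w1.
move=> _ [t [t0 t1] <-].
pose X : 'M[R]_(1 + d, n) := col_mx p (\matrix_i (p + row i M)).
pose l : 'rV[R]_(1 + d) := row_mx (1 - \sum_i t 0 i)%:M t.
have -> : p + t *m M = l *m X.
  have tE : t *m const_mx 1 = (\sum_i t 0 i)%:M :> 'M[R]_1.
    apply/rowP => j; rewrite ord1 !mxE eqxx mulr1n.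
    by apply: eq_bigr => i _; rewrite mxE mulr1.
  have XE : \matrix_i (p + row i M) = (const_mx 1 : 'cV[R]_d) *m p + M.
    by apply/matrixP => i j; rewrite !mxE big_ord1 !mxE mul1r.
  rewrite /l /X mul_row_col mul_scalar_mx XE mulmxDr mulmxA tE mul_scalar_mx.
  by rewrite addrA -scalerDl subrK scale1r.
apply: (convex_weights (@convex_conv_hull _ _ _)) => [i|].
  rewrite /X; case: (splitP i) => j ij.
    rewrite (_ : i = lshift d j) ?rowKu; last exact: val_inj.
    by apply: conv_hull_gen; left; rewrite ord1; apply/rowP => k; rewrite mxE.
  rewrite (_ : i = rshift 1 j) ?rowKd; last exact: val_inj.
  by apply: conv_hull_gen; right; exists j => //; rewrite rowK.
split=> [i|].
  rewrite /l mxE; case: splitP => j _; last exact: t0.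
  by rewrite !mxE !ord1 eqxx mulr1n subr_ge0.
rewrite big_split_ord/= big_ord1 /l row_mxEl mxE eqxx mulr1n.
by under eq_bigr do rewrite row_mxEr; rewrite subrK.
Qed.

End Simplex.

Section ThinDeformationSpace.
Variable R : realType.

Lemma closure_sub_closed (T : topologicalType) (X Y : set T) :
  closed Y -> X `<=` Y -> closure X `<=` Y.
Proof. by move=> /closure_id cY /closureS; rewrite -cY. Qed.

(* A simplex contains an affine image of the moment curve, on which a product
   of affine forms vanishes only if one of them vanishes on the simplex. *)
Lemma simplex_sub_hyperplanes n d (I : finType) (S : pred I) (k : I -> 'rV[R]_n)
    (p : 'rV[R]_n) (M : 'M[R]_(d, n)) :
  conv_hull (p |` [set p + row i M | i in [set: 'I_d]]) `<=`
    [set x | \prod_(T | S T) dot x (k T) = 0] ->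
  exists2 T, S T & forall i, dot (row i M) (k T) = 0.
Proof.
move=> sub.
(* Up to the factor [d + 1], the linear form [k T] along the curve with simplex coordinates
   [s ^ (i + 1) / (d + 1)]; the denominator keeps their sum at most 1 for [s] in [[0, 1]]. *)
pose q T := (d.+1%:R * dot p (k T))%:P +
  \sum_(i < d) dot (row i M) (k T) *: 'X^(i.+1).
have qE T s : (q T).[s] =
    d.+1%:R * dot (p + (\row_(i < d) (s ^+ i.+1 / d.+1%:R)) *m M) (k T).
  rewrite hornerD hornerC horner_sum dotDl mulrDr dot_mulmx; congr (_ + _).
  rewrite dotE mulr_sumr; apply: eq_bigr => i _.
  rewrite hornerZ hornerXn mxE -dot_row [in RHS]dotC; field.
  by rewrite nat1r pnatr_eq0.
have : \prod_(T | S T) q T == 0.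
  apply: contraT => Q0; set Q := \prod_(T | _) _ in Q0.
  (* These are [size Q] distinct roots of [Q] in [(0, 1]], more than its degree allows. *)
  pose rs : seq R := [seq j.+1%:R^-1 | j <- iota 0 (size Q)].
  have := @max_poly_roots _ Q rs Q0; rewrite size_map size_iota ltnn; apply.
    apply/allP => _ /mapP[j _ ->]; rewrite /root horner_prod.
    have s0 : 0 <= j.+1%:R^-1 :> R by rewrite invr_ge0.
    have s1 : j.+1%:R^-1 <= 1 :> R by rewrite invf_le1// ler1n.
    set s := j.+1%:R^-1 in s0 s1 *.
    suff : \prod_(T | S T) dot (p + (\row_(i < d) (s ^+ i.+1 / d.+1%:R)) *m M) (k T) = 0.
      move=> /eqP/prodf_eq0[T ST /eqP T0]; apply/prodf_eq0.
      by exists T => //; rewrite qE T0 mulr0.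
    apply: sub; rewrite simplexE; eexists; last reflexivity.
    split=> [i|]; first by rewrite mxE mulr_ge0// exprn_ge0.
    apply: (@le_trans _ _ (\sum_(i < d) d.+1%:R^-1)).
      apply: ler_sum => i _; rewrite mxE ler_piMl// exprn_ile1//.
    rewrite sumr_const card_ord -[leLHS]mulr_natl ler_pdivrMr ?mul1r ?ltr0n//.
    by rewrite ler_nat.
  rewrite map_inj_uniq ?iota_uniq// => i j /invr_inj/eqP.
  by rewrite eqr_nat => /eqP[].
move=> /prodf_eq0[T ST /eqP qT]; exists T => // i.
have := congr1 (fun q : {poly R} => q`_i.+1) qT.
rewrite coefD coefC coef_sum add0r coef0 (bigD1 i)//= coefZ coefXn eqxx mulr1.
rewrite big1 ?addr0// => j ji; rewrite coefZ coefXn eqSS.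
by rewrite eq_sym val_eqE (negPf ji) mulr0.
Qed.

Section UpperBound.
Variable D : set 'rV[R]_3.
Local Notation A := (lattice_points D).
Local Notation N := #|`A|.
Local Notation P := (lattice_matrix D).
Local Notation C := (cokermx (const_mx 1 : 'rV[R]_N)).

Hypothesis finD : finite_set [set w | D (embed R w)].
Hypothesis N0 : (0 < N)%N.

Lemma rank_cokermx_ones : \rank C = N.-1.
Proof.
rewrite mxrank_coker rank_rV; case: eqP => [/rowP/(_ (Ordinal N0))/eqP|_].
  by rewrite !mxE oner_eq0.
by rewrite subn1.
Qed.

(** A linear form with coefficient sum 0 kills [(1, ..., 1)], hence descends to the quotient in
    which the deformation space lives. The proof compares dimensions. *)
Lemma factor_cokermx_ones (k : 'rV[R]_N) : \sum_i k 0 i = 0 ->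
  exists k' : 'rV[R]_N, C *m k'^T = k^T.
Proof.
move=> k0; set O := const_mx 1 : 'rV_N.
have Ok : (k <= kermx O^T)%MS.
  apply/sub_kermxP/rowP => j; rewrite ord1 !mxE -[RHS]k0.
  by apply: eq_bigr => i _; rewrite !mxE mulr1.
have CO : (C^T <= kermx O^T)%MS.
  by apply/sub_kermxP; rewrite -trmx_mul mulmx_coker trmx0.
have : (kermx O^T <= C^T)%MS.
  by rewrite -(mxrank_leqif_sup CO) mxrank_ker !mxrank_tr rank_cokermx_ones
     -rank_cokermx_ones mxrank_coker.
move=> /(submx_trans Ok)/submxP[k' ->]; exists k'.
by rewrite trmx_mul trmxK.
Qed.

Definition affinely_dependent (T : {set 'I_N}) (k : 'rV[R]_N) : Prop :=
  [/\ forall i, i \notin T -> k 0 i = 0, k != 0 & affine_relation k].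

(** The closure lies in the row space of [C], of dimension [N - 1], and in the zero set of a product
    of linear forms, one for each set [T] carrying an affine relation. A simplex of dimension at
    least [N - 1] spans that row space; one of the forms would vanish on it, and its relation [k T]
    would be 0. *)
Lemma deformation_space_thin c d : (N <= d.+1)%N ->
  ~ contains_simplex (closure (@deformation_space R D c)) d.
Proof.
move=> Nd [p [M [freeM sub]]].
(* One relation per [T] is enough: coefficients that are affine on [T] are killed by every affine
   relation supported on [T], not only by the one coming from the singular point. *)
have /choice[k kP] (T : {set 'I_N}) : exists k,
    (exists k0, affinely_dependent T k0) -> affinely_dependent T k.
  by have [[k Tk]|nT] := pselect (exists k, affinely_dependent T k); [exists k|exists 0].
pose S (T : {set 'I_N}) := `[< exists k0, affinely_dependent T k0 >].
have {kP}Sk T : S T -> affinely_dependent T (k T) by move=> /asboolP/kP.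
have /choice[k' k'P] (T : {set 'I_N}) : exists k', S T -> C *m k'^T = (k T)^T.
  have [/Sk[_ _ [/factor_cokermx_ones[k' k'C] _]]|_] := boolP (S T); last by exists 0.
  by exists k'.
have subZ : closure (@deformation_space R D c) `<=`
    [set x | \prod_(T | S T) dot x (k' T) = 0] `&` [set x | x *m cokermx C = 0].
  apply: closure_sub_closed.
    apply: closedI.
      apply: (@preimage_closed _ _ (fun x => \prod_(T | S T) dot x (k' T)) [set 0]).
        move=> x _; apply: continuous_big => [|T _]; first exact: mul_continuous.
        exact: linear_rV_continuous.
      exact: closed_eq.
    rewrite (_ : [set x | _] = \bigcap_(j in [set: 'I_N])
        [set x | dot x (col j (cokermx C))^T = 0]).
      by apply: closed_bigI => j _; exact: closed_linear_eq.
    apply/seteqP; split=> [x /= xC j _|x xC] /=; first by rewrite dot_col xC mxE.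
    by apply/rowP => j; rewrite -dot_col mxE; exact: xC.
  move=> _ [c' [c's _] <-]; split; last by rewrite /= -mulmxA mulmx_coker mulmx0.
  have [T [u [b [k0 [cT k0T k00 rk0]]]]] := singular_relation finD N0 c's.
  have ST : S T by apply/asboolP; exists k0; split.
  rewrite /= (bigD1 T)//= [X in X * _](_ : _ = 0) ?mul0r//.
  rewrite /dot -mulmxA k'P// -/(dot _ _); have [kT _ [ksum kC]] := Sk _ ST.
  have -> : dot (coef_vector D c') (k T) = dot (k T *m P) u + b * \sum_i k T 0 i.
    rewrite dotC dot_mulmx !dotE mulr_sumr -big_split; apply: eq_bigr => i _.
    have [iT|/kT->] := boolP (i \in T); last by rewrite /= !mul0r mulr0 addr0.
    by rewrite [coef_vector _ _ _ _]mxE -/(lattice_point i) cT// -dot_row mulrDr [b * _]mulrC.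
  by rewrite kC ksum mulr0 addr0 /dot mul0mx mxE.
have [T ST MT] : exists2 T, S T & forall i, dot (row i M) (k' T) = 0.
  by apply: (simplex_sub_hyperplanes (p := p)) => x /sub/subZ[].
have MC : (M <= C)%MS.
  rewrite submxE; apply/eqP/row_matrixP => i; rewrite row_mul row0.
  have pC t : subweights t -> (p + t *m M) *m cokermx C = 0.
    by move=> tw; suff /sub/subZ[] : (conv_hull (p |` [set p + row i M | i in
      [set: 'I_d]])) (p + t *m M); [|rewrite simplexE; exists t].
  have p0 : p *m cokermx C = 0.
    rewrite -[RHS](pC 0) ?mul0mx ?addr0//.
    by split=> [j|]; [rewrite mxE|rewrite big1// => j _; rewrite mxE].
  have [w0 w1] := weights_delta R i.
  have := pC (delta_mx 0 i); rewrite mulmxDl p0 add0r -rowE; apply.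
  by split=> //; rewrite w1.
have CM : (C <= M)%MS.
  have := mxrankS MC; rewrite -(mxrank_leqif_sup MC) rank_cokermx_ones.
  by move/eqP: freeM => ->; rewrite eqn_leq => ->; rewrite -ltnS prednK.
have [_ /negP + _] := Sk _ ST; apply.
have /submxP[Y CY] := CM.
rewrite -[k T]trmxK -k'P// CY -mulmxA (_ : M *m _ = 0) ?mulmx0 ?trmx0//.
by apply/colP => i; rewrite [RHS]mxE -(MT i) /dot -row_mul [RHS]mxE.
Qed.

End UpperBound.

End ThinDeformationSpace.

(** * Construction of singular algebraic surfaces *)

Section Lifting.
Variables (R : realType) (D : set 'rV[R]_3).
Local Notation A := (lattice_points D).
Local Notation N := #|`A|.
Local Notation P := (lattice_matrix D).
Implicit Types (c : 'rV[int]_3 -> R) (f : laurent R).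

Hypothesis hullD : D = conv_hull [set row i P | i in [set: 'I_N]].

(** The rows of [C], weighted by [t ^ (- v x)], add up to Puiseux terms [b y] that satisfy all
    affine relations. In each column one row strictly dominates, so nothing cancels and [b y] has
    order [- v y]. Dividing by the monomials at [z], where [z_i = t ^ (- p i)], gives the
    coefficients of [f]. *)
Lemma lift_relations c (v : 'I_N -> rat) (p : 'I_3 -> rat) (C : 'M[R]_N) :
  (forall x, affine_relation (row x C)) ->
  (forall y, exists x0, [/\ C x0 y != 0, v x0 = v y &
     forall x, x != x0 -> C x y != 0 -> v x < v y]) ->
  (forall y, c (lattice_point y) =
     ratr (v y - \sum_j p j * (lattice_point y 0 j)%:~R)) ->
  exists f z, [/\ tropicalizes_to D f c, singular_point f z &
    forall i, Val (z 0 i) = (ratr (p i))%:E].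
Proof.
move=> Crel Cmax cv.
pose z : 'rV[puiseux R]_3 := \row_i term 1 (- p i).
have zp i : has_order (z 0 i) (- p i) by rewrite mxE; apply: has_order_term; exact: oner_neq0.
have z0 i : z 0 i != 0 := has_order_neq0 (zp i).
pose b y : puiseux R := \sum_x term (C x y)%:C%C (- v x).
have bE y s : b y s = \sum_x if s == - v x then (C x y)%:C%C else 0.
  by rewrite pcoef_sum.
have bv y : has_order (b y) (- v y).
  have [x0 [Cx0 vx0 vx]] := Cmax y; split=> [|s sv]; rewrite bE.
    rewrite (bigD1 x0)//= vx0 eqxx big1 ?addr0 => [|x xx0].
      by rewrite eq_complex /= eqxx andbT.
    case: eqP => // /oppr_inj vxy; have [->//|/(vx _ xx0)] := eqVneq (C x y) 0.
    by rewrite vxy ltxx.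
  apply: big1 => x _; case: eqP => // sx.
  have [->//|Cxy] := eqVneq (C x y) 0; have [xx0|/vx/(_ Cxy)] := eqVneq x x0.
    by move: sv; rewrite sx xx0 vx0 ltxx.
  by rewrite ltNge -lerN2 -sx (ltW sv).
pose g w : puiseux R := \sum_(y < N | lattice_point y == w) b y / monomial z w.
pose f : laurent R := [fsfun w in A => g w].
have fE y : f (lattice_point y) = b y / monomial z (lattice_point y).
  rewrite fsfunE lattice_point_in /g (big_pred1 y)// => y'.
  by rewrite (inj_eq (@lattice_point_inj _ _)).
have fv y : has_order (f (lattice_point y))
    (- (v y - \sum_j p j * (lattice_point y 0 j)%:~R)).
  rewrite fE opprB addrC -[X in _ + X]opprK -sumrN.
  under [X in _ - X]eq_bigr do rewrite -mulNr.
  exact/has_orderM/has_orderV/has_order_monomial.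
have suppf : finsupp f = A.
  apply/fsetP => w; rewrite mem_finsupp; apply/idP/idP => [|/lattice_pointP[y <-]].
    by apply: contraR => wA; rewrite fsfunE (negPf wA).
  exact: has_order_neq0 (fv y).
have relE (n : 'I_N -> int) : (forall x, \sum_y C x y * (n y)%:~R = 0) ->
    \sum_y b y * (n y)%:~R = 0.
  move=> Cn; apply/val_inj/funext => s; rewrite [LHS]pcoef_sum [RHS]pcoef0.
  under eq_bigr do rewrite pcoefMz bE mulr_suml.
  rewrite exchange_big big1//= => x _; case: eqP => _; last first.
    by rewrite big1// => y _; rewrite mul0r.
  rewrite -[RHS](rmorph0 (real_complex R)) -(Cn x) rmorph_sum.
  by apply: eq_bigr => y _; rewrite rmorphM/= rmorph_int.
exists f, z; split.
- split=> [|w /lattice_pointP[y <-]]; last first.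
    by rewrite ((has_orderP _ _).1 (fv y)) cv rmorphN/= opprK.
  rewrite /newton_polytope [RHS]hullD; congr conv_hull.
  rewrite (_ : [set w | _] = [set` A]) ?image_lattice_points.
    by apply: eq_imagel => y _; rewrite rowK.
  by apply/seteqP; split=> w /=; rewrite -suppf mem_finsupp.
- apply/(singular_pointP f z0); rewrite suppf !sum_lattice_points.
  have bfE y : f (lattice_point y) * monomial z (lattice_point y) = b y.
    by rewrite fE divfK//; exact: (has_order_neq0 (has_order_monomial _ zp)).
  have sumb j : \sum_(w <- A) f w * monomial z w * (w 0 j)%:~R =
      \sum_y b y * (lattice_point y 0 j)%:~R.
    by rewrite sum_lattice_points; apply: eq_bigr => y _; rewrite bfE.
  split=> [|j].
    under eq_bigr do rewrite bfE -[b _]mulr1.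
    apply: (relE (fun=> 1)) => x; have [rx _] := Crel x; rewrite -[RHS]rx.
    by apply: eq_bigr => y _; rewrite mulr1 mxE.
  rewrite sumb relE// => x; have /affine_relationP[_ /(_ j) rx] := Crel x.
  by rewrite -[RHS]rx; apply: eq_bigr => y _; rewrite mxE.
- by move=> i; rewrite ((has_orderP _ _).1 (zp i)) rmorphN/= opprK.
Qed.

Definition row3 (T : Type) (a b c : 'rV[T]_3) : 'M[T]_3 :=
  \matrix_(i < 3) (if i == 0 then a else if i == 1 then b else c).

(* At [p] the maximum of the tropical polynomial is attained exactly at the
   three collinear points [w - e], [w], [w + e], and the next lower value
   exactly at [u1], [u2], [u3]. *)
Record critical_at c (w e u1 u2 u3 : 'rV[int]_3) (p : 'rV[R]_3) : Prop := {
  crit_e1 : c (w + e) + dot (embed R e) p = c w;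
  crit_e2 : c (w - e) - dot (embed R e) p = c w;
  crit_12 : c u2 + dot (embed R (u2 - u1)) p = c u1;
  crit_13 : c u3 + dot (embed R (u3 - u1)) p = c u1;
  crit_lt : c u1 + dot (embed R (u1 - w)) p < c w;
  crit_rest : forall x, x \in A -> x \notin [:: w; w + e; w - e; u1; u2; u3] ->
    c x + dot (embed R (x - u1)) p < c u1 }.

(* No three of the points [w], [u1], [u2], [u3] are collinear modulo [e];
   requiring them to be coplanar shortens the computations. *)
Definition general_position (w e u1 u2 u3 : 'rV[int]_3) : Prop :=
  row3 (embed R e) (embed R (u1 - w)) (embed R (u2 - w)) \in unitmx /\
  exists a b : R, [/\ a != 0, b != 0, a + b != 1 &
    embed R (u3 - w) = a *: embed R (u1 - w) + b *: embed R (u2 - w)].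

Definition is_rational (x : R) : Prop := exists q : rat, x = ratr q.

Lemma embedD x y : embed R (x + y) = embed R x + embed R y.
Proof. exact: map_mxD. Qed.

Lemma embedN x : embed R (- x) = - embed R x.
Proof. exact: map_mxN. Qed.

Lemma embedB x y : embed R (x - y) = embed R x - embed R y.
Proof. exact: map_mxB. Qed.

(** Each lattice point is expressed in the affine frame [w - e], [w], [u1], [u2], and these
    relations are the rows given to [lift_relations]. Columns [w] and [w - e] are dominated by the
    row of [w + e]; columns [u1] and [u2] by the row of [u3], whose entries there are [- a] and
    [- b], both nonzero; every other column has only its diagonal entry. *)
Lemma lift_critical c w e u1 u2 u3 p :
  {subset [:: w; w + e; w - e; u1; u2; u3] <= A} ->
  general_position w e u1 u2 u3 -> critical_at c w e u1 u2 u3 p ->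
  (forall x, x \in A -> is_rational (c x)) -> (forall i, is_rational (p 0 i)) ->
  exists f z, [/\ tropicalizes_to D f c, singular_point f z &
    forall i, Val (z 0 i) = (p 0 i)%:E].
Proof.
move=> subA [W1 [a [b [a0 b0 ab1 u3E]]]] [e1 e2 e12 e13 elt erest] cQ pQ.
pose V x := c x + dot (embed R x) p.
have Ve1 : V (w + e) = V w by rewrite /V embedD dotDl -e1; ring.
have Ve2 : V (w - e) = V w by rewrite /V embedB dotBl -e2; ring.
have V12 : V u2 = V u1 by rewrite /V -e12 embedB dotBl; ring.
have V13 : V u3 = V u1 by rewrite /V -e13 embedB dotBl; ring.
have Vlt : V u1 < V w by move: elt; rewrite /V embedB dotBl; lra.
have Vrest x : x \in A -> x \notin [:: w; w + e; w - e; u1; u2; u3] -> V x < V u1.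
  by move=> xA xn; have := erest x xA xn; rewrite /V embedB dotBl; lra.
have [pq pE] := choice (fun i : 'I_3 => pQ i).
have [cq cE] := choice (fun y : 'I_N => cQ _ (lattice_point_in y)).
pose v y := cq y + \sum_j pq j * (lattice_point y 0 j)%:~R.
have vE y : ratr (v y) = V (lattice_point y).
  rewrite /V cE rmorphD rmorph_sum/= dotE; congr (_ + _); apply: eq_bigr => j _.
  by rewrite pE mxE rmorphM/= ratr_int mulrC.
have vlt x y : V (lattice_point x) < V (lattice_point y) -> v x < v y.
  by rewrite -!vE ltr_rat.
have veq x y : V (lattice_point x) = V (lattice_point y) -> v x = v y.
  by rewrite -!vE => /fmorph_inj.
have [iw iwE] : exists i : 'I_N, lattice_point i = w.
  by apply: lattice_pointP; apply: subA; rewrite !inE eqxx.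
have [i1 i1E] : exists i : 'I_N, lattice_point i = w + e.
  by apply: lattice_pointP; apply: subA; rewrite !inE eqxx !orbT.
have [i0 i0E] : exists i : 'I_N, lattice_point i = w - e.
  by apply: lattice_pointP; apply: subA; rewrite !inE eqxx !orbT.
have [k1 k1E] : exists i : 'I_N, lattice_point i = u1.
  by apply: lattice_pointP; apply: subA; rewrite !inE eqxx !orbT.
have [k2 k2E] : exists i : 'I_N, lattice_point i = u2.
  by apply: lattice_pointP; apply: subA; rewrite !inE eqxx !orbT.
have [k3 k3E] : exists i : 'I_N, lattice_point i = u3.
  by apply: lattice_pointP; apply: subA; rewrite !inE eqxx !orbT.
set W := row3 _ _ _ in W1.
pose co x := (embed R (x - w)) *m invmx W.
have coE i t : embed R t = row i W -> co (w + t) = delta_mx 0 i.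
  move=> ti; rewrite /co [w + t]addrC addrK ti rowE mulmxK// .
have co_e : co (w + e) = delta_mx 0 0 by apply: coE; rewrite rowK.
have co_w : co w = 0 by rewrite /co subrr /embed map_mx0 mul0mx.
have co_e' : co (w - e) = - delta_mx 0 0.
  rewrite -co_e /co -mulNmx -embedN; congr (embed _ _ *m _).
  by rewrite [w - e]addrC addrK [w + e]addrC addrK.
have co_u1 : co u1 = delta_mx 0 1.
  by rewrite -[u1](subrKC w); apply: coE; rewrite rowK.
have co_u2 : co u2 = delta_mx 0 2%:R.
  by rewrite -[u2](subrKC w); apply: coE; rewrite rowK.
have co_u3 : co u3 = a *: delta_mx 0 1 + b *: delta_mx 0 2%:R.
  by rewrite /co u3E mulmxDl -!scalemxAl -co_u1 -co_u2.
(* From [x = w + t0 e + t1 (u1 - w) + t2 (u2 - w)] with [e = w - (w - e)]. For the four points of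
   the frame the relation is trivial. *)
pose rel x : 'rV[R]_N := let t := co (lattice_point x) in
  delta_mx 0 x - (1 + t 0 0 - t 0 1 - t 0 2%:R) *: delta_mx 0 iw
    + t 0 0 *: delta_mx 0 i0 - t 0 1 *: delta_mx 0 k1 - t 0 2%:R *: delta_mx 0 k2.
pose C := \matrix_x rel x.
have Crel x : affine_relation (row x C).
  rewrite rowK /rel; set t := co (lattice_point x); split.
    have sumE (k : 'rV[R]_N) : \sum_i k 0 i = dot k (const_mx 1).
      by rewrite dotE; apply: eq_bigr => i _; rewrite mxE mulr1.
    have dE i : dot (delta_mx 0 i : 'rV[R]_N) (const_mx 1) = 1.
      by rewrite -sumE; have [_] := weights_delta R i.
    by rewrite sumE !(dotDl, dotNl, dotZl) !dE; ring.
  have tE : embed R (lattice_point x - w) = t 0 0 *: embed R e +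
      t 0 1 *: embed R (u1 - w) + t 0 2%:R *: embed R (u2 - w).
    rewrite -[LHS](mulmxKV W1) -/(co _) -/t mulmx_sum_row !big_ord_recl big_ord0.
    by rewrite !rowK addr0 addrA; congr (_ *: _ + _ *: _ + _ *: _); congr (t 0 _); exact: val_inj.
  rewrite !(mulmxDl, mulNmx) -!scalemxAl -!rowE !rowK iwE i0E k1E k2E.
  have -> : embed R (lattice_point x) = embed R w + embed R (lattice_point x - w).
    by rewrite -embedD addrC subrK.
  by rewrite tE !embedB; apply/rowP => j; rewrite !mxE; ring.
have CE x y : C x y = (y == x)%:R - (1 + co (lattice_point x) 0 0 -
      co (lattice_point x) 0 1 - co (lattice_point x) 0 2%:R) * (y == iw)%:R
    + co (lattice_point x) 0 0 * (y == i0)%:R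
    - co (lattice_point x) 0 1 * (y == k1)%:R
    - co (lattice_point x) 0 2%:R * (y == k2)%:R.
  by rewrite !mxE.
have neqco (i j : 'I_N) l :
    co (lattice_point i) 0 l != co (lattice_point j) 0 l -> i != j.
  by apply: contra_neq => ->.
have neqV (i j : 'I_N) : V (lattice_point i) < V (lattice_point j) -> i != j.
  by apply: contraTneq => ->; rewrite ltxx.
have coW l : co (lattice_point iw) 0 l = 0 by rewrite iwE co_w mxE.
have co1 l : co (lattice_point i1) 0 l = (l == 0)%:R by rewrite i1E co_e mxE.
have co0 l : co (lattice_point i0) 0 l = - (l == 0)%:R by rewrite i0E co_e' !mxE.
have coK1 l : co (lattice_point k1) 0 l = (l == 1)%:R by rewrite k1E co_u1 mxE.
have coK2 l : co (lattice_point k2) 0 l = (l == 2%:R)%:R by rewrite k2E co_u2 mxE.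
have coK3 l : co (lattice_point k3) 0 l = a * (l == 1)%:R + b * (l == 2%:R)%:R.
  by rewrite k3E co_u3 !mxE.
have N0 : [&& i0 != iw, i0 != i1 & iw != i1].
  apply/and3P; split; apply: (@neqco _ _ 0);
    rewrite ?coW ?co0 ?co1 /= mulr1n;
    by rewrite ?oppr_eq0 ?eqNr 1?[0 == 1]eq_sym oner_eq0.
have NK : [&& k1 != k2, k1 != k3 & k2 != k3].
  apply/and3P; split; [apply: (@neqco _ _ 1)|apply: (@neqco _ _ 2%:R)|apply: (@neqco _ _ 1)];
    rewrite ?coK1 ?coK2 ?coK3 /= ?mulr1n ?mulr0n ?mulr0 ?mulr1 ?addr0 ?add0r ?oner_eq0//.
  - by rewrite eq_sym.
  - by rewrite eq_sym.
have NV (i j : 'I_N) : i \in [:: k1; k2; k3] -> j \in [:: i0; iw; i1] -> v i < v j /\ i != j.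
  move=> ik jw; suff Vij : V (lattice_point i) < V (lattice_point j).
    by split; [exact: vlt|exact: neqV].
  have -> : V (lattice_point i) = V u1.
    by move: ik; rewrite !inE => /or3P[]/eqP->; rewrite ?k1E ?k2E ?k3E.
  have -> : V (lattice_point j) = V w => //.
  by move: jw; rewrite !inE => /or3P[]/eqP->; rewrite ?i0E ?i1E ?iwE.
have C0 (x y : 'I_N) : x \in [:: iw; i0; k1; k2] -> C x y = 0.
  rewrite CE !inE => /or4P[]/eqP->; rewrite ?coW ?co0 ?coK1 ?coK2 /= ?mulr1n ?mulr0n; ring.
have [/and3P[N01 N02 N03] /and3P[N12 N13 N23]] := (N0, NK).
have spec x : x \notin [:: iw; i1; i0; k1; k2; k3] -> v x < v k1.
  move=> xn; apply: vlt; rewrite k1E; apply: Vrest; first exact: lattice_point_in.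
  move: xn; rewrite -i1E -i0E -iwE -k1E -k2E -k3E !inE.
  by rewrite !(inj_eq (@lattice_point_inj _ _)).
have vk2 : v k2 = v k1 by apply: veq; rewrite k1E k2E.
have vk3 : v k3 = v k1 by apply: veq; rewrite k1E k3E.
have vi0 : v i0 = v iw by apply: veq; rewrite i0E iwE.
have vi1 : v i1 = v iw by apply: veq; rewrite i1E iwE.
have vkw : v k1 < v iw by apply: vlt; rewrite k1E iwE.
have NKW i j : i \in [:: k1; k2; k3] -> j \in [:: i0; iw; i1] -> (i == j) = false.
  by move=> ik jw; have [_ /negPf] := NV i j ik jw.
have [|y|f [z [fc sf zp]]] := @lift_relations c v pq C Crel; last 2 first.
- by rewrite /v addrK cE.
- by exists f, z; split=> // i; rewrite pE.
(* The rows of the frame points vanish, and the points outside the distinguished six have values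
   below [v k1]. So only rows [i1] and [k3] can compete with [x0], and the two hypotheses rule them
   out. *)
have main y x0 : v k1 <= v y -> (x0 != i1 -> C i1 y = 0) ->
    (x0 != k3 -> v k3 < v y) -> forall x, x != x0 -> C x y != 0 -> v x < v y.
  move=> ky C1 v3 x xx0 Cxy.
  have [|/spec/lt_le_trans] := boolP (x \in [:: iw; i1; i0; k1; k2; k3]); last exact.
  rewrite !inE => /or4P[/eqP xE|/eqP xE|/eqP xE|/or3P[]/eqP xE];
    rewrite xE in xx0 Cxy *;
    try by move: Cxy; rewrite C0 ?eqxx// !inE eqxx ?orbT.
  - by move: Cxy; rewrite C1 ?eqxx// eq_sym.
  - by apply: v3; rewrite eq_sym.
have E1 : ((k1 == iw) = false) * ((k1 == i0) = false) * ((k1 == i1) = false).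
  by rewrite !NKW ?inE ?eqxx ?orbT.
have E2 : ((k2 == iw) = false) * ((k2 == i0) = false) * ((k2 == i1) = false).
  by rewrite !NKW ?inE ?eqxx ?orbT.
have E3 : ((k1 == k2) = false) * ((k2 == k1) = false) * ((k1 == k3) = false) *
    ((k2 == k3) = false).
  by rewrite [k2 == k1]eq_sym (negPf N12) (negPf N13) (negPf N23).
have E0 : ((i0 == iw) = false) * ((iw == i0) = false) * ((i0 == i1) = false) *
    ((iw == i1) = false).
  by rewrite [iw == i0]eq_sym (negPf N01) (negPf N02) (negPf N03).
have E4 : ((iw == k1) = false) * ((iw == k2) = false) * ((i0 == k1) = false) *
    ((i0 == k2) = false).
  by rewrite ![_ == k1]eq_sym ![_ == k2]eq_sym !E1 !E2.
pose E := (E0, E1, E2, E3, E4, eqxx); move=> y.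
have [->|yk1] := eqVneq y k1.
  exists k3; split=> //; last first.
    apply: main => //; last by rewrite eqxx.
    by move=> _; rewrite CE !co1 !E /= ?mulr0n ?mulr1n; ring.
  rewrite CE !coK3 !E /= ?mulr0n ?mulr1n.
  by rewrite [X in X != 0](_ : _ = - a) ?oppr_eq0//; ring.
have [->|yk2] := eqVneq y k2.
  exists k3; split=> //; first last.
  - apply: main => //; [by rewrite vk2| |by rewrite eqxx].
    by move=> _; rewrite CE !co1 !E /= ?mulr0n ?mulr1n; ring.
  - by rewrite vk2.
  rewrite CE !coK3 !E /= ?mulr0n ?mulr1n.
  by rewrite [X in X != 0](_ : _ = - b) ?oppr_eq0//; ring.
have [->|yw] := eqVneq y iw.
  exists i1; split=> //; last first.
    by apply: main; [exact: ltW|rewrite eqxx|rewrite vk3].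
  rewrite CE !co1 !E /= ?mulr0n ?mulr1n.
  by rewrite [X in X != 0](_ : _ = - 2%:R) ?oppr_eq0 ?pnatr_eq0//; ring.
have [->|yi0] := eqVneq y i0.
  exists i1; split; first last.
  - by apply: main; rewrite ?vi0; [exact: ltW|rewrite eqxx|rewrite vk3].
  - by rewrite vi0.
  rewrite CE !co1 !E /= ?mulr0n ?mulr1n.
  by rewrite [X in X != 0](_ : _ = 1) ?oner_eq0//; ring.
exists y; have Cy x : C x y = (y == x)%:R.
  by rewrite CE (negPf yk1) (negPf yk2) (negPf yw) (negPf yi0) !mulr0 !(addr0, subr0).
split=> // [|x xy]; first by rewrite Cy eqxx oner_eq0.
by rewrite Cy [y == x]eq_sym (negPf xy) eqxx.
Qed.

End Lifting.

(** * Density, perturbation and the lower bound for the dimension *)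

Section FiniteBaire.

(** Either the first set is dense in [O], or removing its closure leaves a nonempty open set in
    whose points the remaining sets accumulate. It will be applied to the finitely many face
    types. *)
Lemma closure_finite_cover (T : topologicalType) (I : finType) (Q : I -> set T)
    (O : set T) : open O -> O !=set0 -> O `<=` closure [set y | exists i, Q i y] ->
  exists i (V : set T), [/\ open V, V !=set0 & V `<=` O `&` closure (Q i)].
Proof.
move=> oO O0 OQ.
have {OQ} : O `<=` closure [set y | exists2 i, i \in enum I & Q i y].
  apply: subset_trans OQ _; apply: closureS => y [i Qi].
  by exists i => //; rewrite mem_enum.
elim: (enum I) O oO O0 => [|i s IH] O oO O0 Os.
  have [y Oy] := O0; have [z [+ _]] := Os _ Oy _ (open_nbhs_nbhs (conj oO Oy)).
  by case.
have [OQ|/existsNP[y /not_implyP[Oy nQ]]] := pselect (O `<=` closure (Q i)).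
  by exists i, O; split=> // z Oz; split=> //; exact: OQ.
have [||z [Oz nz]|j [V [oV V0 VO]]] := IH (O `&` ~` closure (Q i)).
- by apply: openI => //; exact/closed_openC/closed_closure.
- by exists y.
- have : closure (Q i `|` [set y | exists2 j, j \in s & Q j y]) z.
    apply: closureS (Os _ Oz) => x [j]; rewrite inE => /orP[/eqP->|js] Qj.
      by left.
    by right; exists j.
  by rewrite closureU => -[].
- by exists j, V; split=> // x /VO[[]].
Qed.

Lemma closure_rational_rV (R : realType) n (O : set 'rV[R]_n) : open O ->
  O `<=` closure (O `&` [set map_mx ratr y | y in [set: 'rV[rat]_n]]).
Proof.
move=> oO y Oy B By.
have /nbhs_ballP[e /= e0 eBO] : nbhs y (B `&` O).
  by apply: filterI => //; exact: open_nbhs_nbhs.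
have /choice[q qP] (j : 'I_n) : exists q : rat, `|y 0 j - ratr q| < e.
  have := @dense_rat R (ball (y 0 j) e); case.
  - by exists (y 0 j); exact: ballxx.
  - exact: ball_open.
  - by move=> x [xB [q _ qx]]; exists q; rewrite qx.
exists (map_mx ratr (\row_j q j)).
have [] : (B `&` O) (map_mx ratr (\row_j q j)).
  by apply: eBO; split=> // i j; rewrite ord1 !mxE; exact: qP.
by split=> //; split=> //; exists (\row_j q j).
Qed.

End FiniteBaire.

Lemma row_free_mull (F : fieldType) m n d (B : 'M[F]_(m, n)) : (d <= \rank B)%N ->
  exists Z : 'M[F]_(d, m), row_free (Z *m B).
Proof.
move=> dB; pose Y : 'M[F]_(d, \rank B) := pid_mx d.
have /submxP[Z YZ] : (Y *m row_base B <= B)%MS.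
  by rewrite (submx_trans (submxMl _ _))// eq_row_base.
exists Z; rewrite -YZ /row_free mxrankMfree ?row_base_free//.
by rewrite rank_pid_mx.
Qed.

Section CriticalTropical.
Variables (R : realType) (D : set 'rV[R]_3).
Local Notation A := (lattice_points D).
Local Notation N := #|`A|.
Local Notation P := (lattice_matrix D).
Implicit Types (c : 'rV[int]_3 -> R).

Hypothesis finD : finite_set [set w | D (embed R w)].
Hypothesis hullD : D = conv_hull [set row i P | i in [set: 'I_N]].

Lemma row3_unit_neq0 (a b c : 'rV[R]_3) : row3 a b c \in unitmx -> a != 0.
Proof.
move=> Wu; apply/eqP => a0; have : row 0 (row3 a b c) = 0 by rewrite rowK.
rewrite rowE => /(congr1 (mulmx^~ (invmx (row3 a b c)))).
rewrite mulmxK// mul0mx => /rowP/(_ 0)/eqP.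
by rewrite !mxE oner_eq0.
Qed.

(** The base change [L] from the frame at [w] has determinant [1 - a - b], nonzero because [u1],
    [u2], [u3] are not collinear modulo [e]; [L'] is its inverse. *)
Lemma general_position_unit w e u1 u2 u3 : general_position R w e u1 u2 u3 ->
  row3 (embed R e) (embed R (u2 - u1)) (embed R (u3 - u1)) \in unitmx.
Proof.
move=> [W1 [a [b [a0 b0 ab u3E]]]].
have t0 : 1 - a - b != 0 by rewrite -addrA -opprD subr_eq0 eq_sym.
pose r (x y z : R) : 'rV[R]_3 :=
  \row_(i < 3) (if i == 0 then x else if i == 1 then y else z).
pose L := row3 (r 1 0 0) (r 0 (-1) 1) (r 0 (a - 1) b).
pose L' := row3 (r 1 0 0) (r 0 (b / (1 - a - b)) (- (1 - a - b)^-1))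
  (r 0 ((1 - a) / (1 - a - b)) (- (1 - a - b)^-1)).
have LL' : L *m L' = 1%:M.
  apply/matrixP => i j; rewrite !mxE !big_ord_recl big_ord0 !mxE.
  case: i => -[|[|[|//]]] i; case: j => -[|[|[|//]]] j;
    rewrite /= !mxE /= ?mulr1n ?mulr0n; by field.
rewrite (_ : row3 _ _ _ = L *m row3 (embed R e) (embed R (u1 - w)) (embed R (u2 - w))).
  by rewrite unitmx_mul W1 andbT; have [] := mulmx1_unit LL'.
have E21 : embed R (u2 - u1) = - embed R (u1 - w) + embed R (u2 - w).
  by rewrite !embedB; apply/rowP => j; rewrite !mxE; ring.
have E31 : embed R (u3 - u1) = (a - 1) *: embed R (u1 - w) + b *: embed R (u2 - w).
  rewrite scalerBl scale1r addrAC -u3E !embedB.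
  by apply/rowP => j; rewrite !mxE; ring.
apply/row_matrixP => i; rewrite row_mul !rowK mulmx_sum_row !big_ord_recl big_ord0 !rowK /=.
case: i => -[|[|[|//]]] i; rewrite /= !mxE /=.
- by rewrite scale1r !scale0r !addr0.
- by rewrite E21 scale0r scaleN1r scale1r add0r addr0.
- by rewrite E31 scale0r add0r addr0.
Qed.

Lemma critical_tropical_surface c w e u1 u2 u3 p : e != 0 ->
  {subset [:: w; w + e; w - e; u1; u2; u3] <= A} ->
  critical_at D c w e u1 u2 u3 p -> tropical_surface D c p.
Proof.
move=> e0 subA [e1 e2 e12 e13 elt erest].
pose V x := c x + dot (embed R x) p.
have wA : w \in A by apply: subA; rewrite !inE eqxx.
have Ve1 : V (w + e) = V w by rewrite /V embedD dotDl -e1; ring.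
have Ve2 : V (w - e) = V w by rewrite /V embedB dotBl -e2; ring.
have V12 : V u2 = V u1 by rewrite /V -e12 embedB dotBl; ring.
have V13 : V u3 = V u1 by rewrite /V -e13 embedB dotBl; ring.
have Vlt : V u1 < V w by move: elt; rewrite /V embedB dotBl; lra.
have Vmax x : x \in A -> V x <= V w.
  move=> xA; have [|xn] := boolP (x \in [:: w; w + e; w - e; u1; u2; u3]).
    rewrite !inE => /or4P[/eqP->|/eqP->|/eqP->|/or3P[]/eqP->]; lra.
  by have := erest x xA xn; rewrite /V embedB dotBl; move: Vlt; rewrite /V; lra.
have VE : trop_poly D c p = V w.
  apply/eqP; rewrite eq_le; apply/andP; split.
    apply: ge_sup; first by exists (V w), w.
    by move=> _ [x xA <-]; exact: Vmax.
  apply: ub_le_sup; last by exists w.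
  by exists (V w) => _ [x xA <-]; exact: Vmax.
exists w, (w + e); rewrite VE; split=> //.
  by apply: subA; rewrite !inE eqxx orbT.
by rewrite eq_sym -subr_eq0 [w + e]addrC addrK.
Qed.

End CriticalTropical.

Section Slope.
Variable R : realType.
Implicit Types (c : 'rV[int]_3 -> R).

(** The solution [p] of the linear system [crit_e1], [crit_12], [crit_13]. The remaining equation
    [crit_e2] then amounts to [c (w + e) + c (w - e) = 2 c w]. *)
Definition slope c (w e u1 u2 u3 : 'rV[int]_3) : 'rV[R]_3 :=
  (\row_(j < 3) (if j == 0 then c w - c (w + e) else
     if j == 1 then c u1 - c u2 else c u1 - c u3)) *m
  invmx (row3 (embed R e) (embed R (u2 - u1)) (embed R (u3 - u1)))^T.

Lemma slopeP c w e u1 u2 u3 (p : 'rV[R]_3) :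
  row3 (embed R e) (embed R (u2 - u1)) (embed R (u3 - u1)) \in unitmx ->
  p = slope c w e u1 u2 u3 <-> [/\ c (w + e) + dot (embed R e) p = c w,
    c u2 + dot (embed R (u2 - u1)) p = c u1 &
    c u3 + dot (embed R (u3 - u1)) p = c u1].
Proof.
rewrite /slope; set W := row3 _ _ _ => Wu; set r := \row_j _.
have Wt : W^T \in unitmx by rewrite unitmx_tr.
have -> : p = r *m invmx W^T <-> p *m W^T = r.
  by split=> [->|<-]; rewrite ?mulmxKV ?mulmxK.
have E j : (p *m W^T) 0 j = dot (row j W) p by rewrite dotC dot_row.
split=> [/rowP pr|[h0 h1 h2]].
  have := pr 0; have := pr 1; have := pr 2%:R; rewrite !E !rowK !mxE /= => -> -> ->.
  by split; rewrite addrC subrK.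
apply/rowP => j; rewrite E rowK mxE.
by case: j => -[|[|[|//]]] j /=; [rewrite -h0|rewrite -h1|rewrite -h2]; ring.
Qed.

Lemma rational_rowP n (v : 'rV[R]_n) : (forall j, is_rational (v 0 j)) ->
  exists q : 'rV[rat]_n, v = map_mx ratr q.
Proof.
move=> /choice[q vq]; exists (\row_j q j).
by apply/rowP => j; rewrite vq !mxE.
Qed.

Lemma is_rationalB (x y : R) : is_rational x -> is_rational y -> is_rational (x - y).
Proof. by move=> [q ->] [r ->]; exists (q - r); rewrite rmorphB. Qed.

Lemma is_rational_nat n : is_rational (n%:R : R).
Proof. by exists n%:R; rewrite ratr_nat. Qed.

Lemma is_rationalN (x : R) : is_rational x -> is_rational (- x).
Proof. by rewrite -sub0r; apply: is_rationalB (is_rational_nat 0). Qed.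

Lemma embed_rat x : embed R x = map_mx ratr (map_mx intr x : 'rV[rat]_3).
Proof. by apply/rowP => j; rewrite !mxE ratr_int. Qed.

Lemma row3_map (a b c : 'rV[rat]_3) :
  row3 (map_mx ratr a) (map_mx ratr b) (map_mx ratr c) =
  map_mx ratr (row3 a b c) :> 'M[R]_3.
Proof. by apply/row_matrixP => i; rewrite -map_row !rowK; do !case: ifP. Qed.

Lemma slope_rational c w e u1 u2 u3 :
  (forall x, x \in [:: w; w + e; w - e; u1; u2; u3] -> is_rational (c x)) ->
  forall i, is_rational (slope c w e u1 u2 u3 0 i).
Proof.
move=> cQ i; have [|q rq] := @rational_rowP 3 (\row_(j < 3)
    (if j == 0 then c w - c (w + e) else if j == 1 then c u1 - c u2 else c u1 - c u3)).
  by move=> j; rewrite mxE; do !case: ifP => _; apply: is_rationalB; apply: cQ;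
    rewrite !inE eqxx ?orbT.
rewrite /slope rq !embed_rat row3_map map_trmx -map_invmx -map_mxM.
by rewrite mxE; eexists.
Qed.

Lemma slope_continuous (T : topologicalType) (g : T -> 'rV[int]_3 -> R) w e u1 u2 u3 i :
  (forall x, continuous (fun y => g y x)) ->
  continuous (fun y => slope (g y) w e u1 u2 u3 0 i).
Proof.
move=> gc; rewrite /slope; set W := invmx _.
rewrite [X in continuous X](_ : _ = (fun y : T => \sum_(j < 3)
    (if j == 0 then g y w - g y (w + e) else
     if j == 1 then g y u1 - g y u2 else g y u1 - g y u3) * W j i)); last first.
  by apply/funext => y; rewrite mxE; apply: eq_bigr => j _; rewrite mxE.
apply: continuous_big => [|j _ y]; first exact: add_continuous.
apply: continuousM; last exact: cst_continuous.
by case: (j == 0); [|case: (j == 1)]; apply: continuousB; exact: gc.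
Qed.

End Slope.

Section Perturbation.
Variables (R : realType) (D : set 'rV[R]_3).
Local Notation A := (lattice_points D).
Local Notation N := #|`A|.
Local Notation P := (lattice_matrix D).
Local Notation C := (cokermx (const_mx 1 : 'rV[R]_N)).

Hypothesis finD : finite_set [set w | D (embed R w)].
Hypothesis hullD : D = conv_hull [set row i P | i in [set: 'I_N]].

Definition coef_fun (c : 'rV[R]_N) x : R := \sum_(i < N | lattice_point i == x) c 0 i.

Lemma coef_funE c i : coef_fun c (lattice_point i) = c 0 i.
Proof.
by rewrite /coef_fun (big_pred1 i)// => j; rewrite (inj_eq (@lattice_point_inj _ _)).
Qed.

Lemma coef_funK c : coef_vector D (coef_fun c) = c.
Proof. by apply/rowP => i; rewrite mxE coef_funE. Qed.

Lemma coef_fun_coef_vector c x : x \in A -> coef_fun (coef_vector D c) x = c x.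
Proof. by move=> /lattice_pointP[i <-]; rewrite coef_funE mxE. Qed.

Lemma coef_fun_continuous (T : topologicalType) (g : T -> 'rV[R]_N) x :
  (forall i, continuous (fun y => g y 0 i)) -> continuous (fun y => coef_fun (g y) x).
Proof.
by move=> gc; apply: continuous_big => [|i _]; [exact: add_continuous|exact: gc].
Qed.

Lemma dot_continuous (T : topologicalType) n (g : T -> 'rV[R]_n) v :
  (forall i, continuous (fun y => g y 0 i)) -> continuous (fun y => dot v (g y)).
Proof.
move=> gc; rewrite [X in continuous X](_ : _ = (fun y : T => \sum_i v 0 i * g y 0 i)).
  apply: continuous_big => [|i _ y]; first exact: add_continuous.
  by apply: continuousM; [exact: cst_continuous|exact: gc].
by apply/funext => y; rewrite dotE.
Qed.

Lemma cstD_continuous (T : topologicalType) (a : R) (g : T -> R) :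
  continuous g -> continuous (fun y => a + g y).
Proof. by move=> gc y; apply: cvgD; [exact: cvg_cst|exact: gc]. Qed.

Lemma coordinatewise_continuous (T : topologicalType) n (f : T -> 'rV[R]_n) :
  (forall j, continuous (fun y => f y 0 j)) -> continuous f.
Proof.
move=> fc y B /nbhs_ballP[r /= r0 rB].
have : \forall z \near y, forall j, ball (f y 0 j) r (f z 0 j).
  by apply: filter_forall => j; apply: (fc j y); exact: nbhsx_ballx.
by apply: filterS => z zr; apply: rB; split=> // i j; rewrite ord1.
Qed.

Lemma near_lt (T : topologicalType) (f g : T -> R) y0 : continuous f -> continuous g ->
  f y0 < g y0 -> \forall y \near y0, f y < g y.
Proof.
move=> fc gc; rewrite -subr_lt0 => fg.
have h : (f \- g) y @[y --> y0] --> (f \- g) y0 by apply: continuousB; [exact: fc|exact: gc].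
have {}h : \forall y \near y0, (f \- g) y < 0 by exact: cvgr_lt h _ fg.
by apply: (filterS _ h) => y; rewrite /= subr_lt0.
Qed.

Variables (c0 : 'rV[int]_3 -> R) (w e : 'rV[int]_3) (I : finType).
Variables (u1 u2 u3 : I -> 'rV[int]_3) (p0 : I -> 'rV[R]_3).
Hypothesis subA : forall k, {subset [:: w; w + e; w - e; u1 k; u2 k; u3 k] <= A}.
Hypothesis gpos : forall k, general_position R w e (u1 k) (u2 k) (u3 k).
Hypothesis crit0 : forall k, critical_at D c0 w e (u1 k) (u2 k) (u3 k) (p0 k).
Hypothesis p0_inj : injective p0.
Hypothesis c0Q : forall x, x \in A -> is_rational (c0 x).
Variable k0 : I.

Let pk (c : 'rV[int]_3 -> R) k := slope c w e (u1 k) (u2 k) (u3 k).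

(** The equalities hold by the choice of the slope and the assumed relation on [g y]. The
    inequalities and the distinctness of the slopes are finitely many strict conditions on
    continuous functions, true at [y0]. *)
Lemma near_critical (T : topologicalType) (g : T -> 'rV[R]_N) y0 :
  (forall i, continuous (fun y => g y 0 i)) -> g y0 = coef_vector D c0 ->
  (forall y, coef_fun (g y) (w + e) + coef_fun (g y) (w - e) = 2 * coef_fun (g y) w) ->
  \forall y \near y0, injective (pk (coef_fun (g y))) /\ forall k,
    critical_at D (coef_fun (g y)) w e (u1 k) (u2 k) (u3 k) (pk (coef_fun (g y)) k).
Proof.
move=> gc gy0 gH.
have cc x : continuous (fun y => coef_fun (g y) x) by exact: coef_fun_continuous.
have pc k i : continuous (fun y => pk (coef_fun (g y)) k 0 i) by exact: slope_continuous.
have dc k v : continuous (fun y => dot v (pk (coef_fun (g y)) k)) by exact: dot_continuous.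
have c0E x : x \in A -> coef_fun (g y0) x = c0 x.
  by move=> xA; rewrite gy0 coef_fun_coef_vector.
have Wu k := general_position_unit (gpos k).
have p0E k : pk (coef_fun (g y0)) k = p0 k.
  have [e1 _ e12 e13 _ _] := crit0 k.
  by apply/esym/(slopeP _ _ _ (Wu k)); split; rewrite !c0E//; apply: (subA (k := k));
    rewrite !inE eqxx ?orbT.
have ccd k x v : continuous (fun y => coef_fun (g y) x + dot v (pk (coef_fun (g y)) k)).
  by move=> y; apply: cvgD; [exact: cc|exact: dc].
apply: filterI.
  have : \forall y \near y0, forall kl : I * I, kl.1 != kl.2 ->
      pk (coef_fun (g y)) kl.1 <> pk (coef_fun (g y)) kl.2.
    apply: filter_forall => -[k l] /=; have [_|kl] := eqVneq k l.
      by apply: filterE.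
    have [j] : exists i, p0 k 0 i != p0 l 0 i.
      apply: contrapT => nex; move/eqP: kl; apply; apply: p0_inj; apply/rowP => i.
      by apply/eqP; apply: contra_notT nex => kli; exists i.
    rewrite neq_lt => /orP[] kli.
      have : \forall y \near y0, pk (coef_fun (g y)) k 0 j < pk (coef_fun (g y)) l 0 j.
        by apply: near_lt => //; rewrite !p0E.
      by apply: filterS => y + _ E; rewrite E ltxx.
    have : \forall y \near y0, pk (coef_fun (g y)) l 0 j < pk (coef_fun (g y)) k 0 j.
      by apply: near_lt => //; rewrite !p0E.
    by apply: filterS => y + _ E; rewrite E ltxx.
  apply: filterS => y yP k l E; apply/eqP; apply: contraT => kl.
  by case: (yP (k, l) kl).
apply: filter_forall => k.
have [_ _ _ _ elt erest] := crit0 k.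
have lt1 : \forall y \near y0, coef_fun (g y) (u1 k) +
    dot (embed R (u1 k - w)) (pk (coef_fun (g y)) k) < coef_fun (g y) w.
  apply: near_lt => //; rewrite p0E !c0E//; apply: (subA (k := k));
    by rewrite !inE eqxx ?orbT.
have lt2 : \forall y \near y0, forall i : 'I_N,
    lattice_point i \notin [:: w; w + e; w - e; u1 k; u2 k; u3 k] ->
    coef_fun (g y) (lattice_point i) +
    dot (embed R (lattice_point i - u1 k)) (pk (coef_fun (g y)) k) < coef_fun (g y) (u1 k).
  apply: filter_forall => i.
  have [iS|iS] := boolP (lattice_point i \in [:: w; w + e; w - e; u1 k; u2 k; u3 k]).
    exact: filterE.
  suff : \forall y \near y0, coef_fun (g y) (lattice_point i) +
      dot (embed R (lattice_point i - u1 k)) (pk (coef_fun (g y)) k) < coef_fun (g y) (u1 k).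
    by apply: filterS.
  apply: near_lt => //; rewrite p0E !c0E ?erest ?lattice_point_in//.
  by apply: (subA (k := k)); rewrite !inE eqxx ?orbT.
near=> y; have /(slopeP _ _ _ (Wu k))[e1 e12 e13] := erefl (pk (coef_fun (g y)) k).
split=> //.
- by have := gH y; move: e1; rewrite -/(pk _ k); lra.
- by near: y.
- move=> x /lattice_pointP[i <-]; move: i; near: y; exact: lt2.
Unshelve. all: by end_near. Qed.

Lemma critical_tropical_singular (c : 'rV[int]_3 -> R) k :
  (forall x, x \in A -> is_rational (c x)) ->
  critical_at D c w e (u1 k) (u2 k) (u3 k) (pk c k) ->
  singular_tropical D c /\ tropical_singular_point D c (pk c k).
Proof.
move=> cQ ck; have [||f [z [fc sf zp]]] := lift_critical hullD (subA (k := k)) (gpos k) ck.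
- exact: cQ.
- by apply: slope_rational => x /(subA (k := k))/cQ.
split; first by exists f, z.
split; last by exists f, z.
apply: critical_tropical_surface (subA (k := k)) ck.
have := row3_unit_neq0 (gpos k).1; apply: contra_neq => ->.
by rewrite /embed map_mx0.
Qed.

Lemma dot_delta n i (c : 'rV[R]_n) : dot (delta_mx 0 i) c = c 0 i.
Proof. by rewrite /dot -rowE !mxE. Qed.

(* The perturbations of [c0] keeping the three values on [w - e], [w], [w + e]
   affine: by [near_critical] the nearby rational ones are singular. *)
Lemma many_tropical_singular_points : exists c, maximal_dimensional D c /\
  exists s : seq 'rV[R]_3, [/\ uniq s, forall p, p \in s -> tropical_singular_point D c p &
    size s = #|I|].
Proof.
have [iw iwE] : exists i : 'I_N, lattice_point i = w.
  by apply: lattice_pointP; apply: (subA (k := k0)); rewrite !inE eqxx.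
have [i1 i1E] : exists i : 'I_N, lattice_point i = w + e.
  by apply: lattice_pointP; apply: (subA (k := k0)); rewrite !inE eqxx !orbT.
have [i0 i0E] : exists i : 'I_N, lattice_point i = w - e.
  by apply: lattice_pointP; apply: (subA (k := k0)); rewrite !inE eqxx !orbT.
have e0 : e != 0.
  have := row3_unit_neq0 (gpos k0).1; apply: contra_neq => ->.
  by rewrite /embed map_mx0.
have i1w : i1 != iw.
  apply: contra_neq e0 => i1w; apply: (@addrI _ w).
  by rewrite addr0 -i1E -iwE i1w.
have i0w : i0 != iw.
  apply: contra_neq e0 => i0w; apply/eqP; rewrite -oppr_eq0; apply/eqP/(@addrI _ w).
  by rewrite addr0 -i0E -iwE i0w.
have N0 : (0 < N)%N by apply: leq_ltn_trans (ltn_ord iw).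
(* The second difference along [w - e], [w], [w + e]. It is taken over the rationals so that its
   kernel [K] has rational entries and rational [y] give rational coefficients [g y]. *)
pose h : 'rV[rat]_N := delta_mx 0 i1 + delta_mx 0 i0 - 2 *: delta_mx 0 iw.
have h0 : h != 0.
  apply/eqP => /rowP/(_ iw)/eqP; rewrite !mxE !eqxx ![iw == _]eq_sym.
  by rewrite (negPf i1w) (negPf i0w).
pose K : 'M[R]_N := map_mx ratr (kermx h^T).
pose g (y : 'rV[R]_N) := coef_vector D c0 + y *m K.
have hdot (c : 'rV[R]_N) : dot c (map_mx ratr h) = c 0 i1 + c 0 i0 - 2 * c 0 iw.
  rewrite /h !(map_mxD, map_mxN, map_mxZ, map_delta_mx) dotC !(dotDl, dotNl, dotZl).
  by rewrite !dot_delta rmorph_nat.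
have gh y : dot (g y) (map_mx ratr h) = 0.
  have Kh : dot (y *m K) (map_mx ratr h) = 0.
    by rewrite /dot -mulmxA map_trmx -map_mxM mulmx_ker map_mx0 mulmx0 mxE.
  rewrite /g dotDl Kh addr0 hdot !mxE -!/(lattice_point _) iwE i1E i0E.
  by have [e1 e2 _ _ _ _] := crit0 k0; lra.
have gH y : coef_fun (g y) (w + e) + coef_fun (g y) (w - e) = 2 * coef_fun (g y) w.
  by have := gh y; rewrite hdot -i1E -i0E -iwE !coef_funE; lra.
have gc i : continuous (fun y => g y 0 i).
  rewrite [X in continuous X](_ : _ = (fun y : 'rV[R]_N =>
      coef_vector D c0 0 i + dot y (col i K)^T)).
    exact/cstD_continuous/linear_rV_continuous.
  by apply/funext => y; rewrite dot_col [LHS]mxE.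
have g0 : g 0 = coef_vector D c0 by rewrite /g mul0mx addr0.
have good := near_critical gc g0 gH.
set G := (X in \forall y \near _, X y) in good.
pose Q (t : {set {set 'I_N}}) := [set y : 'rV[R]_N | [/\ G y,
  (exists q : 'rV[rat]_N, y = map_mx ratr q) & @face_type R D (coef_fun (g y)) = t]].
have gQ y : (exists q : 'rV[rat]_N, y = map_mx ratr q) ->
    forall x, x \in A -> is_rational (coef_fun (g y) x).
  move=> [q ->] x /lattice_pointP[i <-]; rewrite coef_funE.
  have [|q0 q0E] := @rational_rowP R _ (coef_vector D c0).
    by move=> j; rewrite mxE; apply: c0Q; exact: lattice_point_in.
  by rewrite /g q0E -map_mxM -map_mxD mxE; eexists.
(* Rational [y] are dense near 0 and each has some face type; so one type [t] is dense in a nonempty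
   open set [V], from which the final [y1] is taken. *)
have [|||t [V [oV [y0 Vy0] VQ]]] := @closure_finite_cover _ _ Q (interior G).
- exact: open_interior.
- by exists 0.
- apply: subset_trans (closure_rational_rV (@open_interior _ G)) _.
  apply: closureS => y [/interior_subset Gy [q _ qy]].
  by exists (@face_type R D (coef_fun (g y))); split=> //; exists q.
have [_ y0Q] := VQ _ Vy0.
have [y1 [[Gy1 y1Q y1t] _]] := y0Q _ (open_nbhs_nbhs (conj oV Vy0)).
pose c := coef_fun (g y1).
have sing y : Q t y -> singular_tropical D (coef_fun (g y)).
  by move=> [Gy yQ _]; have [] := critical_tropical_singular (gQ _ yQ) (Gy.2 k0).
exists c; split; last first.
  exists [seq pk c k | k <- enum I]; split.
  - by rewrite map_inj_uniq ?enum_uniq//; exact: Gy1.1.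
  - by move=> p /mapP[k _ ->]; have [] := critical_tropical_singular (gQ _ y1Q) (Gy1.2 k).
  - by rewrite size_map cardT.
split; first exact: sing.
split; last by apply: deformation_space_thin => //; lia.
have gC_cont : continuous (fun y => g y *m C).
  apply: coordinatewise_continuous => j.
  rewrite [X in continuous X](_ : _ = (fun y => dot (col j C)^T (g y))).
    exact: dot_continuous.
  by apply/funext => y; rewrite dotC dot_col.
have VC y : V y -> closure (@deformation_space R D c) (g y *m C).
  move=> /VQ[_ yQ] B /gC_cont/yQ[z [Qz Bz]]; exists (g z *m C); split=> //.
  exists (coef_fun (g z)); last by rewrite coef_funK.
  split; first exact: sing.
  by apply: (eq_dual_subdivision hullD); have [_ _ ->] := Qz.
(* [K] has rank [N - 1] and the kernel of [C] has dimension 1, so at most one dimension is lost in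
   the quotient. *)
have rankKC : (N - 2 <= \rank (K *m C))%N.
  have := mxrank_mul_ker K C.
  have : (\rank (K :&: kermx C)%MS <= 1)%N.
    apply: leq_trans (mxrankS (capmxSr _ _)) _.
    by rewrite mxrank_ker rank_cokermx_ones//; lia.
  rewrite mxrank_map mxrank_ker mxrank_tr rank_rV h0 /=.
  by move: (\rank _) (\rank _) => r1 r2; lia.
have [Z Zfree] := row_free_mull rankKC.
have /nbhs_ballP[r /= r0 rV] := open_nbhs_nbhs (conj oV Vy0).
(* [S] exceeds all entries of [l *m Z] for subweights [l]; scaling by [r / S] keeps the simplex in
   the ball around [y0]. *)
pose S : R := 1 + \sum_i \sum_j `|Z i j|.
have S0 : 0 < S by rewrite ltr_wpDr// sumr_ge0// => i _; rewrite sumr_ge0.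
exists (g y0 *m C), ((r / S) *: (Z *m (K *m C))); split.
  by rewrite /row_free mxrank_scale_nz// mulf_neq0 ?invr_eq0 ?gt_eqF.
rewrite simplexE => _ [l [l0 l1] <-].
have -> : g y0 *m C + l *m ((r / S) *: (Z *m (K *m C))) =
    g (y0 + (r / S) *: (l *m Z)) *m C.
  rewrite /g; move: (cokermx _) => C'.
  by rewrite !mulmxDl -!scalemxAl -scalemxAr !mulmxA addrA.
apply/VC/rV; split=> // i j; rewrite ord1 /ball /= !mxE opprD addrA subrr sub0r normrN.
rewrite normrM gtr0_norm ?divr_gt0// mulrAC ltr_pdivrMr// ltr_pM2l//.
apply: (@le_lt_trans _ _ (\sum_i \sum_j `|Z i j|)); last by rewrite /S ltrDr.
apply: le_trans (ler_norm_sum _ _ _) _; apply: ler_sum => k _.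
rewrite normrM; apply: (@le_trans _ _ `|Z k j|); last first.
  by rewrite (bigD1 j)//= lerDl sumr_ge0.
rewrite ler_piMl// ger0_norm//; apply: le_trans l1.
by rewrite (bigD1 k)//= lerDl sumr_ge0.
Qed.

End Perturbation.

(** * Lattice polytopes and their dilates *)

Section LatticePolytopes.
Variable R : realType.
Implicit Types (D : set 'rV[R]_3) (s : seq 'rV[int]_3) (w : 'rV[int]_3).

Lemma embedMn w n : embed R (w *+ n) = n%:R *: embed R w.
Proof. by rewrite scaler_nat; apply/rowP => j; rewrite !mxE !mulmxnE !mxE rmorphMn. Qed.

Lemma dilate_convex n D : convex_set D -> convex_set (dilate n D).
Proof.
move=> /convex_setP cD; apply/convex_setP => _ _ t t01 [x Dx <-] [y Dy <-].
exists (t *: x + (1 - t) *: y); first exact: cD.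
by rewrite scalerDr !scalerA ![n%:R * _]mulrC.
Qed.

Lemma dilateD k m D x y : convex_set D -> dilate k D x -> dilate m D y ->
  dilate (k + m) D (x + y).
Proof.
move=> /convex_setP cD [x0 Dx <-] [y0 Dy <-].
have [km0|km0] := eqVneq (k + m)%N 0%N.
  move: km0 => /eqP; rewrite addn_eq0 => /andP[/eqP-> /eqP->].
  by exists x0; rewrite ?scale0r ?addr0.
have km : (k + m)%:R != 0 :> R by rewrite pnatr_eq0.
exists (k%:R / (k + m)%:R *: x0 + (1 - k%:R / (k + m)%:R) *: y0).
  apply: cD => //; rewrite divr_ge0//= ler_pdivrMr ?mul1r ?ler_nat ?leq_addr//.
  by rewrite ltr0n lt0n.
rewrite scalerDr !scalerA; congr (_ *: _ + _ *: _); first by rewrite mulrC divfK.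
by rewrite mulrBr mulr1 [X in _ - X]mulrC divfK// natrD addrAC subrr add0r.
Qed.

Lemma dilate1 D : dilate 1 D = D.
Proof.
apply/seteqP; split=> [_ [x Dx <-]|x Dx]; first by rewrite scale1r.
by exists x => //; rewrite scale1r.
Qed.

Lemma lattice_polytope_dilate n D : lattice_polytope D -> lattice_polytope (dilate n D).
Proof.
move=> [s ->]; exists [seq w *+ n | w <- s]; apply/seteqP; split.
  move=> _ [x hx <-]; apply: (conv_hull_sub (Y := [set x | conv_hull _ (n%:R *: x)])) hx.
    move=> a b t t01 ha hb /=; rewrite scalerDr !scalerA ![n%:R * _]mulrC -!scalerA.
    by have /convex_setP := @convex_conv_hull R 3 (embed R @` [set` [seq w *+ n | w <- s]]); apply.
  move=> _ [w ws <-]; apply: conv_hull_gen; exists (w *+ n); last exact: embedMn.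
  exact: map_f.
apply: smallest_sub; first by apply: dilate_convex; exact: convex_conv_hull.
move=> _ [w /= /mapP[w' ws ->] <-]; exists (embed R w'); last by rewrite embedMn.
by apply: conv_hull_gen; exists w'.
Qed.

Lemma lattice_polytope_convex D : lattice_polytope D -> convex_set D.
Proof. by move=> [s ->]; exact: convex_conv_hull. Qed.

Lemma lattice_polytope_finite D : lattice_polytope D -> finite_set [set w | D (embed R w)].
Proof.
move=> [s ->]; pose B := (\sum_(w <- s) \sum_(i < 3) `|w ord0 i|)%N.
have wB w i : w \in s -> (`|w ord0 i| <= B)%N.
  move=> ws; rewrite /B (big_rem w)//= (bigD1 i)//= -addnA leq_addr//.
have hB x : conv_hull (embed R @` [set` s]) x -> forall i, `|x 0 i| <= B%:R.
  apply: (conv_hull_sub (Y := [set x : 'rV[R]_3 | forall i, `|x 0 i| <= B%:R])) =>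
      [a b t /andP[t0 t1] aB bB i|_ [w ws <-] i].
    rewrite !mxE; have := aB i; have := bB i; rewrite !ler_norml => /andP[? ?] /andP[? ?].
    by apply/andP; split; nra.
  by rewrite mxE -intr_norm -abszE -pmulrn ler_nat wB.
pose g (h : {ffun 'I_3 -> 'I_(B + B).+1}) : 'rV[int]_3 := \row_i ((h i)%:Z - B%:Z).
apply: (@sub_finite_set _ _ (range g)); last exact: finite_image.
move=> w /hB wB'.
have wi i : (absz (w 0%R i + B%:Z)%R < (B + B).+1)%N /\ 0 <= w 0 i + B%:Z.
  by have := wB' i; rewrite mxE -intr_norm -abszE -pmulrn ler_nat; lia.
exists [ffun i => Ordinal (wi i).1] => //.
apply/rowP => i; rewrite mxE ffunE /=.
by have := (wi i).2; lia.
Qed.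

Lemma lattice_polytope_hull D : lattice_polytope D ->
  D = conv_hull [set row i (lattice_matrix D) | i in [set: 'I_#|`lattice_points D|]].
Proof.
move=> lD; have finD := lattice_polytope_finite lD.
have -> : [set row i (lattice_matrix D) | i in [set: 'I_#|`lattice_points D|]] =
    embed R @` [set w | D (embed R w)].
  have -> : [set w | D (embed R w)] = [set` lattice_points D].
    by apply/seteqP; split=> w /=; rewrite in_lattice_points// => /asboolP.
  by rewrite image_lattice_points; apply: eq_imagel => i _; rewrite rowK.
have [s Ds] := lD; apply/seteqP; split.
  rewrite {1}Ds; apply: conv_hullS => _ [w ws <-]; exists w => //=.
  by rewrite Ds; apply: conv_hull_gen; exists w.
by apply: smallest_sub; [exact: lattice_polytope_convex|move=> _ [w Dw <-]].
Qed.

End LatticePolytopes.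

Section Configurations.
Variable R : realType.
Implicit Types (D : set 'rV[R]_3).

Lemma row3_mul (v a b c : 'rV[R]_3) :
  v *m row3 a b c = v 0 0 *: a + v 0 1 *: b + v 0 2%:R *: c.
Proof.
rewrite mulmx_sum_row !big_ord_recl big_ord0 addr0 !rowK addrA.
by congr (v 0 _ *: _ + v 0 _ *: _ + v 0 _ *: _); exact: val_inj.
Qed.

Lemma row3_unitP (a b c : 'rV[R]_3) : row3 a b c \in unitmx <->
  forall x y z : R, x *: a + y *: b + z *: c = 0 -> [/\ x = 0, y = 0 & z = 0].
Proof.
split=> [Wu x y z xyz|abc].
  pose v : 'rV[R]_3 := \row_(i < 3) (if i == 0 then x else if i == 1 then y else z).
  have : v *m row3 a b c = 0 by rewrite row3_mul !mxE.
  move/(congr1 (mulmx^~ (invmx (row3 a b c)))); rewrite mulmxK// mul0mx => /rowP v0.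
  by have := v0 0; have := v0 1; have := v0 2%:R; rewrite !mxE /= => -> -> ->.
rewrite -row_free_unit -kermx_eq0; apply/eqP/row_matrixP => i; rewrite row0.
set v := row i _; have : v *m row3 a b c = 0 by rewrite /v -row_mul mulmx_ker row0.
rewrite row3_mul => /abc[v0 v1 v2]; apply/rowP => j; rewrite [RHS]mxE.
by case: j => -[|[|[|//]]] j;
  [rewrite -[RHS]v0|rewrite -[RHS]v1|rewrite -[RHS]v2]; congr (v 0 _); exact: val_inj.
Qed.

(** A single critical point at [p = 0], with heights 0 on the triple, -1 on [u1], [u2], [u3] and -2
    elsewhere; [w], [u1], [u3], [u2] form a parallelogram, so [a = b = 1]. It supplies a surface
    where the claimed number of singular points is not positive. *)
Lemma small_configuration D (w e u1 u2 u3 : 'rV[int]_3) : lattice_polytope D ->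
  (forall x, x \in [:: w; w + e; w - e; u1; u2; u3] -> D (embed R x)) ->
  row3 (embed R e) (embed R (u1 - w)) (embed R (u2 - w)) \in unitmx ->
  u3 - w = (u1 - w) + (u2 - w) -> exists c, maximal_dimensional D c.
Proof.
move=> lD DA Wu u3E; have finD := lattice_polytope_finite lD.
have hullD := lattice_polytope_hull lD; have indep := (row3_unitP _ _ _).1 Wu.
have uT u x y z : embed R (u - w) =
      x *: embed R e + y *: embed R (u1 - w) + z *: embed R (u2 - w) ->
    (y != 0) || (z != 0) -> u \notin [:: w; w + e; w - e].
  move=> uE yz; apply/negP; rewrite !inE => /or3P uw.
  have [h uwh] : exists h : R, embed R (u - w) = h *: embed R e.
    case: uw => /eqP->; [exists 0|exists 1|exists (-1)].
    - by rewrite subrr /embed map_mx0 scale0r.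
    - by rewrite [w + e]addrC addrK scale1r.
    - by rewrite [w - e]addrC addrK scaleN1r embedN.
  have [] := indep (x - h) y z; last by move=> _ y0 z0; rewrite y0 z0 eqxx in yz.
  by apply/rowP => j; have /rowP/(_ j) := uE; rewrite uwh !mxE mulrBl => ->; ring.
pose c0 (x : 'rV[int]_3) : R := if x \in [:: w; w + e; w - e] then 0
  else if x \in [:: u1; u2; u3] then -1 else -2.
have c0w x : x \in [:: w; w + e; w - e] -> c0 x = 0 by rewrite /c0 => ->.
have c0u x : x \in [:: u1; u2; u3] -> c0 x = -1.
  rewrite /c0 => xu; rewrite xu ifF//; apply/negbTE.
  have : [|| x == u1, x == u2 | x == u3] by rewrite !inE in xu.
  move=> /or3P[]/eqP->.
  - by apply: (@uT _ 0 1 0); [rewrite !scale0r scale1r add0r addr0|rewrite oner_eq0].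
  - by apply: (@uT _ 0 0 1); [rewrite !scale0r scale1r !add0r|rewrite oner_eq0 orbT].
  - apply: (@uT _ 0 1 1); last by rewrite oner_eq0.
    by rewrite u3E embedD scale0r !scale1r add0r.
have [|||||c [cm _]] := @many_tropical_singular_points R D finD hullD c0 w e unit
  (fun=> u1) (fun=> u2) (fun=> u3) (fun=> 0) _ _ _ _ _ tt.
- by move=> _ x /DA Dx; rewrite in_lattice_points//; exact/asboolP.
- move=> _; split=> //; exists 1, 1; split; rewrite ?oner_eq0//.
    by rewrite -subr_eq0 addrK oner_eq0.
  by rewrite u3E embedD !scale1r.
- move=> _; have d0 (x : 'rV[R]_3) : dot x 0 = 0 by rewrite dotC /dot mul0mx mxE.
  split; rewrite ?d0 ?addr0 ?subr0.
  + by rewrite !c0w// !inE eqxx ?orbT.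
  + by rewrite !c0w// !inE eqxx ?orbT.
  + by rewrite !c0u// !inE eqxx ?orbT.
  + by rewrite !c0u// !inE eqxx ?orbT.
  + by rewrite c0u ?c0w ?inE ?eqxx ?orbT// ltrN10.
  + move=> x _ xn; rewrite (c0u u1) ?inE ?eqxx// d0 addr0 /c0 !ifF; [lra| |];
      apply: contraNF xn; rewrite !inE => /or3P[]->; rewrite ?orbT//.
- by move=> [] [].
- move=> x _; rewrite /c0; case: ifP => _; first exact: (is_rational_nat _ 0).
  by case: ifP => _; apply: is_rationalN; [exact: (is_rational_nat _ 1)|exact: is_rational_nat].
by exists c.
Qed.

End Configurations.

Section LatticePointsInDilates.
Variable R : realType.
Implicit Types (D : set 'rV[R]_3).

(** If the differences of the generators did not span, a nonzero linear form would be constant on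
    [D], against the simplex contained in it. Three independent differences are then selected. *)
Lemma affine_frame D : lattice_polytope D -> has_dim D 3 ->
  exists a b c d : 'rV[int]_3, [/\ D (embed R a), D (embed R b), D (embed R c), D (embed R d) &
    row3 (embed R (b - a)) (embed R (c - a)) (embed R (d - a)) \in unitmx].
Proof.
move=> [s Ds] [[p [M [Mfree pM]]] _].
rewrite simplexE in pM.
have subw0 : subweights (0 : 'rV[R]_3).
  by split=> [i|]; [rewrite mxE|rewrite big1// => i _; rewrite mxE].
have Dp : D p by apply: pM; exists 0; rewrite // mul0mx addr0.
have DpM i : D (p + row i M).
  apply: pM; exists (delta_mx 0 i); last by rewrite -rowE.
  by have [w0 w1] := weights_delta R i; split=> //; rewrite w1.
have sD w : w \in s -> D (embed R w) by move=> ws; rewrite Ds; apply: conv_hull_gen; exists w.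
case: s => [|a s] in Ds sD.
  have : D `<=` set0.
    by rewrite Ds; apply: (conv_hull_sub (Y := set0)) => [x y t _ []|x [w]].
  by move=> /(_ _ Dp).
pose Y : 'M[R]_(size (a :: s), 3) := \matrix_i embed R (nth 0 (a :: s) i - a).
have Yfull : row_full Y.
  suff : row_free Y^T by rewrite /row_free /row_full mxrank_tr.
  rewrite -kermx_eq0; apply: contraT => /rowV0Pn[v /sub_kermxP vY v0].
  have Dv x : D x -> dot x v = dot (embed R a) v.
    rewrite Ds; apply: (conv_hull_sub (Y := [set x | dot x v = dot (embed R a) v])) =>
      [x1 x2 t _ /= v1 v2|_ [w /= ws <-]].
      by rewrite dotDl !dotZl v1 v2; ring.
    have wN : (index w (a :: s) < size (a :: s))%N by rewrite index_mem.
    have := congr1 (fun z : 'rV_(size (a :: s)) => z 0 (Ordinal wN)) vY.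
    rewrite -dot_row rowK mxE /= -/(index w (a :: s)) nth_index// dotC embedB dotBl.
    by move/eqP; rewrite subr_eq0 => /eqP.
  have Mv : M *m v^T = 0.
    apply/colP => i; rewrite [RHS]mxE.
    have := Dv _ (DpM i); rewrite dotDl (Dv _ Dp) -[RHS]addr0 => /addrI.
    by rewrite /dot -row_mul mxE.
  move: Mfree; rewrite row_free_unit => Mu.
  by move: v0; rewrite -(trmxK v) -(mulKmx Mu v^T) Mv mulmx0 trmx0 eqxx.
pose f := fullrankfun Yfull; pose pt i := nth 0 (a :: s) (f i).
exists a, (pt 0), (pt 1), (pt 2%:R); split; try by apply: sD; rewrite ?mem_head ?mem_nth.
rewrite (_ : row3 _ _ _ = rowsub f Y); first exact: fullrowsub_unit.
apply/row_matrixP => i; rewrite row_rowsub !rowK.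
by case: i => -[|[|[|//]]] i /=; rewrite /pt; congr (embed _ (nth _ _ (f _) - _)); exact: val_inj.
Qed.

(** In [2 D] the sums [2a], [a + b], [2b] form the triple, and [b + c], [a + d], [c + d] complete a
    parallelogram at [a + b]. The other [n - 2] summands are all [a]. *)
Lemma maximal_dimensional_dilate D n : lattice_polytope D -> has_dim D 3 -> (2 <= n)%N ->
  exists c, maximal_dimensional (dilate n D) c.
Proof.
move=> lD D3 n2; have cD := lattice_polytope_convex lD.
have [a [b [c [d [Da Db Dc Dd Wu]]]]] := affine_frame lD D3.
have Dxy x y : D (embed R x) -> D (embed R y) ->
    dilate n D (embed R (a *+ (n - 2) + x + y)).
  move=> Dx Dy; rewrite -[X in dilate X _](subnK n2) -[2%N]/(1 + 1)%N addnA.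
  rewrite !embedD embedMn; apply: dilateD => //; last by rewrite dilate1.
  by apply: dilateD; rewrite ?dilate1//; exists (embed R a).
pose w := a *+ (n - 2) + a + b.
apply: (@small_configuration R (dilate n D) w (b - a)
  (a *+ (n - 2) + b + c) (a *+ (n - 2) + a + d) (a *+ (n - 2) + c + d)).
- exact: lattice_polytope_dilate.
- move=> x; have E1 : w + (b - a) = a *+ (n - 2) + b + b.
    by rewrite /w; apply/rowP => i; rewrite !mxE; ring.
  have E2 : w - (b - a) = a *+ (n - 2) + a + a.
    by rewrite /w; apply/rowP => i; rewrite !mxE; ring.
  by rewrite E1 E2 !inE => /or4P[/eqP->|/eqP->|/eqP->|/or3P[]/eqP->]; exact: Dxy.
- have -> : a *+ (n - 2) + b + c - w = c - a.
    by rewrite /w; apply/rowP => i; rewrite !mxE; ring.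
  have -> : a *+ (n - 2) + a + d - w = (d - a) - (b - a).
    by rewrite /w; apply/rowP => i; rewrite !mxE; ring.
  apply/row3_unitP => x y z; rewrite embedB => xyz.
  have [|xz y0 z0] := (row3_unitP _ _ _).1 Wu (x - z) y z; last first.
    by split=> //; move: xz; rewrite z0 subr0.
  rewrite -[RHS]xyz; apply/rowP => i; rewrite !mxE; ring.
- by rewrite /w; apply/rowP => i; rewrite !mxE; ring.
Qed.

Lemma box_in_dilate D (B : R) : convex_set D -> has_dim D 3 -> 0 <= B ->
  exists (k : nat) (q : 'rV[int]_3),
    forall x : 'rV[R]_3, (forall i, `|x 0 i| <= B) -> dilate k D (embed R q + x).
Proof.
move=> cD [[p [M [Mfree pM]]] _] B0; rewrite simplexE in pM.
move: Mfree; rewrite row_free_unit => Mu.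
(* Bounds the coordinates in the basis [M] of a vector with entries at most [B + 1]; the extra 1
   absorbs the rounding of [ctr] to the lattice point [q]. *)
pose T := (B + 1) * \sum_i \sum_j `|invmx M j i|.
have T0 : 0 <= T by rewrite mulr_ge0 ?addr_ge0// sumr_ge0// => i _; rewrite sumr_ge0.
(* Around the point with simplex coordinates [(k/4, k/4, k/4)] in the [k]-fold simplex, deviations
   up to [k / 12] keep the coordinates nonnegative and their sum at most [3k/4 + 3k/12 = k]. *)
pose k := (Num.truncn (12 * T)).+1.
have kT : 12 * T <= k%:R by rewrite ltW// truncnS_gt.
have k0 : 0 < k%:R :> R by rewrite ltr0n.
have [ctr ctrE] : exists ctr, ctr = k%:R *: p + (k%:R / 4) *: (const_mx 1 *m M) by eexists.
pose q : 'rV[int]_3 := \row_i Num.floor (ctr 0 i).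
exists k, q => x xB.
pose y := embed R q + x - ctr.
have yB i : `|y 0 i| <= B + 1.
  have := xB i; rewrite !mxE => xi.
  have /andP[f1 f2] := floor_itv (ctr 0 i); rewrite intrD in f2.
  by move: xi; rewrite !ler_norml => /andP[x1 x2]; apply/andP; split; lra.
have [z zE] : exists z, z = y *m invmx M by eexists.
have zT i : `|z 0 i| <= T.
  apply: (@le_trans _ _ ((B + 1) * \sum_j `|invmx M j i|)).
    rewrite zE mxE mulr_sumr; apply: le_trans (ler_norm_sum _ _ _) _.
    by apply: ler_sum => j _; rewrite normrM ler_wpM2r.
  rewrite ler_wpM2l ?addr_ge0// [leRHS](bigD1 i)//= lerDl sumr_ge0// => l _.
  by rewrite sumr_ge0.
exists (k%:R^-1 *: (embed R q + x)); last by rewrite scalerA mulfV ?gt_eqF// scale1r.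
apply: pM; exists (k%:R^-1 *: ((k%:R / 4) *: const_mx 1 + z)).
  have tE i : (k%:R^-1 *: ((k%:R / 4) *: const_mx 1 + z)) 0 i = k%:R^-1 * (k%:R / 4 + z 0 i).
    by rewrite !mxE mulr1.
  split=> [i|].
    by rewrite tE mulr_ge0 ?invr_ge0 ?(ltW k0)//; have := zT i; rewrite ler_norml; lra.
  under eq_bigr do rewrite tE.
  rewrite -mulr_sumr ler_pdivrMl// mulr1 !big_ord_recl big_ord0.
  by have := zT ord0; have := zT (lift ord0 ord0); have := zT (lift ord0 (lift ord0 ord0));
    rewrite !ler_norml; lra.
have zM : z *m M = y by rewrite zE mulmxKV.
rewrite -scalemxAl mulmxDl zM -scalemxAl.
have -> : p = k%:R^-1 *: (k%:R *: p) by rewrite scalerA mulVf ?gt_eqF// scale1r.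
by rewrite -scalerDr addrA -ctrE /y addrC subrK.
Qed.

End LatticePointsInDilates.

(** * The chain of triangles along a long segment *)

Section ManySingularPoints.
Variable R : realType.
Implicit Types (D : set 'rV[R]_3).

(** The given segment of [m D], scaled by [(n - k) / m], lies in [(n - k) D]. Only its starting
    point is rounded to the lattice; the error, below 1, and the displacement [d], at most 3, fit
    into the box of half-width 4 in [k D]. *)
Lemma long_segment D (k m n M L : nat) (q u v e : 'rV[int]_3) : convex_set D ->
  (forall x : 'rV[R]_3, (forall i, `|x 0 i| <= 4) -> dilate k D (embed R q + x)) ->
  (k <= n)%N -> (0 < m)%N -> dilate m D (embed R u) -> dilate m D (embed R v) ->
  v - u = e *+ M -> (L * m <= (n - k) * M)%N ->
  exists X : 'rV[int]_3, forall i (d : 'rV[int]_3), (i <= L)%N -> (forall j, `|d 0 j| <= 3) ->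
    dilate n D (embed R (X + e *+ i + d)).
Proof.
move=> cD box kn m0 [a Da au] [b Db bv] uv LM.
have m0R : m%:R != 0 :> R by rewrite pnatr_eq0 -lt0n.
pose P : 'rV[R]_3 := (n - k)%:R *: a.
pose X0 : 'rV[int]_3 := \row_j Num.floor (P 0 j).
exists (X0 + q) => i d iL dj.
have seg : dilate (n - k) D (P + i%:R *: embed R e).
  have iM : (i * m <= (n - k) * M)%N by apply: leq_trans LM; rewrite leq_mul2r iL orbT.
  have [nM|nM] := eqVneq ((n - k) * M)%N 0%N.
    have -> : i = 0%N by move: iM; rewrite nM leqn0 muln_eq0 (gtn_eqF m0) orbF => /eqP.
    by exists a; rewrite // scale0r addr0.
  have nM0 : ((n - k) * M)%:R != 0 :> R by rewrite pnatr_eq0.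
  pose t : R := (i * m)%:R / ((n - k) * M)%:R.
  exists (t *: b + (1 - t) *: a).
    move/convex_setP: cD; apply=> //; rewrite divr_ge0//= ler_pdivrMr ?mul1r ?ler_nat//.
    by rewrite lt_def nM0 ler0n.
  have ba : m%:R *: (b - a) = M%:R *: embed R e by rewrite scalerBr au bv -embedB uv embedMn.
  apply: (@scalerI _ _ m%:R) => //.
  have -> : t *: b + (1 - t) *: a = a + t *: (b - a).
    by rewrite scalerBl scale1r scalerBr addrCA.
  move: (b - a) ba => c ba; rewrite /P !scalerDr; congr (_ + _); rewrite !scalerA.
  rewrite [m%:R * (_ * t)]mulrC -[LHS]scalerA ba scalerA /t !natrM.
  congr (_ *: _).
  by field; move: nM; rewrite muln_eq0 negb_or !pnatr_eq0 => /andP[-> ->].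
have -> : embed R (X0 + q + e *+ i + d) =
    (P + i%:R *: embed R e) + (embed R q + (embed R X0 - P + embed R d)).
  by rewrite !embedD embedMn; apply/rowP => j; rewrite !mxE; ring.
rewrite -(subnK kn); apply: dilateD => //; apply: box => j.
have := dj j; rewrite !mxE.
have /andP[f1 f2] := floor_itv ((n - k)%:R * a 0 j); rewrite intrD in f2.
rewrite -(ler_int R) intr_norm !ler_norml => /andP[d1 d2].
by apply/andP; split; lra.
Qed.

Lemma parabola_gap (i r : R) : 0 <= i -> i + 2 <= r -> 0 < 4 * r - 2 * i + 2 * i ^+ 2 - 2.
Proof. by have := sqr_ge0 i; lra. Qed.

(** The function [- l ^ 2] lies strictly below its chord through [k] and [k + 1] at all other
    integers; the product is the difference. *)
Lemma nat_square_gap (l k : nat) : l != k -> l != k.+1 ->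
  0 < (l%:R - k%:R) * (l%:R - k%:R - 1 : R).
Proof.
rewrite neq_ltn => /orP[lk _|kl lk].
  have lkR : l%:R + 1 <= k%:R :> R by rewrite natr1 ler_nat.
  by rewrite nmulr_rgt0; lra.
have klR : k%:R + 2 <= l%:R :> R by rewrite -natrD ler_nat addn2 ltn_neqAle eq_sym lk.
by rewrite mulr_gt0; lra.
Qed.

(** Modulo [e1], in coordinates [(e, e2)] centred at [X], the chain is [(l, 1)], and the two apexes
    are [pA = (1, 2)] and [pB = (1, 0)]. The concave heights [- l ^ 2] make each unit segment of the
    chain an edge of one triangle on either side. *)
Lemma big_configuration D (X e e1 e2 : 'rV[int]_3) (L : nat) : lattice_polytope D ->
  (0 < L)%N -> row3 (embed R e1) (embed R e) (embed R e2) \in unitmx ->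
  (forall l, (l <= L)%N -> D (embed R (X + e *+ l + e2))) ->
  (forall x, x \in [:: X; X + e1; X - e1; X + e; X + e + e2 *+ 2] -> D (embed R x)) ->
  exists c, maximal_dimensional D c /\ exists s : seq 'rV[R]_3,
    [/\ uniq s, forall p, p \in s -> tropical_singular_point D c p & size s = (L * 2)%N].
Proof.
move=> lD L0 W0 DS DX; have finD := lattice_polytope_finite lD.
have hullD := lattice_polytope_hull lD.
(* Dual vectors to [e] and [e2] that kill [e1]: slopes in their span give [X - e1], [X], [X + e1]
   the same value. *)
have [d1 [d2 [[d11 d10 d12] [d21 d20 d22]]]] : exists d1 d2 : 'rV[R]_3,
    [/\ dot (embed R e1) d1 = 0, dot (embed R e) d1 = 1 & dot (embed R e2) d1 = 0] /\
    [/\ dot (embed R e1) d2 = 0, dot (embed R e) d2 = 0 & dot (embed R e2) d2 = 1].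
  set W := row3 _ _ _ in W0.
  have dE i j : dot (row i W) (col j (invmx W))^T = (j == i)%:R.
    by rewrite dot_col -row_mul mulmxV// !mxE eq_sym.
  exists (col 1 (invmx W))^T, (col 2%:R (invmx W))^T.
  by split; split; [have := dE 0 1|have := dE 1 1|have := dE 2%:R 1|
    have := dE 0 2%:R|have := dE 1 2%:R|have := dE 2%:R 2%:R]; rewrite rowK.
(* The points [S 0], ..., [S L] with concave coefficients, [pA] above and [pB]
   below them, span [2 * L] triangles; [p_ k] is the slope of the dual plane of
   the [k]-th one. There [X - e1], [X], [X + e1] have the maximal value [0] and
   the vertices of the triangle the value [VU k]. *)
pose S l := X + e *+ l + e2; pose pA := X + e + e2 *+ 2; pose pB := X + e.
(* [CA] is large enough for all triangle levels [VU] to be below the value 0 of the triple. The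
   difference [CB - CA = 4 rL] makes [parabola_gap] the amount by which the apex opposite to the
   triangle stays below its level. *)
pose rL : R := L.+1%:R; pose CA : R := 2 * rL ^+ 2; pose CB : R := CA + 4 * rL.
pose I : finType := ('I_L * bool)%type.
pose i_ (k : I) : R := (k.1 : nat)%:R.
(* [x_] makes [- l ^ 2 + l x] equal at [i] and [i + 1]; [y_] is then forced by requiring the apex
   [pA] or [pB] to have the same value as these two points. *)
pose x_ k := 2 * i_ k + 1.
pose y_ (k : I) := if k.2 then i_ k ^+ 2 - i_ k - 1 - CA else i_ k + 1 - CB - i_ k ^+ 2.
pose p_ k := x_ k *: d1 + y_ k *: d2.
pose vl x k := dot (embed R (x - X)) (p_ k).
have dp u k : dot u (p_ k) = x_ k * dot u d1 + y_ k * dot u d2.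
  by rewrite /p_ [dot u _]dotC dotDl !dotZl ![dot _ u]dotC.
have SX l : embed R (S l - X) = l%:R *: embed R e + embed R e2.
  by rewrite -embedMn -embedD; congr embed; rewrite /S -[X + _ + e2]addrA [X + _]addrC addrK.
have AX : embed R (pA - X) = embed R e + 2 *: embed R e2.
  by rewrite -embedMn -embedD; congr embed; rewrite /pA -[X + e + _]addrA [X + _]addrC addrK.
have BX : embed R (pB - X) = embed R e by rewrite /pB [X + e]addrC addrK.
have PX : embed R (X + e1 - X) = embed R e1 by rewrite [X + e1]addrC addrK.
have MX : embed R (X - e1 - X) = - embed R e1 by rewrite -embedN [X - e1]addrC addrK.
have XX : embed R (X - X) = 0 by rewrite subrr /embed map_mx0.
have d0 (u : 'rV[R]_3) : dot 0 u = 0 by rewrite /dot mul0mx mxE.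
have vS l k : vl (S l) k = l%:R * x_ k + y_ k.
  by rewrite /vl SX dp !dotDl !dotZl d10 d12 d20 d22; ring.
have vA k : vl pA k = x_ k + 2 * y_ k.
  by rewrite /vl AX dp !dotDl !dotZl d10 d12 d20 d22; ring.
have vB k : vl pB k = x_ k by rewrite /vl BX dp d10 d20; ring.
have vT x k : x \in [:: X; X + e1; X - e1] -> vl x k = 0.
  by rewrite !inE /vl => /or3P[]/eqP->; rewrite ?XX ?PX ?MX dp ?d0 ?dotNl ?d11 ?d21; ring.
have vD x y k : dot (embed R (x - y)) (p_ k) = vl x k - vl y k.
  by rewrite /vl -dotBl -embedB; congr (dot (embed _ _) _); rewrite opprB addrA subrK.
pose VU k := i_ k ^+ 2 + i_ k + y_ k.
(* A height pushing all remaining lattice points below every triangle level; it is an integer so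
   that the coefficients stay rational. *)
pose big := (Num.truncn (\sum_(k : I) \sum_(x <- lattice_points D) `|vl x k - VU k|)).+1.
have bigP x k : x \in lattice_points D -> vl x k - big%:R < VU k.
  move=> xA; suff : vl x k - VU k < big%:R by lra.
  apply: le_lt_trans (ler_norm _) _; apply: le_lt_trans (truncnS_gt _).
  rewrite (bigD1 k)//= (big_rem x)//= -addrA lerDl addr_ge0//.
    by rewrite sumr_ge0.
  by rewrite sumr_ge0// => k' _; rewrite sumr_ge0.
pose c0 x : R := if x \in [:: X; X + e1; X - e1] then 0
  else if x == pA then CA else if x == pB then - CB
  else if x \in [seq S l | l <- iota 0 L.+1] then - dot (embed R (x - X)) d1 ^+ 2
  else - big%:R.
have cT x : x \in [:: X; X + e1; X - e1] -> c0 x = 0 by rewrite /c0 => ->.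
have nT x : (dot (embed R (x - X)) d1 != 0) || (dot (embed R (x - X)) d2 != 0) ->
    (x \in [:: X; X + e1; X - e1]) = false.
  apply: contraTF; rewrite !inE negb_or !negbK => /or3P[]/eqP->;
    by rewrite ?XX ?PX ?MX ?d0 ?dotNl ?d11 ?d21 ?oppr0 eqxx.
have A1 : dot (embed R (pA - X)) d1 = 1 by rewrite AX dotDl dotZl d10 d12; ring.
have A2 : dot (embed R (pA - X)) d2 = 2 by rewrite AX dotDl dotZl d20 d22; ring.
have B1 : dot (embed R (pB - X)) d1 = 1 by rewrite BX d10.
have B2 : dot (embed R (pB - X)) d2 = 0 by rewrite BX d20.
have S1 l : dot (embed R (S l - X)) d1 = l%:R by rewrite SX dotDl dotZl d10 d12; ring.
have S2 l : dot (embed R (S l - X)) d2 = 1 by rewrite SX dotDl dotZl d20 d22; ring.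
have cA : c0 pA = CA by rewrite /c0 nT ?eqxx// A1 oner_eq0.
have cB : c0 pB = - CB.
  rewrite /c0 nT ?B1 ?oner_eq0// eqxx ifF//; apply/negP => /eqP BA.
  by move: B2; rewrite BA A2 => /eqP; rewrite pnatr_eq0.
have cS l : (l <= L)%N -> c0 (S l) = - l%:R ^+ 2.
  move=> lL; rewrite /c0 nT ?S2 ?oner_eq0 ?orbT// ifF; last first.
    apply/negP => /eqP SA; have := S2 l; rewrite SA A2 => /eqP.
    by rewrite -subr_eq0 (_ : 2 - 1 = 1) ?oner_eq0//; ring.
  rewrite ifF; last first.
    apply/negP => /eqP SB; have := S2 l; rewrite SB B2 => /esym/eqP.
    by rewrite oner_eq0.
  by rewrite map_f ?S1// mem_iota add0n ltnS.
have i0 k : 0 <= i_ k by rewrite ler0n.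
have iL k : i_ k + 2 <= rL.
  by rewrite /i_ /rL -natrD ler_nat addn2 !ltnS.
have gap k := parabola_gap (i0 k) (iL k).
have rL0 : 0 <= rL by rewrite ler0n.
have VU0 k : VU k < 0.
  by rewrite /VU /y_ /CB /CA; have := i0 k; have := iL k; case: ifP => _ ? ?; nra.
have subA (k : I) : {subset [:: X; X + e1; X - e1; S k.1; S k.1.+1; if k.2 then pA else pB] <=
    lattice_points D}.
  move=> x xk; rewrite in_lattice_points//; apply/asboolP; move: xk.
  rewrite !inE => /or4P[/eqP->|/eqP->|/eqP->|/or3P[]/eqP->];
    try by apply: DX; rewrite !inE eqxx ?orbT.
  - by apply: DS; rewrite ltnW.
  - exact: DS.
  - by case: ifP => _; apply: DX; rewrite !inE eqxx ?orbT.
have gpos (k : I) : general_position R X e1 (S k.1) (S k.1.+1) (if k.2 then pA else pB).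
  split.
    apply/row3_unitP => x y z; rewrite !SX => xyz.
    have [|-> y0 z0] := (row3_unitP _ _ _).1 W0 x (y * i_ k + z * (k.1.+1)%:R) (y + z).
      by rewrite -[RHS]xyz; apply/rowP => j; rewrite !mxE /i_; ring.
    have zE : z = - y by apply/eqP; rewrite -addr_eq0 addrC z0.
    have y00 : y = 0.
      by move: y0; rewrite zE -natr1 -/(i_ k) => h; rewrite -[RHS]oppr0 -[in RHS]h; ring.
    by rewrite zE y00 oppr0.
  have E (l : nat) : i_ k = l%:R -> (2 * i_ k + 1 != 0) && (1 - 2 * i_ k != 0).
    move=> ->; apply/andP; split.
      by rewrite -natrM natr1 pnatr_eq0.
    rewrite subr_eq0 -natrM -[1]/(1%:R) eqr_nat; apply/negP => /eqP; lia.
  have /andP[n1 n2] := E _ erefl.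
  case: k.2.
    (* Solves [(1, 2) = a (i, 1) + b (i + 1, 1)]. Both coefficients are odd integers, hence nonzero,
       and their sum is 2. *)
    exists (2 * i_ k + 1), (1 - 2 * i_ k); split=> //.
      by rewrite (_ : _ + _ = 2) ?(eqr_nat R 2 1)//; ring.
    rewrite AX !SX -natr1 -/(i_ k); apply/rowP => j; rewrite !mxE; ring.
  exists (-1), 1; split; rewrite ?oppr_eq0 ?oner_eq0//.
    by rewrite addNr eq_sym oner_eq0.
  by rewrite BX !SX -natr1 -/(i_ k); apply/rowP => j; rewrite !mxE; ring.
have VUE (k : I) : c0 (S k.1) + vl (S k.1) k = VU k.
  by rewrite cS 1?ltnW// vS /VU /x_ -/(i_ k); ring.
have crit (k : I) : critical_at D c0 X e1 (S k.1) (S k.1.+1) (if k.2 then pA else pB) (p_ k).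
  have c1 : c0 (S k.1) = - i_ k ^+ 2 by rewrite cS// ltnW.
  have c2 : c0 (S k.1.+1) = - (i_ k + 1) ^+ 2 by rewrite cS// -natr1.
  split.
  - have := vT (X + e1) k; rewrite /vl PX !cT ?inE ?eqxx ?orbT// => ->//; ring.
  - have := vT (X + e1) k; rewrite /vl PX !cT ?inE ?eqxx ?orbT// => ->//; ring.
  - by rewrite vD !vS c1 c2 -natr1 -/(i_ k) /x_; ring.
  - by rewrite vD c1 vS -/(i_ k); case: ifP => k2; rewrite ?vA ?vB ?cA ?cB /x_ /y_ k2; ring.
  - by have := VUE k; rewrite -/(vl _ k) (cT X) ?inE ?eqxx// => ->.
  move=> x xA xn; rewrite vD.
  suff : c0 x + vl x k < VU k by rewrite addrA ltrBlDr VUE.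
  have xnT : (x \in [:: X; X + e1; X - e1]) = false.
    by move: xn; rewrite !inE; do 3 case: (x == _) => //=.
  have [xE|xnA] := eqVneq x pA.
    case k2 : k.2; first by move: xn; rewrite xE k2 !inE eqxx !orbT.
    rewrite xE cA vA /VU /y_ /x_ k2 /CB -subr_gt0.
    by have := gap k; congr (is_true (0 < _)); ring.
  have [xE|xnB] := eqVneq x pB.
    case k2 : k.2; last by move: xn; rewrite xE k2 !inE eqxx !orbT.
    rewrite xE cB vB /VU /y_ /x_ k2 /CB -subr_gt0.
    by have := gap k; congr (is_true (0 < _)); ring.
  have [/mapP[l]|xnS] := boolP (x \in [seq S l | l <- iota 0 L.+1]).
    rewrite mem_iota add0n ltnS => /andP[_ lL] xE; rewrite xE cS// vS /VU /x_ -subr_gt0.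
    have := @nat_square_gap l k.1; rewrite -/(i_ k) => h.
    have : 0 < (l%:R - i_ k) * (l%:R - i_ k - 1).
      by apply: h; apply: contraNneq xn => lE; rewrite xE lE !inE eqxx !orbT.
    by congr (is_true (0 < _)); ring.
  have -> : c0 x = - big%:R by rewrite /c0 xnT (negPf xnA) (negPf xnB) (negPf xnS).
  by rewrite addrC; exact: bigP.
(* The first coordinate determines the unit segment. For the two triangles on it the second
   coordinates differ by the positive quantity of [gap]. *)
have p_inj : injective p_.
  move=> k l kl; have := congr1 (dot (embed R e)) kl; have := congr1 (dot (embed R e2)) kl.
  rewrite !dp d10 d20 d12 d22 !(mulr0, mulr1, add0r, addr0) => yE xE.
  have iE : i_ k = i_ l by move: xE => /addIr/mulfI; apply; rewrite pnatr_eq0.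
  have kl1 : k.1 = l.1 by apply/val_inj/eqP; rewrite -(eqr_nat R); exact/eqP.
  case: k l {kl xE} kl1 iE yE (gap k) => [k b] [l b'] /= -> _.
  case: b b' => [] []//; rewrite /y_ /CB /= => yE; rewrite (_ : 4 * rL - _ + _ - _ =
    i_ (l, true) ^+ 2 - i_ (l, true) - 1 - CA -
    (i_ (l, true) + 1 - (CA + 4 * rL) - i_ (l, true) ^+ 2)); try ring.
    by rewrite [X in X - _]yE subrr ltxx.
  by rewrite -[X in X - _]yE subrr ltxx.
have c0Q x : x \in lattice_points D -> is_rational (c0 x).
  move=> _; rewrite /c0; case: ifP => _; first exact: (is_rational_nat _ 0).
  case: ifP => _.
    by rewrite /CA /rL -natrX -natrM; exact: is_rational_nat.
  case: ifP => _.
    by rewrite /CB /CA /rL -natrX -!natrM -natrD; apply/is_rationalN/is_rational_nat.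
  case: ifP => [/mapP[l _ ->]|_]; last exact/is_rationalN/is_rational_nat.
  by rewrite S1 -natrX; apply/is_rationalN/is_rational_nat.
have [c [mc [s [us sP ss]]]] :=
  many_tropical_singular_points finD hullD subA gpos crit p_inj c0Q (Ordinal L0, true).
exists c; split=> //; exists s; split=> //.
by rewrite ss card_prod card_ord card_bool.
Qed.

End ManySingularPoints.

Lemma bigmax_seq_attained (T : eqType) (s : seq T) (F : T -> nat) :
  (0 < \max_(x <- s) F x)%N -> exists2 x, x \in s & F x = (\max_(x <- s) F x)%N.
Proof.
elim: s => [|x s IH]; first by rewrite big_nil.
rewrite big_cons => h; have [le|lt] := leqP (F x) (\max_(y <- s) F y)%N.
  have [|y ys yE] := IH; first by rewrite (maxn_idPr le) in h.
  by exists y; rewrite ?inE ?ys ?orbT// (maxn_idPr le).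
by exists x; rewrite ?inE ?eqxx// (maxn_idPl (ltnW lt)).
Qed.

Section SegmentsInDilates.
Variable R : realType.
Implicit Types (D : set 'rV[R]_3).

Lemma ld_attained D : finite_set [set w | D (embed R w)] -> (0 < ld D)%N ->
  exists u v : 'rV[int]_3, [/\ D (embed R u), D (embed R v) & lattice_length u v = ld D].
Proof.
move=> finD ld0; have [u uA uE] := bigmax_seq_attained ld0.
have [|v vA vE] := @bigmax_seq_attained _ (lattice_points D) (lattice_length u).
  by rewrite uE.
exists u, v; split; last by rewrite vE.
- by move: uA; rewrite in_lattice_points// => /asboolP.
- by move: vA; rewrite in_lattice_points// => /asboolP.
Qed.

Lemma lattice_length_mul (u v : 'rV[int]_3) :
  exists e : 'rV[int]_3, v - u = e *+ lattice_length u v.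
Proof.
exists (\row_(i < 3) divz (v 0 i - u 0 i) (lattice_length u v)%:Z); apply/rowP => i.
rewrite mulmxnE !mxE -mulr_natr natz divzK// dvdzE; exact: biggcdn_inf.
Qed.

Lemma lattice_length_neq0 (u v : 'rV[int]_3) : (0 < lattice_length u v)%N -> u != v.
Proof.
apply: contraTneq => ->; rewrite -leqNgt leqn0 /lattice_length.
by rewrite big1_idem// => i _; rewrite subrr.
Qed.

Lemma dilate_singular_points D k n m (q : 'rV[int]_3) : lattice_polytope D ->
  (forall x : 'rV[R]_3, (forall i, `|x 0 i| <= 4) -> dilate k D (embed R q + x)) ->
  (k <= n)%N -> (0 < m)%N -> (m <= (n - k) * ld (dilate m D))%N ->
  exists c, maximal_dimensional (dilate n D) c /\ exists s : seq 'rV[R]_3,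
    [/\ uniq s, forall p, p \in s -> tropical_singular_point (dilate n D) c p &
    size s = ((((n - k) * ld (dilate m D)) %/ m) * 2)%N].
Proof.
move=> lD box kn m0 mM; set M := ld _ in mM *; set L := (_ %/ m)%N.
have L0 : (0 < L)%N by rewrite divn_gt0.
have M0 : (0 < M)%N by move: (leq_trans m0 mM); rewrite muln_gt0 => /andP[].
have [u [v [Du Dv uvM]]] := ld_attained (lattice_polytope_finite (lattice_polytope_dilate m lD)) M0.
have [e eE] := lattice_length_mul u v.
have [j ej] : exists j, e 0 j != 0.
  apply: contrapT => nex; have /eqP[] : u != v by apply: lattice_length_neq0; rewrite uvM.
  apply/esym/subr0_eq; rewrite eE; apply/rowP => j.
  rewrite mulmxnE mxE; have [->|ej] := eqVneq (e 0 j) 0; first by rewrite mul0rn.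
  by case: nex; exists j.
rewrite uvM -/M in eE.
have LM : (L * m <= (n - k) * M)%N by exact: leq_trunc_div.
have [X DX] := long_segment (lattice_polytope_convex lD) box kn m0 Du Dv eE LM.
pose b (i : 'I_3) : 'rV[int]_3 := delta_mx 0 i.
have b3 i l : `|b i 0 l| <= 1 by rewrite mxE eqxx; case: (l == i).
(* Indices are modulo 3. Since [e] has nonzero coordinate [j], it is independent of the two other
   unit vectors. *)
have [j1 j2 j12] : [/\ j + 1 != j, j + 2 != j & j + 1 != j + 2] by case: j {ej} => -[|[|[|]]].
apply: (big_configuration (X := X) (e := e) (e1 := b (j + 1)) (e2 := b (j + 2))) => //.
- exact: lattice_polytope_dilate.
- apply/row3_unitP => x y z /rowP xyz.
  have coord l : x * (l == j + 1)%:R + y * (e 0 l)%:~R + z * (l == j + 2)%:R = 0.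
    by have := xyz l; rewrite !mxE !eqxx; do 2 case: (l == _).
  have y0 : y = 0.
    have := coord j; rewrite ![j == _]eq_sym (negPf j1) (negPf j2) !mulr0 addr0 add0r.
    by move/eqP; rewrite mulf_eq0 intr_eq0 (negPf ej) orbF => /eqP.
  have := coord (j + 1); have := coord (j + 2).
  by rewrite y0 !eqxx [j + 2 == _]eq_sym (negPf j12) !(mul0r, mulr0, mulr1, add0r, addr0).
- move=> l lL; apply: DX => // i; exact: le_trans (b3 _ _) _.
have DX0 := DX 0%N _ (leq0n _); have DX1 := DX 1%N _ L0; rewrite mulr0n addr0 mulr1n in DX0 DX1.
have bn i (c : int) : `|c| <= 3 -> forall l, `|(b i *~ c) 0 l| <= 3.
  by move=> c3 l; rewrite -scaler_int mxE mxE eqxx /=; case: (l == i); rewrite ?mulr1 ?mulr0// intz.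
have z3 l : `|(0 : 'rV[int]_3) 0 l| <= 3 by rewrite mxE.
move=> x; rewrite !inE => /orP[/eqP->|/orP[/eqP->|/orP[/eqP->|/orP[]/eqP->]]].
- by rewrite -[X]addr0; apply: DX0.
- by apply: DX0; apply: (bn _ 1).
- by apply: DX0; apply: (bn _ (-1)).
- by rewrite -[X + e]addr0; apply: DX1.
by apply: DX1; apply: (bn _ 2).
Qed.

Lemma bounded_fun_cst (T : Type) (c : R) : bounded_fun (fun _ : T => c).
Proof.
exists `|c|; split; first exact: num_real.
by move=> M cM x _; rewrite ltW.
Qed.

End SegmentsInDilates.

Theorem theorem6p1 (R : realType) (D : set 'rV[R]_3) :
  lattice_polytope D -> has_dim D 3 ->
  exists r : nat -> R, bounded_fun r /\
    forall n : nat, (1 <= n)%N ->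
      (n = 1%N -> exists c, maximal_dimensional D c) ->
      exists c : 'rV[int]_3 -> R,
        maximal_dimensional (dilate n D) c /\
        exists s : seq 'rV[R]_3,
          [/\ uniq s,
              forall p, p \in s -> tropical_singular_point (dilate n D) c p &
              2 * n%:R * ld_infty D + r n <= (size s)%:R].
Proof.
move=> lD D3; have cD := lattice_polytope_convex lD.
have [k [q box]] := box_in_dilate cD D3 (B := 4) (ler0n _ _).
set a := ld_infty D.
(* Twice the loss in length: [k |a|] for the [k] copies of [D] reserved for the box, and 1 each for
   approximating the limit and for rounding down to [L]. *)
exists (fun => - (2 * k%:R * `|a| + 4)); split; first exact: bounded_fun_cst.
move=> n n1 Hn.
(* When the bound is not positive the empty list of points suffices, but a surface of maximal
   dimension must still exist: for [n = 1] this is [Hn], for [n >= 2] a small configuration. *)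
have few : 2 * n%:R * a - (2 * k%:R * `|a| + 4) <= 0 ->
    exists c, maximal_dimensional (dilate n D) c /\ exists s : seq 'rV[R]_3, [/\ uniq s,
      forall p, p \in s -> tropical_singular_point (dilate n D) c p &
      2 * n%:R * a + - (2 * k%:R * `|a| + 4) <= (size s)%:R].
  move=> h; have [c mc] : exists c, maximal_dimensional (dilate n D) c.
    case: n n1 Hn {h} => [//|[_ /(_ erefl)|n _ _]]; first by rewrite dilate1.
    exact: maximal_dimensional_dilate.
  by exists c; split=> //; exists [::].
have a0 := normr_ge0 a; have aa := ler_norm a.
have [nk|kn] := leqP n k.
  apply: few; have : n%:R <= k%:R :> R by rewrite ler_nat.
  have : 0 <= n%:R :> R by [].
  by nra.
have k0 : 0 <= k%:R :> R by [].
have n0 : 0 < n%:R :> R by rewrite ltr0n.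
(* Without convergence [limn] has the default value 0, and the bound is negative. *)
have [cv|dv] := pselect (cvgn (fun n : nat => (ld (dilate n D))%:R / n%:R : R)); last first.
  apply: few; have -> : a = 0 by exact: (dvgP dv).
  by rewrite normr0; lra.
(* The tolerance [1 / n] costs at most 1 over the length, because it is multiplied by [n - k]. *)
have [m m0 mM] : exists2 m, (0 < m)%N & a - n%:R^-1 < (ld (dilate m D))%:R / m%:R.
  have [|N _ NP] := @cvgr_dist_lt _ _ _ _ _ _ _ cv n%:R^-1; first by rewrite invr_gt0.
  exists N.+1 => //; have /= := NP N.+1 (leqnSn _).
  by move=> /(le_lt_trans (ler_norm _)); rewrite -[limn _]/a !ltrBlDr addrC.
pose M := ld (dilate m D); pose L := (((n - k) * M) %/ m)%N.
have La : n%:R * a - k%:R * `|a| - 2 <= L%:R.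
  have mR : 0 < m%:R :> R by rewrite ltr0n.
  have LM : ((n - k) * M)%:R / m%:R < L%:R + 1 :> R.
    by rewrite ltr_pdivrMr// natr1 -natrM ltr_nat ltn_ceil.
  have : (n - k)%:R * (a - n%:R^-1) <= L%:R + 1.
    apply: le_trans (ltW LM); rewrite natrM -mulrA ler_wpM2l//; exact: ltW.
  have : (n - k)%:R * n%:R^-1 <= 1 :> R by rewrite ler_pdivrMr// mul1r ler_nat leq_subr.
  rewrite natrB 1?ltnW// => h1 h2.
  have : k%:R * a <= k%:R * `|a| by rewrite ler_wpM2l.
  by lra.
have [L0|L0] := posnP L; first by apply: few; rewrite L0 in La; lra.
have [|c [mc [s [us sP sE]]]] := dilate_singular_points lD box (ltnW kn) m0.
  by rewrite -divn_gt0.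
by exists c; split=> //; exists s; split=> //; rewrite sE natrM; lra.
Qed.
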